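(* Let $(g,G,\mathbf p)_W$ be a local holomorphic deformation of a marked map $g$ with transfer operator $\mathcal A$. Assume that either the triple $(g,G,\mathbf p)_W$ has the lifting property or $(g,G,\mathbf p)_W$ is real and has the real lifting property. Assume also that for all $r<j\le\nu$, $Dg^{q_j-l_j}(c_{l_j,j})\neq1$. Then: (1) all eigenvalues of $\mathcal A$ are contained in $\overline{\mathbb D}$, where $\mathbb D$ is the open unit disc; (2) there is a neighbourhood $W'$ of $\mathbf c_1$ in $W$ such that $\{\mathbf w\in W':\mathcal R(\mathbf w)=0\}$ is a smooth submanifold of $W'$, and its dimension is equal to the geometric multiplicity of the eigenvalue $1$ of $\mathcal A$.
   Context: **Marked map.** A marked map is a map $g:P_0\cup U\to\mathbb C$, where $P_0\subset\mathbb C$ is finite and $U\subset\mathbb C$ is open, together with a finite set $P\supset P_0$ such that $g(P)\subset P$, $P\setminus P_0\subset U$, $g|_U$ is holomorphic and $g'(x)\ne 0$ for $x\in P\setminus P_0$. Write $P_0=\{c_{0,1},\dots,c_{0,\nu}\}$ (distinct points), $c_{n,j}=g^n(c_{0,j})$, $\mathbf c_0=(c_{0,j})_j$, $\mathbf c_1=(c_{1,j})_j$. **Local holomorphic deformation.** $(g,G,\mathbf p)_W$ consists of an open connected $W\subset\mathbb C^\nu$ containing $\mathbf c_1$, a holomorphic map $\mathbf p=(p_1,\dots,p_\nu):W\to\mathbb C^\nu$ with $\mathbf p(\mathbf c_1)=\mathbf c_0$, and a holomorphic map $G:W\times U\to\mathbb C$, $(w,z)\mapsto G_w(z)$, with $G_{\mathbf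 c_1}=g|_U$. It is real if $P\subset\mathbb R$, $U$ and $W$ are conjugation invariant, $g(\bar z)=\overline{g(z)}$, $G_{\overline w}(\overline z)=\overline{G_w(z)}$ and $p_j(\overline w)=\overline{p_j(w)}$. **Critical relations.** For each $j$ exactly one of the following holds: (a) there are $q_j>0$ and $\mu(j)\in\{1,\dots,\nu\}$ with $g^{q_j}(c_{0,j})=c_{0,\mu(j)}$ and $g^k(c_{0,j})\notin P_0$ for $1\le k<q_j$; (b) there are $1\le l_j<q_j$ with $g^{q_j}(c_{0,j})=g^{l_j}(c_{0,j})$ and $g^k(c_{0,j})\notin P_0$ for $1\le k\le q_j$. Fix such integers, and label so that (a) holds for $1\le j\le r$ and (b) for $r<j\le\nu$. Near $\mathbf c_1$ define $\mathcal R=(R_1,\dots,R_\nu)$ by $R_j(w)=G_w^{q_j-1}(w_j)-p_{\mu(j)}(w)$ for $1\le j\le r$ and $R_j(w)=G_w^{q_j-1}(w_j)-G_w^{l_j-1}(w_j)$ for $r<j\le\nu$. **Motions and lifts.** A holomorphic motion $h_\lambda$ of $g(P)$ over $(\Lambda,0)$ is a family of injections $h_\lambda:g(P)\to\mathbb C$, $\lambda\in\Lambda$ (a domain containing $0$), holomorphic in $\lambda$ with $h_0=\mathrm{id}$; it is real if $\Lambda$ is symmetric with respect to $\mathbb R$ and $h_\lambda(x)\in\mathbb R$ for real $\lambda$. With $\mathbf c_1(\lambda)=(h_\lambda(c_{1,j}))_j$, a holomorphic motion $\hat h_\lambda$ of $g(P)$ is a lift of $h_\lambda$ over $\Lambda_0\ni0$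 if for $\lambda\in\Lambda_0$: $\hat h_\lambda(c_{0,j})=p_j(\mathbf c_1(\lambda))$ for $c_{0,j}\in g(P)$, and $G_{\mathbf c_1(\lambda)}(\hat h_\lambda(x))=h_\lambda(g(x))$ for $x\in g(P)\setminus P_0$. The lifting property: for each holomorphic motion $h^{(0)}_\lambda$ of $g(P)$ over $(\mathbb D,0)$ there exist $\varepsilon>0$, $M>0$ and holomorphic motions $h^{(k)}_\lambda$ ($k\ge1$) of $g(P)$ over $(\mathbb D_\varepsilon,0)$, $\mathbb D_\varepsilon=\{|\lambda|<\varepsilon\}$, such that for every $k\ge0$, $h^{(k+1)}_\lambda$ is a lift of $h^{(k)}_\lambda$ over $\mathbb D_\varepsilon$ and $|h^{(k)}_\lambda(x)|\le M$ for all $x\in g(P)$, $\lambda\in\mathbb D_\varepsilon$. The real lifting property (for real $(g,G,\mathbf p)_W$): the same for all real $h_\lambda^{(0)}$. **Transfer operator.** $\mathcal A:\mathbb C^{\#g(P)}\to\mathbb C^{\#g(P)}$ is the linear map sending $\left\{\frac{d}{d\lambda}h_\lambda(x)|_{\lambda=0}\right\}_{x\in g(P)}$ to $\left\{\frac{d}{d\lambda}\hat h_\lambda(x)|_{\lambda=0}\right\}_{x\in g(P)}$ whenever $\hat h_\lambda$ is a lift of $h_\lambda$. Explicitly, $(\mathcal Av)(c_{0,j})=\sum_k\frac{\partial p_j}{\partial w_k}(\mathbf c_1)v(c_{1,k})$ for $c_{0,j}\in g(P)$ and $(\mathcal Av)(x)=\frac1{g'(x)}\Big(v(g(x))-\sum_k\frac{\partial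 G_w(x)}{\partial w_k}\big|_{w=\mathbf c_1}v(c_{1,k})\Big)$ for $x\in g(P)\setminus P_0$.
   Formalization: Part (2) is proved assuming every cycle of g in P outside the forward orbit of P_0 has multiplier ≠ 1; otherwise the dimension claim fails (e.g. P_0={2}, P={0,2}, g=id near 0, p(w)=2+(w-2)/2). The condition is void if P is the forward orbit of P_0. *)

(* Defs.v *)
From HB Require Import structures.
From mathcomp Require Import all_boot all_order all_algebra.
From mathcomp Require Import finmap.
From mathcomp Require Import all_classical all_reals all_analysis.
From mathcomp Require Import complex.

Set Implicit Arguments.
Unset Strict Implicit.
Unset Printing Implicit Defensive.

Import Order.TTheory GRing.Theory Num.Theory numFieldNormedType.Exports.

Local Open Scope classical_set_scope.
Local Open Scope ring_scope.

(* The cast to numClosedFieldType gives R[i] the norm topology that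
   MathComp-Analysis puts on every numFieldType.  For eps : cplx R the order
   makes 0 < eps mean that eps is a positive real number. *)
Definition cplx (R : realType) : numClosedFieldType := R[i].

Section ComplexGeometry.
Context {R : realType}.
Local Notation C := (cplx R).

(* differentiable is Frechet differentiability over the scalar field C. *)
Definition holomorphic_on (V1 V2 : normedModType C) (D : set V1)
    (f : V1 -> V2) : Prop :=
  forall z, D z -> differentiable f z.

Definition disc (rho : C) : set C := [set z | `|z| < rho].

Definition flat {n} (d : nat) : set 'rV[C]_n :=
  [set y | forall i : 'I_n, (d <= i)%N -> y 0 i = 0].

(* Embedded complex submanifold, of complex dimension d, of the open set
   Omega: it is straightened to C^d x {0} by local biholomorphisms phi, with
   inverse psi.  Without d <= n an open set would be flat of dimension d. *)
Definition submanifold {n} (Omega : set 'rV[C]_n) (d : nat)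
    (S : set 'rV[C]_n) : Prop :=
  [/\ S `<=` Omega, (d <= n)%N &
   forall a, S a ->
   exists (V : set 'rV[C]_n) (phi psi : 'rV[C]_n -> 'rV[C]_n),
     [/\ open V, V a, V `<=` Omega & open (phi @` V)] /\
     [/\ holomorphic_on V phi, holomorphic_on (phi @` V) psi,
         forall x, V x -> psi (phi x) = x
       & phi @` (S `&` V) = (phi @` V) `&` flat d]].

End ComplexGeometry.

Section MarkedMaps.
Context {R : realType}.
Local Notation C := (cplx R).

(* g is a total function; only its values on P0 and U are ever constrained. *)
Variables (nu : nat) (c0 : 'rV[C]_nu) (U : set C) (g : C -> C).
Variable P : {fset C}.

Definition P0 : {fset C} := [fset c0 0 j | j in 'I_nu]%fset.

(* The row of the c_{n,j}. *)
Definition crit (n : nat) : 'rV[C]_nu := map_mx (iter n g) c0.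

Definition gP : {fset C} := [fset g x | x in P]%fset.

Record marked_map : Prop := MarkedMap {
  mm_distinct : injective (fun j : 'I_nu => c0 0 j);
  mm_open : open U;
  mm_P0 : (P0 `<=` P)%fset;
  mm_stable : forall x, x \in P -> g x \in P;
  mm_P : forall x, x \in P -> x \notin P0 -> U x;
  mm_holomorphic : holomorphic_on U g;
  mm_noncritical : forall x, x \in P -> x \notin P0 -> derive1 g x != 0
}.

Variables (W : set 'rV[C]_nu) (p : 'rV[C]_nu -> 'rV[C]_nu).
Variable G : 'rV[C]_nu -> C -> C.

Record local_deformation : Prop := LocalDeformation {
  ld_open : open W;
  ld_connected : connected W;
  ld_base : W (crit 1);
  ld_p : holomorphic_on W p;
  ld_p_base : p (crit 1) = c0;
  ld_G : holomorphic_on (W `*` U) (fun wz : 'rV[C]_nu * C => G wz.1 wz.2);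
  ld_G_base : forall z, U z -> G (crit 1) z = g z
}.

Definition conj_row (w : 'rV[C]_nu) : 'rV[C]_nu := map_mx Num.conj w.

Record real_deformation : Prop := RealDeformation {
  rd_P : forall x, x \in P -> x \is Num.real;
  rd_U : forall z, U z -> U z^*;
  rd_W : forall w, W w -> W (conj_row w);
  rd_g : forall z, z \in P0 \/ U z -> g z^* = (g z)^*;
  rd_G : forall w z, W w -> U z -> G (conj_row w) z^* = (G w z)^*;
  rd_p : forall w, W w -> p (conj_row w) = conj_row (p w)
}.

(* With 0-based indices, relation (a) holds for j < r and (b) for r <= j; the
   values of l below r and of mu from r on are irrelevant.  That only one of
   (a) and (b) can hold for a given j follows from the conditions on P0. *)
Record critical_relations (r : nat) (q l : 'I_nu -> nat)
    (mu : 'I_nu -> 'I_nu) : Prop := CriticalRelations {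
  cr_r : (r <= nu)%N;
  cr_a : forall j : 'I_nu, (j < r)%N ->
    [/\ (0 < q j)%N, iter (q j) g (c0 0 j) = c0 0 (mu j)
      & forall k, (1 <= k < q j)%N -> iter k g (c0 0 j) \notin P0];
  cr_b : forall j : 'I_nu, (r <= j)%N ->
    [/\ (1 <= l j < q j)%N, iter (q j) g (c0 0 j) = iter (l j) g (c0 0 j)
      & forall k, (1 <= k <= q j)%N -> iter k g (c0 0 j) \notin P0]
}.

(* The open set on which all the compositions in relation_map make sense. *)
Definition relation_domain (q : 'I_nu -> nat) : set 'rV[C]_nu :=
  [set w | W w /\
     forall j k, (k < (q j).-1)%N -> U (iter k (G w) (w 0 j))].

Definition relation_map (r : nat) (q l : 'I_nu -> nat) (mu : 'I_nu -> 'I_nu)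
    (w : 'rV[C]_nu) : 'rV[C]_nu :=
  \row_j (iter (q j).-1 (G w) (w 0 j) -
          (if (j < r)%N then p w 0 (mu j) else iter (l j).-1 (G w) (w 0 j))).

(* Motions are functions of (lambda, x), used for lambda in Lam and x in g(P)
   only.  Lam is only ever a disc centred at 0, so that the conditions on the
   parameter domain (a symmetric domain containing 0) are automatic. *)
Definition holomorphic_motion (Lam : set C) (h : C -> C -> C) : Prop :=
  [/\ forall lam, Lam lam -> {in gP &, injective (h lam)},
      forall x, x \in gP -> holomorphic_on Lam (fun lam => h lam x)
    & forall x, x \in gP -> h 0 x = x].

Definition real_motion (Lam : set C) (h : C -> C -> C) : Prop :=
  holomorphic_motion Lam h /\
  forall lam x, Lam lam -> lam \is Num.real -> x \in gP ->
    h lam x \is Num.real.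

Definition motion_c1 (h : C -> C -> C) (lam : C) : 'rV[C]_nu :=
  map_mx (h lam) (crit 1).

(* The memberships in W and U say that p and G are evaluated inside their
   domains of definition. *)
Definition is_lift (Lam0 : set C) (h hhat : C -> C -> C) : Prop :=
  forall lam, Lam0 lam ->
  [/\ W (motion_c1 h lam),
      forall j, c0 0 j \in gP -> hhat lam (c0 0 j) = p (motion_c1 h lam) 0 j
    & forall x, x \in gP -> x \notin P0 ->
        U (hhat lam x) /\ G (motion_c1 h lam) (hhat lam x) = h lam (g x)].

(* eps <= 1 because h0 is a motion over the unit disc only. *)
Definition liftable (h0 : C -> C -> C) : Prop :=
  exists (eps M : C) (h : nat -> C -> C -> C),
  [/\ 0 < eps <= 1, 0 < M, h 0%N = h0,
      forall k, holomorphic_motion (disc eps) (h k.+1)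
    & forall k, is_lift (disc eps) (h k) (h k.+1) /\
        forall x lam, x \in gP -> disc eps lam -> `|h k lam x| <= M].

Definition lifting_property : Prop :=
  forall h0, holomorphic_motion (disc 1) h0 -> liftable h0.

Definition real_lifting_property : Prop :=
  forall h0, real_motion (disc 1) h0 -> liftable h0.

(* Extension by 0 of a vector indexed by g(P).  It is only evaluated at points
   of g(P). *)
Definition at_pt (v : {ffun gP -> C^o}) (y : C) : C := oapp v 0 (insub y).

Definition transfer_fun (v : {ffun gP -> C^o}) : {ffun gP -> C^o} :=
  [ffun x : gP =>
     if [pick j | c0 0 j == val x] is Some j
     then \sum_k 'D_('e_k) (fun w => p w 0 j) (crit 1)
                 * at_pt v (crit 1 0 k) : C^o
     else (derive1 g (val x))^-1
          * (at_pt v (g (val x))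
             - \sum_k 'D_('e_k) (fun w => G w (val x)) (crit 1)
                      * at_pt v (crit 1 0 k))].

Lemma at_pt_linear a u v y :
  at_pt (a *: u + v) y = a * at_pt u y + at_pt v y.
Proof. by rewrite /at_pt; case: insub => [x|] /=; rewrite ?ffunE ?mulr0 ?addr0. Qed.

Lemma transfer_fun_linear : linear transfer_fun.
Proof.
have sumP (F : 'I_nu -> C) a (u v : {ffun gP -> C^o}) :
  \sum_k F k * at_pt (a *: u + v) (crit 1 0 k) =
  a * (\sum_k F k * at_pt u (crit 1 0 k)) + \sum_k F k * at_pt v (crit 1 0 k).
  rewrite mulr_sumr -big_split; apply: eq_bigr => k _ /=.
  by rewrite at_pt_linear mulrDr mulrCA.
move=> a u v; apply/ffunP => x; rewrite !ffunE.
case: pickP => [j _|_] /=; first by rewrite sumP.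
by rewrite sumP at_pt_linear opprD addrACA -mulrBr mulrDr mulrCA.
Qed.

HB.instance Definition _ :=
  GRing.isLinear.Build C {ffun gP -> C^o} {ffun gP -> C^o} _ transfer_fun
    transfer_fun_linear.

Definition transfer : 'End({ffun gP -> C^o}) := linfun transfer_fun.

(* P is an arbitrary finite invariant set, so it may contain cycles outside the
   forward orbit of P0.  On such a cycle of multiplier 1 there is an
   eigenvector of the transfer operator for the eigenvalue 1 that vanishes at
   all the points of the forward orbit of P0, and hence is not seen by the
   critical relations.  The condition is void if P is the forward orbit
   of P0. *)
Definition no_extra_multiplier_one : Prop :=
  forall (x : C) (n : nat), x \in P ->
    (0 < n)%N -> iter n g x = x ->
    (forall m, (0 < m < n)%N -> iter m g x <> x) ->
    (forall (j : 'I_nu) (m : nat), iter m g (c0 0 j) <> x) ->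
    derive1 (iter n g) x <> 1.

End MarkedMaps.

(* Main.v *)
Require Import Defs.
From HB Require Import structures.
From mathcomp Require Import all_boot all_order all_algebra.
From mathcomp Require Import finmap perm.
From mathcomp Require Import all_classical all_reals all_analysis.
From mathcomp Require Import complex ring lra zify.

Set Implicit Arguments.
Unset Strict Implicit.
Unset Printing Implicit Defensive.

Import Order.TTheory GRing.Theory Num.Theory numFieldNormedType.Exports.
Local Open Scope classical_set_scope.
Local Open Scope ring_scope.

(* The iterated lifts of a motion with velocity v have velocities A^n v and are
   uniformly bounded, so the powers of A are bounded; this gives (1).

   For (2), let h be a curve that agrees with its lift up to an error
   t^k b + o(t^k).  Its n-th lift is h + t^k (b + A b + ... + A^(n-1) b) + o(t^k),
   so that these sums are bounded, b = w - A w for some w, and h + t^k w agrees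
   with its lift up to o(t^k).  Hence every v with A v = v is tangent, for every
   k, to a curve along which the critical relations hold up to o(t^k).
   Linearizing the relations along orbits, where the multiplier conditions
   exclude other solutions, shows that v |-> v(c_1) maps ker (A - 1) onto
   ker DR.  In coordinates that straighten rank DR components of R, the other
   components therefore vanish to infinite order along each direction of ker DR
   on the zero set of the first ones, hence identically.  In the real case the
   curves exist for real directions only, and a polynomial vanishing on these
   vanishes. *)

(** The corrections [w] come with no bound uniform in [k], so the curves are not known to converge
    to one along which the relations hold exactly. Each order has its own curve, and vanishing to
    infinite order must be turned into vanishing by estimates that see finitely many terms: Taylor
    polynomials with a geometric remainder on a disc. These come from Cauchy's formula on squares;
    functions of several variables are reached by restriction to complex lines. The radius and the
    bound in the lifting property depend on the motion. This is harmless, because one finite bound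
    for each motion is enough. A curve need not have a lift, and it need not be injective on g(P).
    Agreement with the lift is therefore expressed by the equations of a lift up to o(t^k), and a
    curve is rescaled in t to a motion over the unit disc before it is lifted. Curves and lifts are
    compared by strict differentiability, since both of the compared points move. *)

(** * Real-valued norms and differentiability by estimates *)

Section NormReal.
Context {R : realType}.
Local Notation C := (cplx R).

(* The order of cplx R is partial, so norms are moved to R. *)
Definition nm {V : normedModType C} (x : V) : R := complex.Re `|x|.

Lemma nmE (V : normedModType C) (x : V) : `|x| = (nm x)%:C%C.
Proof. by rewrite /nm RRe_real // normr_real. Qed.

Lemma nm_ge0 (V : normedModType C) (x : V) : 0 <= nm x.
Proof. by rewrite -ler0c -nmE. Qed.

Lemma nm0 (V : normedModType C) : nm (0 : V) = 0.
Proof. by apply: complexI; rewrite -nmE normr0. Qed.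

Lemma nm_eq0 (V : normedModType C) (x : V) : nm x = 0 -> x = 0.
Proof. by move=> h; apply/normr0_eq0; rewrite nmE h. Qed.

Lemma nmN (V : normedModType C) (x : V) : nm (- x) = nm x.
Proof. by rewrite /nm normrN. Qed.

Lemma nmD (V : normedModType C) (x y : V) : nm (x + y) <= nm x + nm y.
Proof. by rewrite -lecR rmorphD /= -!nmE ler_normD. Qed.

Lemma nmB (V : normedModType C) (x y : V) : nm (x - y) <= nm x + nm y.
Proof. by rewrite -[nm y]nmN nmD. Qed.

Lemma nmC (V : normedModType C) (x y : V) : nm (x - y) = nm (y - x).
Proof. by rewrite -nmN opprB. Qed.

Lemma nmZ (V : normedModType C) (a : C) (x : V) : nm (a *: x) = nm a * nm x.
Proof. by apply: complexI; rewrite rmorphM /= -!nmE normrZ. Qed.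

Lemma nmM (a x : C) : nm (a * x) = nm a * nm x.
Proof. by apply: complexI; rewrite rmorphM /= -!nmE normrM. Qed.

Lemma nmX (a : C) n : nm (a ^+ n) = nm a ^+ n.
Proof. by apply: complexI; rewrite rmorphXn /= -!nmE normrX. Qed.

Lemma nmV (a : C) : nm (a^-1) = (nm a)^-1.
Proof. by apply: complexI; rewrite fmorphV /= -!nmE normfV. Qed.

Lemma nm1 : nm (1 : C) = 1.
Proof. by apply: complexI; rewrite -nmE normr1. Qed.

Lemma nmR (a : R) : nm (a%:C%C : C) = `|a|.
Proof.
by apply: complexI; rewrite -nmE normc_def /= expr0n /= addr0 sqrtr_sqr.
Qed.

Lemma nm_sum (V : normedModType C) (I : Type) (s : seq I) (Q : pred I) (F : I -> V) :
  nm (\sum_(i <- s | Q i) F i) <= \sum_(i <- s | Q i) nm (F i).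
Proof.
elim/big_rec2: _ => [|i x y _ h]; first by rewrite nm0.
by apply: (le_trans (nmD _ _)); rewrite lerD2l.
Qed.

Lemma nm_i : nm ('i%C : C) = 1.
Proof. by apply: complexI; rewrite -nmE normc_def /= expr0n expr1n add0r sqrtr1. Qed.

Lemma nm_Re (z : C) : `|complex.Re z| <= nm z.
Proof. by rewrite -lecR -nmE; exact: normc_ge_Re. Qed.

Lemma nm_Im (z : C) : `|complex.Im z| <= nm z.
Proof.
have -> : complex.Im z = complex.Re (- 'i%C * z) by case: z => a b /=; ring.
apply: (le_trans (nm_Re _)); rewrite nmM nmN.
by rewrite nm_i mul1r.
Qed.

Lemma nm_ReIm (z : C) : nm z <= `|complex.Re z| + `|complex.Im z|.
Proof.
rewrite {1}(complexE z); apply: (le_trans (nmD _ _)).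
rewrite nmR nmM nmR lerD2l.
by rewrite nm_i mul1r.
Qed.

Lemma nbhs_nm (V : normedModType C) (x : V) (A : set V) :
  nbhs x A <-> exists2 d : R, 0 < d & forall y, nm (y - x) < d -> A y.
Proof.
split.
- move/nbhs_ballP => [e /= e0 h].
  exists (complex.Re e); first by move: e0; rewrite ltcE /= => /andP[].
  move=> y hy; apply: h; rewrite -ball_normE /= distrC nmE.
  by rewrite -[e]RRe_real ?ltcR // gtr0_real.
- move=> [d d0 h]; apply/nbhs_ballP; exists (d%:C)%C; first by rewrite /= ltcR.
  by move=> y; rewrite -ball_normE /= distrC nmE ltcR; exact: h.
Qed.

(** The norm of a row is the maximum of the norms of its entries; the sign of [d] matters when there
    are no entries. *)
Lemma nm_rV n (x : 'rV[C]_n) (d : R) : 0 <= d ->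
  (nm x <= d) <-> (forall i, nm (x 0 i) <= d).
Proof.
move=> d0; have : (0 : C) <= d%:C%C by rewrite lecR.
rewrite -lecR -nmE.
have -> : (forall i, nm (x 0 i) <= d) <-> (forall i, `|x 0 i| <= d%:C%C).
  by split=> h i; have := h i; rewrite nmE lecR.
move: (d%:C%C : C) => D /nonnegP [e].
rewrite {1}/Num.norm /= mx_normE num_le; split.
  by move=> /bigmax_leP [_ h] i; have := h (0, i) isT.
move=> h; apply/bigmax_leP; split => [|[i j] _ /=]; first by rewrite -num_le /=.
by rewrite -num_le /= ord1; exact: h.
Qed.

Lemma nm_coord n (x : 'rV[C]_n) i : nm (x 0 i) <= nm x.
Proof. by have [h _] := nm_rV x (nm_ge0 x); exact: h. Qed.

Lemma nm_pair (V W : normedModType C) (x : V) (y : W) (d : R) :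
  (nm (x, y) <= d) = (nm x <= d) && (nm y <= d).
Proof.
rewrite -lecR -nmE prod_normE /= !nmE.
have -> (a b : R) : Num.max a%:C%C b%:C%C = (Num.max a b)%:C%C :> C.
  by rewrite /Order.max ltcR; case: ifP.
by rewrite lecR ge_max.
Qed.

Lemma nm_pair_lt (V W : normedModType C) (x : V) (y : W) (d : R) :
  (nm (x, y) < d) = (nm x < d) && (nm y < d).
Proof.
rewrite -ltcR -nmE prod_normE /= !nmE.
have -> (a b : R) : Num.max a%:C%C b%:C%C = (Num.max a b)%:C%C :> C.
  by rewrite /Order.max ltcR; case: ifP.
by rewrite ltcR gt_max.
Qed.

Lemma differentiable_eps (V W : normedModType C) (f : V -> W) (x : V) :
  differentiable f x -> forall e : R, 0 < e -> exists2 d : R, 0 < d &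
  forall h, nm h < d -> nm (f (x + h) - f x - 'd f x h) <= e * nm h.
Proof.
move=> /diff_locally /eqaddoP h e e0.
have /h /nbhs_nm [d d0 hd] : 0 < (e%:C)%C :> C by rewrite ltcR.
exists d => // k hk; have := hd k; rewrite subr0 => /(_ hk).
by rewrite !nmE /= -rmorphM /= lecR /cst /= opprD addrA [x + k]addrC.
Qed.

Lemma linear_nm_bounded (V W : normedModType C) (L : {linear V -> W}) :
  continuous L -> exists2 K : R, 0 < K & forall h, nm (L h) <= K * nm h.
Proof.
move=> /linear_lipschitz [k k0 hk].
have kE : k = (complex.Re k)%:C%C by rewrite RRe_real // gtr0_real.
exists (complex.Re k); first by rewrite -ltcR -kE.
by move=> h; rewrite -lecR rmorphM /= -kE -!nmE.
Qed.

(** The bound [K] makes [L] continuous, which differentiability requires of a derivative and which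
    is not automatic on an arbitrary normed space. *)
Lemma eps_differentiable (V W : normedModType C) (f : V -> W) (x : V)
  (L : {linear V -> W}) (K : R) : (forall h, nm (L h) <= K * nm h) ->
  (forall e : R, 0 < e -> exists2 d : R, 0 < d &
  forall h, nm h < d -> nm (f (x + h) - f x - L h) <= e * nm h) ->
  differentiable f x /\ 'd f x = L :> (V -> W).
Proof.
move=> hK hL.
have Lc : continuous L.
  move=> z A /nbhs_nm [d d0 hd]; apply/nbhs_nm.
  have K1 : 0 < `|K| + 1 by rewrite ltr_wpDl.
  exists (d / (`|K| + 1)); first by rewrite divr_gt0.
  move=> y hy; apply: hd; rewrite -linearB; apply: (le_lt_trans (hK _)).
  apply: (@le_lt_trans _ _ ((`|K| + 1) * nm (y - z))).
    rewrite ler_wpM2r ?nm_ge0 //; apply: (le_trans (ler_norm _)).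
    by rewrite lerDl.
  by rewrite mulrC -ltr_pdivlMr.
have fL : f \o shift x = cst (f x) + L +o_ 0 id.
  apply/eqaddoP => e e0; have eE : e = (complex.Re e)%:C%C.
    by rewrite RRe_real // gtr0_real.
  have [|d d0 hd] := hL (complex.Re e); first by rewrite -ltcR -eE.
  apply/nbhs_nm; exists d => // y; rewrite subr0 => /hd.
  by rewrite !nmE eE -rmorphM /= lecR /cst /= opprD addrA [x + y]addrC.
split; last exact: diff_unique.
apply/diff_locallyP; rewrite (diff_unique Lc fL); split => //.
Qed.
End NormReal.

(** * Integration over rectangles and Taylor polynomials *)

Section ComplexIntegral.
Context {R : realType}.
Local Notation C := (cplx R).
Local Notation Re := (@complex.Re R).
Local Notation Im := (@complex.Im R).
Local Notation mu := (@lebesgue_measure R).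

(** The points [y] range over all of [R], so continuity at the end points is two-sided; the
    integrands are restrictions of functions continuous at each point of the segment. *)
Definition cts (a b : R) (f : R -> C) : Prop :=
  forall x, a <= x <= b -> forall e : R, 0 < e ->
  exists2 d : R, 0 < d & forall y, `|y - x| < d -> nm (f y - f x) < e.

Definition cint (a b : R) (f : R -> C) : C :=
  (\int[mu]_(x in `[a, b]) Re (f x) +i* \int[mu]_(x in `[a, b]) Im (f x))%C.

Lemma cReD (x y : C) : Re (x + y) = Re x + Re y.
Proof. by case: x y => [? ?] [? ?]. Qed.

Lemma cImD (x y : C) : Im (x + y) = Im x + Im y.
Proof. by case: x y => [? ?] [? ?]. Qed.

Lemma cReN (x : C) : Re (- x) = - Re x.
Proof. by case: x => [? ?]. Qed.

Lemma cImN (x : C) : Im (- x) = - Im x.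
Proof. by case: x => [? ?]. Qed.

Lemma cReM (x y : C) : Re (x * y) = Re x * Re y - Im x * Im y.
Proof. by case: x y => [? ?] [? ?]. Qed.

Lemma cImM (x y : C) : Im (x * y) = Re x * Im y + Im x * Re y.
Proof. by case: x y => [? ?] [? ?]. Qed.

Lemma complex_ext (x y : C) : Re x = Re y -> Im x = Im y -> x = y.
Proof. by case: x y => [? ?] [? ?] /= -> ->. Qed.

Lemma cts_integrable a b (f : R -> C) (T : C -> R) :
  (forall x y, T (x - y) = T x - T y) -> (forall x, `|T x| <= nm x) ->
  cts a b f -> mu.-integrable `[a, b] (EFin \o (T \o f)).
Proof.
move=> TB Tn hf; apply: continuous_compact_integrable; first exact: segment_compact.
apply: continuous_in_subspaceT => x; rewrite inE /= in_itv /= => hx.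
move=> A /nbhs_ballP [e /= e0 he]; have [d d0 hd] := hf x hx e e0.
apply/nbhs_ballP; exists d => // y; rewrite -ball_normE /= distrC => hy.
apply: he; rewrite -ball_normE /=.
suff : `|T (f y) - T (f x)| < e by rewrite distrC.
by rewrite -TB; apply: (le_lt_trans (Tn _)); exact: hd.
Qed.

Lemma cts_Re a b (f : R -> C) : cts a b f -> mu.-integrable `[a, b] (EFin \o (Re \o f)).
Proof.
by apply: cts_integrable => [x y|x]; [rewrite cReD cReN|exact: nm_Re].
Qed.

Lemma cts_Im a b (f : R -> C) : cts a b f -> mu.-integrable `[a, b] (EFin \o (Im \o f)).
Proof.
by apply: cts_integrable => [x y|x]; [rewrite cImD cImN|exact: nm_Im].
Qed.

Lemma cts_cst a b c : cts a b (fun=> c).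
Proof. by move=> x _ e e0; exists 1 => // y _; rewrite subrr nm0. Qed.

Lemma ctsD a b (f g : R -> C) : cts a b f -> cts a b g -> cts a b (fun x => f x + g x).
Proof.
move=> hf hg x hx e e0; have e2 : 0 < e / 2 by rewrite divr_gt0.
have [d d0 hd] := hf x hx _ e2; have [k k0 hk] := hg x hx _ e2.
exists (Num.min d k) => [|y]; first by rewrite lt_min d0.
rewrite lt_min => /andP [/hd h1 /hk h2].
rewrite opprD addrACA; apply: (le_lt_trans (nmD _ _)); lra.
Qed.

Lemma ctsZ a b c (f : R -> C) : cts a b f -> cts a b (fun x => c * f x).
Proof.
move=> hf x hx e e0; have c1 : 0 < nm c + 1 by rewrite ltr_wpDl ?nm_ge0.
have [d d0 hd] := hf x hx (e / (nm c + 1)) (divr_gt0 e0 c1).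
exists d => // y /hd; rewrite -mulrBr nmM ltr_pdivlMr // => h.
apply: le_lt_trans h; rewrite mulrDr mulr1 mulrC.
by rewrite lerDl nm_ge0.
Qed.

Lemma ctsB a b (f g : R -> C) : cts a b f -> cts a b g -> cts a b (fun x => f x - g x).
Proof.
move=> hf hg x hx e e0; have [d d0 hd] := ctsD hf (ctsZ (-1) hg) hx e0.
by exists d => // y /hd; rewrite !mulN1r.
Qed.

Lemma cintD a b (f g : R -> C) : cts a b f -> cts a b g ->
  cint a b (fun x => f x + g x) = cint a b f + cint a b g.
Proof.
move=> hf hg; apply: complex_ext; rewrite ?cReD ?cImD /=.
  under eq_Rintegral do rewrite cReD.
  by rewrite RintegralD //; [exact: (cts_Re hf)|exact: (cts_Re hg)].
under eq_Rintegral do rewrite cImD.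
by rewrite RintegralD //; [exact: (cts_Im hf)|exact: (cts_Im hg)].
Qed.

Lemma cintZ a b c (f : R -> C) : cts a b f ->
  cint a b (fun x => c * f x) = c * cint a b f.
Proof.
move=> hf.
have h (k : R) (T : C -> R) : mu.-integrable `[a, b] (EFin \o (T \o f)) ->
    mu.-integrable `[a, b] (EFin \o (fun x => k * T (f x))).
  move=> hi; rewrite (_ : _ \o _ = (fun x => k%:E * (T (f x))%:E)%E).
    exact: integrableZl.
  by apply/funext => x; rewrite /= EFinM.
have [hR hI] := (cts_Re hf, cts_Im hf).
apply: complex_ext; rewrite ?cReM ?cImM /=.
  under eq_Rintegral do rewrite cReM.
  by rewrite RintegralB ?RintegralZl //; exact: h.
under eq_Rintegral do rewrite cImM.
by rewrite RintegralD ?RintegralZl //; exact: h.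
Qed.

Lemma cintB a b (f g : R -> C) : cts a b f -> cts a b g ->
  cint a b (fun x => f x - g x) = cint a b f - cint a b g.
Proof.
move=> hf hg; have -> : (fun x => f x - g x) = (fun x => f x + -1 * g x).
  by apply/funext => x; rewrite mulN1r.
rewrite cintD ?cintZ ?mulN1r //; exact: ctsZ.
Qed.

Lemma eq_cint a b (f g : R -> C) : (forall x, a <= x <= b -> f x = g x) ->
  cint a b f = cint a b g.
Proof.
by move=> h; apply: complex_ext => /=; apply: eq_Rintegral => x;
  rewrite inE /= in_itv /= => /h ->.
Qed.

Lemma cint_cst a b c : a <= b -> cint a b (fun=> c) = (b - a)%:C%C * c.
Proof.
move=> ab; have h : fine (mu `[a, b]%classic) = b - a.
  rewrite lebesgue_measure_itv /= lte_fin; move: ab.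
  by rewrite le_eqVlt => /orP [/eqP ->|->] //; rewrite ltxx subrr.
apply: complex_ext; rewrite /= Rintegral_cst // h;
  rewrite ?cReM ?cImM /= mul0r ?addr0 ?subr0; exact: mulrC.
Qed.

Lemma cint_split a m b (f : R -> C) : a <= m <= b -> cts a b f ->
  cint a b f = cint a m f + cint m b f.
Proof.
move=> /andP [am mb] hf.
have h (T : C -> R) : mu.-integrable `[a, b] (EFin \o (T \o f)) ->
  \int[mu]_(x in `[a, b]) T (f x) =
  \int[mu]_(x in `[a, m]) T (f x) + \int[mu]_(x in `[m, b]) T (f x).
  move=> hi; have := Rintegral_itvB hi; move=> /(_ m); rewrite !bnd_simp => /(_ am mb).
  rewrite Rintegral_itv_obnd_cbnd; last first.
    apply: integrableS hi => //.
    by apply: subset_itvr; rewrite bnd_simp.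
  by move=> <-; rewrite addrC subrK.
by apply: complex_ext => /=; rewrite h //; [exact: cts_Re|exact: cts_Im].
Qed.

Lemma cint_Re_ge a b (f : R -> C) (k : R) : a <= b -> cts a b f ->
  (forall x, a <= x <= b -> k <= Re (f x)) -> k * (b - a) <= Re (cint a b f).
Proof.
move=> ab hf hk.
have -> : k * (b - a) = Re (cint a b (fun=> k%:C%C)).
  by rewrite cint_cst // cReM /= mulr0 subr0 mulrC.
have h : mu.-integrable `[a, b] (EFin \o (Re \o (fun=> k%:C%C))).
  by apply: cts_Re; exact: cts_cst.
by apply: le_Rintegral => //; exact: (cts_Re hf).
Qed.

(** Real and imaginary parts are bounded separately, whence the factor 2. Multiplication by 1, -1, i
    and -i reduces all four inequalities to one for real parts. *)
Lemma cint_bound a b (f : R -> C) (B : R) : a <= b -> cts a b f ->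
  (forall x, a <= x <= b -> nm (f x) <= B) -> nm (cint a b f) <= 2 * B * (b - a).
Proof.
move=> ab hf hB.
have h (c : C) : nm c = 1 -> Re (c * cint a b f) <= B * (b - a).
  move=> c1; rewrite -cintZ // -[leLHS]opprK lerNl -cReN.
  have -> : - cint a b (fun x => c * f x) = cint a b (fun x => - c * f x).
    by rewrite !cintZ // mulNr.
  rewrite -mulNr; apply: cint_Re_ge => //; first exact: ctsZ.
  move=> x hx; rewrite lerNl -cReN mulNr opprK.
  by apply: (le_trans (ler_norm _)); apply: (le_trans (nm_Re _)); rewrite nmM c1 mul1r hB.
have nmm1 : nm (-1 : C) = 1 by rewrite nmN nm1.
have nmmi : nm (- 'i%C : C) = 1 by rewrite nmN nm_i.
have := (h 1 nm1, h (-1) nmm1, h 'i%C nm_i, h (- 'i%C) nmmi).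
move: (cint a b f) {h} => z.
rewrite !cReM ?cReN ?cImN /= => -[[[h1 h2] h3] h4].
apply: (le_trans (nm_ReIm _)).
have : `|Re z| <= B * (b - a) by rewrite ler_norml; apply/andP; split; lra.
have : `|Im z| <= B * (b - a) by rewrite ler_norml; apply/andP; split; lra.
lra.
Qed.
End ComplexIntegral.

(** * Goursat's theorem on rectangles *)

Section Goursat.
Context {R : realType}.
Local Notation C := (cplx R).
Local Notation Re := (@complex.Re R).
Local Notation Im := (@complex.Im R).

Definition pt (x y : R) : C := (x +i* y)%C.

Definition cont_at (F : C -> C) (z : C) : Prop :=
  forall e : R, 0 < e -> exists2 d : R, 0 < d &
  forall w, nm (w - z) < d -> nm (F w - F z) < e.

Definition cdiff (F : C -> C) (z : C) : Prop :=
  exists L : C, forall e : R, 0 < e -> exists2 d : R, 0 < d &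
  forall w, nm (w - z) < d -> nm (F w - F z - L * (w - z)) <= e * nm (w - z).

(** The integral of [F] dz along the positively oriented boundary of [a, b] x [c, d]: bottom minus
    top, plus i times right minus left. *)
Definition J (a b c d : R) (F : C -> C) : C :=
  cint a b (fun x => F (pt x c)) - cint a b (fun x => F (pt x d)) +
  'i%C * (cint c d (fun y => F (pt b y)) - cint c d (fun y => F (pt a y))).

Lemma nm_pt (x y : R) : nm (pt x y) <= `|x| + `|y|.
Proof. exact: nm_ReIm. Qed.

Lemma ptB (x y x' y' : R) : pt x y - pt x' y' = pt (x - x') (y - y').
Proof. by []. Qed.

Lemma ptE (z : C) : z = pt (Re z) (Im z).
Proof. by case: z. Qed.

Lemma cdiff_cont (F : C -> C) z : cdiff F z -> cont_at F z.
Proof.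
move=> [L hL] e e0; have [d d0 hd] := hL 1 ltr01.
have K0 : 0 < nm L + 1 by rewrite ltr_wpDl ?nm_ge0.
exists (Num.min d (e / (nm L + 1))) => [|w].
  by rewrite lt_min d0 divr_gt0.
rewrite lt_min => /andP [/hd h1]; rewrite ltr_pdivlMr // => h2.
rewrite -[F w - F z](subrK (L * (w - z))).
apply: (le_lt_trans (nmD _ _)); rewrite nmM; lra.
Qed.

Lemma cts_h a b c (F : C -> C) :
  (forall x, a <= x <= b -> cont_at F (pt x c)) -> cts a b (fun x => F (pt x c)).
Proof.
move=> h x hx e e0; have [d d0 hd] := h x hx e e0; exists d => // y hy.
apply: hd; rewrite ptB; apply: (le_lt_trans (nm_pt _ _)).
by rewrite subrr normr0 addr0.
Qed.

Lemma cts_v a c d (F : C -> C) :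
  (forall y, c <= y <= d -> cont_at F (pt a y)) -> cts c d (fun y => F (pt a y)).
Proof.
move=> h x hx e e0; have [k k0 hk] := h x hx e e0; exists k => // y hy.
apply: hk; rewrite ptB; apply: (le_lt_trans (nm_pt _ _)).
by rewrite subrr normr0 add0r.
Qed.

Lemma J_splitx a m b c d (F : C -> C) : a <= m <= b ->
  (forall x, a <= x <= b -> cont_at F (pt x c)) ->
  (forall x, a <= x <= b -> cont_at F (pt x d)) ->
  J a b c d F = J a m c d F + J m b c d F.
Proof.
move=> hm hc hd; rewrite /J (cint_split hm (cts_h hc)) (cint_split hm (cts_h hd)).
by ring.
Qed.

Lemma J_splity a b c m d (F : C -> C) : c <= m <= d ->
  (forall y, c <= y <= d -> cont_at F (pt a y)) ->
  (forall y, c <= y <= d -> cont_at F (pt b y)) ->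
  J a b c d F = J a b c m F + J a b m d F.
Proof.
move=> hm ha hb; rewrite /J (cint_split hm (cts_v ha)) (cint_split hm (cts_v hb)).
by ring.
Qed.

Definition on_border (a b c d x y : R) : Prop :=
  a <= x <= b /\ c <= y <= d /\ [\/ x = a, x = b, y = c | y = d].

Lemma border_sides a b c d : a <= b -> c <= d ->
  [/\ forall x, a <= x <= b -> on_border a b c d x c,
      forall x, a <= x <= b -> on_border a b c d x d,
      forall y, c <= y <= d -> on_border a b c d a y
    & forall y, c <= y <= d -> on_border a b c d b y].
Proof.
move=> ab cd; have [hc hd] : c <= c <= d /\ c <= d <= d by rewrite !lexx cd.
have [ha hb] : a <= a <= b /\ a <= b <= b by rewrite !lexx ab.
by split=> z hz; split=> //; split=> //; constructor.
Qed.

(* Subtracting the affine function z |-> k + L z does not change J. *)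
Lemma J_affine_bound a b c d (F : C -> C) (L k : C) (B : R) :
  a <= b -> c <= d ->
  (forall x y, on_border a b c d x y -> cont_at F (pt x y)) ->
  (forall x y, on_border a b c d x y ->
     nm (F (pt x y) - (k + L * pt x y)) <= B) ->
  nm (J a b c d F) <= 4 * B * (b - a + (d - c)).
Proof.
move=> ab cd hF hB; have [bc bd ba bb] := border_sides ab cd.
have [h1 h2] : cts a b (fun x => F (pt x c)) /\ cts a b (fun x => F (pt x d)).
  by split; apply: cts_h => x hx; apply: hF; [exact: bc|exact: bd].
have [h3 h4] : cts c d (fun x => F (pt b x)) /\ cts c d (fun x => F (pt a x)).
  by split; apply: cts_v => x hx; apply: hF; [exact: bb|exact: ba].
pose K1 : C := L * pt 0 (c - d); pose K2 : C := L * pt (b - a) 0.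
have -> : J a b c d F =
   cint a b (fun x => F (pt x c) - F (pt x d) - K1) +
   'i%C * cint c d (fun y => F (pt b y) - F (pt a y) - K2).
  rewrite /J !cintB //; try exact: cts_cst; try exact: ctsB.
  rewrite !cint_cst //.
  have -> : K1 = - 'i%C * (d - c)%:C%C * L.
    by rewrite /K1 mulrC; congr (_ * _); apply: complex_ext; rewrite /= ; ring.
  have -> : K2 = (b - a)%:C%C * L by rewrite /K2 mulrC.
  have i2 : 'i%C * 'i%C = -1 :> C by rewrite -expr2 sqr_i.
  by ring: i2.
apply: (le_trans (nmD _ _)); rewrite nmM nm_i mul1r.
have e1 : nm (cint a b (fun x => F (pt x c) - F (pt x d) - K1)) <=
    2 * (2 * B) * (b - a).
  apply: cint_bound => // [|x hx]; first by apply: ctsB; [exact: ctsB|exact: cts_cst].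
  have -> : F (pt x c) - F (pt x d) - K1 =
    (F (pt x c) - (k + L * pt x c)) - (F (pt x d) - (k + L * pt x d)).
    have -> : K1 = L * (pt x c - pt x d) by rewrite /K1 ptB subrr.
    by ring.
  apply: (le_trans (nmB _ _)).
  by have := hB x c (bc x hx); have := hB x d (bd x hx); lra.
have e2 : nm (cint c d (fun y => F (pt b y) - F (pt a y) - K2)) <=
    2 * (2 * B) * (d - c).
  apply: cint_bound => // [|x hx]; first by apply: ctsB; [exact: ctsB|exact: cts_cst].
  have -> : F (pt b x) - F (pt a x) - K2 =
    (F (pt b x) - (k + L * pt b x)) - (F (pt a x) - (k + L * pt a x)).
    have -> : K2 = L * (pt b x - pt a x) by rewrite /K2 ptB subrr.
    by ring.
  apply: (le_trans (nmB _ _)).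
  by have := hB b x (bb x hx); have := hB a x (ba x hx); lra.
by move: (nm _) (nm _) e1 e2 => u v e1 e2; clear -e1 e2; lra.
Qed.

Lemma J_bound a b c d (F : C -> C) (B : R) : a <= b -> c <= d ->
  (forall x y, on_border a b c d x y -> cont_at F (pt x y)) ->
  (forall x y, on_border a b c d x y -> nm (F (pt x y)) <= B) ->
  nm (J a b c d F) <= 4 * B * (b - a + (d - c)).
Proof.
move=> ab cd hF hB; apply: (@J_affine_bound _ _ _ _ _ 0 0) => // x y hxy.
by rewrite mul0r addr0 subr0; exact: hB.
Qed.

Lemma nmD4 (p q r s : C) (B : R) : nm p <= B -> nm q <= B -> nm r <= B ->
  nm s <= B -> nm (p + q + (r + s)) <= 4 * B.
Proof.
move=> hp hq hr hs; apply: (le_trans (nmD _ _)).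
have := nmD p q; have := nmD r s; lra.
Qed.

Lemma nested_limit (v k : nat -> R) : (forall n, 0 <= k n) ->
  (forall m n, (m <= n)%N -> v m <= v n /\ v n + k n <= v m + k m) ->
  exists X, forall n, v n <= X <= v n + k n.
Proof.
move=> k0 hv; exists (sup (range v)) => n.
have hb m n' : v m <= v n' + k n'.
  have [hmn|/ltnW hmn] := leqP m n'; have [i1 i2] := hv _ _ hmn.
    by have := k0 n'; lra.
  by have := k0 m; lra.
apply/andP; split.
  apply: ub_le_sup; last by exists n.
  by exists (v 0 + k 0) => _ [m _ <-]; exact: hb.
apply: ge_sup; first by exists (v n), n.
by move=> _ [m _ <-]; exact: hb.
Qed.

(** Bisection: a rectangle on which |J| exceeds e times the square of the half-perimeter has a
    quarter with the same defect. The bad rectangles shrink to a point near which [F] is affine up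
    to a small relative error, and affine functions contribute nothing to J. *)
Lemma goursat a b c d (F : C -> C) : a <= b -> c <= d ->
  (forall x y, a <= x <= b -> c <= y <= d -> cdiff F (pt x y)) ->
  J a b c d F = 0.
Proof.
move=> ab cd hF; apply: nm_eq0; apply/eqP; rewrite eq_le nm_ge0 andbT.
pose w n : R := (b - a) / 2 ^+ n; pose h n : R := (d - c) / 2 ^+ n.
have w0 n : 0 <= w n by rewrite divr_ge0 ?exprn_ge0 // subr_ge0.
have h0 n : 0 <= h n by rewrite divr_ge0 ?exprn_ge0 // subr_ge0.
have wS n : w n = w n.+1 + w n.+1.
  by rewrite /w exprS; field; rewrite expf_neq0 // pnatr_eq0.
have hS n : h n = h n.+1 + h n.+1.
  by rewrite /h exprS; field; rewrite expf_neq0 // pnatr_eq0.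
have hh : h 0 = d - c by rewrite /h expr0 divr1.
have ww : w 0 = b - a by rewrite /w expr0 divr1.
have wh_small dl : 0 < dl -> exists n, w n + h n < dl.
  move=> d0; have s0 : 0 <= b - a + (d - c) by lra.
  have [n hn] : exists n, (b - a + (d - c)) / dl < n%:R.
    by exists (Num.bound ((b - a + (d - c)) / dl)); rewrite archi_boundP // divr_ge0 // ltW.
  exists n; rewrite /w /h -mulrDl.
  rewrite ltr_pdivrMr ?exprn_gt0 // mulrC -ltr_pdivrMr //.
  by apply: (lt_trans hn); rewrite -natrX ltr_nat ltn_expl.
clearbody w h.
suff main e : 0 < e -> nm (J a b c d F) <= e * (b - a + (d - c)) ^+ 2.
  have [s0|s0] := eqVneq (b - a + (d - c)) 0.
    by have := main 1 ltr01; rewrite s0 expr0n mulr0.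
  apply/ler_addgt0Pl => e e0; rewrite addr0.
  have s2 : 0 < (b - a + (d - c)) ^+ 2 by rewrite exprn_even_gt0.
  by have := main _ (divr_gt0 e0 s2); rewrite divfK // gt_eqF.
move=> e0; rewrite leNgt; apply/negP => hbad.
pose bad n x y := [/\ a <= x, x + w n <= b, c <= y, y + h n <= d &
  e * (w n + h n) ^+ 2 < nm (J x (x + w n) y (y + h n) F)].
have step (s : nat * R * R) : exists t : R * R,
    bad s.1.1 s.1.2 s.2 -> bad s.1.1.+1 t.1 t.2 /\
    [/\ s.1.2 <= t.1, t.1 + w s.1.1.+1 <= s.1.2 + w s.1.1,
        s.2 <= t.2 & t.2 + h s.1.1.+1 <= s.2 + h s.1.1].
  case: s => -[n x] y /=.
  have [|hn] := pselect (bad n x y); last by exists (x, y).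
  move=> [h1 h2 h3 h4 h5]; apply: contrapT => /forallNP hno.
  have := wS n; have := hS n; have := w0 n.+1; have := h0 n.+1 => p1 p2 q1 q2.
  have good x' y' : x <= x' -> x' + w n.+1 <= x + w n -> y <= y' ->
      y' + h n.+1 <= y + h n ->
      nm (J x' (x' + w n.+1) y' (y' + h n.+1) F) <= e * (w n.+1 + h n.+1) ^+ 2.
    move=> k1 k2 k3 k4; rewrite leNgt; apply/negP => hk.
    by apply: (hno (x', y')) => _; split=> //=; split=> //; lra.
  move: h5; rewrite ltNge => /negP; apply.
  have cF x' y' : x <= x' <= x + w n -> y <= y' <= y + h n -> cont_at F (pt x' y').
    by move=> /andP[? ?] /andP[? ?]; apply: cdiff_cont; apply: hF; apply/andP; split; lra.
  rewrite (@J_splitx _ (x + w n.+1)); first last.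
  - by move=> z hz; apply: cF => //; apply/andP; split; lra.
  - by move=> z hz; apply: cF => //; apply/andP; split; lra.
  - by apply/andP; split; lra.
  rewrite (@J_splity _ _ _ (y + h n.+1)); first last.
  - by move=> z hz; apply: cF => //; apply/andP; split; lra.
  - by move=> z hz; apply: cF => //; apply/andP; split; lra.
  - by apply/andP; split; lra.
  rewrite (@J_splity (x + w n.+1) _ _ (y + h n.+1)); first last.
  - by move=> z hz; apply: cF => //; apply/andP; split; lra.
  - by move=> z hz; apply: cF => //; apply/andP; split; lra.
  - by apply/andP; split; lra.
  have g1 := good x y; have g2 := good x (y + h n.+1).
  have g3 := good (x + w n.+1) y; have g4 := good (x + w n.+1) (y + h n.+1).
  rewrite -!addrA -wS -hS in g2 g3 g4.
  have -> : (w n + h n) ^+ 2 = 4 * (w n.+1 + h n.+1) ^+ 2 by rewrite wS hS; ring.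
  rewrite mulrCA; apply: nmD4; [apply: g1|apply: g2|apply: g3|apply: g4];
    clear -p1 p2 q1 q2; lra.
have [f hf] := choice step.
pose fix u (n : nat) : R * R := if n is m.+1 then f (m, (u m).1, (u m).2) else (a, c).
have ub n : bad n (u n).1 (u n).2.
  elim: n => [|n IH]; last by have [] := hf (n, (u n).1, (u n).2) IH.
  rewrite /bad /= ww hh.
  have -> : a + (b - a) = b by ring.
  have -> : c + (d - c) = d by ring.
  by split.
have mono n := (hf (n, (u n).1, (u n).2) (ub n)).2.
have mx m n : (m <= n)%N -> (u m).1 <= (u n).1 /\ (u n).1 + w n <= (u m).1 + w m.
  elim: n => [|n IH]; first by rewrite leqn0 => /eqP ->.
  rewrite leq_eqVlt => /orP [/eqP ->//|/IH [i1 i2]].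
  by have [/= m1 m2 _ _] := mono n; split; lra.
have my m n : (m <= n)%N -> (u m).2 <= (u n).2 /\ (u n).2 + h n <= (u m).2 + h m.
  elim: n => [|n IH]; first by rewrite leqn0 => /eqP ->.
  rewrite leq_eqVlt => /orP [/eqP ->//|/IH [i1 i2]].
  by have [/= _ _ m1 m2] := mono n; split; lra.
have [X hX] := nested_limit w0 mx.
have [Y hY] := nested_limit h0 my.
have [hXb hYd] : a <= X <= b /\ c <= Y <= d.
  have [l1 l2 l3 l4 _] := ub 0; have := hX 0; have := hY 0.
  by move=> /andP [? ?] /andP [? ?]; split; apply/andP; split; lra.
have [L hL] := hF X Y hXb hYd.
(* With the factor 4 of [J_affine_bound] this leaves e / 2 times the squared half-perimeter. *)
have e8 : 0 < e / 8 by rewrite divr_gt0.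
have [dl d0 hd] := hL _ e8.
have [n hn] := wh_small _ d0.
have [l1 l2 l3 l4 hlt] := ub n.
move: hlt; rewrite ltNge => /negP; apply.
pose x := (u n).1; pose y := (u n).2; rewrite -/x -/y in l1 l2 l3 l4 *.
have {}hX : x <= X <= x + w n := hX n; have {}hY : y <= Y <= y + h n := hY n.
have small x' y' : x <= x' <= x + w n -> y <= y' <= y + h n ->
    nm (pt x' y' - pt X Y) <= w n + h n.
  move=> hx' hy'; rewrite ptB; apply: (le_trans (nm_pt _ _)).
  by clear -hX hY hx' hy'; apply: lerD; rewrite ler_norml; lra.
apply: (@le_trans _ _ (4 * (e / 8 * (w n + h n)) * (x + w n - x + (y + h n - y)))).
  apply: (@J_affine_bound _ _ _ _ _ L (F (pt X Y) - L * pt X Y)).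
  - by rewrite lerDl.
  - by rewrite lerDl.
  - move=> x' y' [hx' [hy' _]]; apply: cdiff_cont; apply: hF.
      by clear -l1 l2 hx'; lra.
    by clear -l3 l4 hy'; lra.
  move=> x' y' [hx' [hy' _]].
  have -> : F (pt x' y') - (F (pt X Y) - L * pt X Y + L * pt x' y') =
    F (pt x' y') - F (pt X Y) - L * (pt x' y' - pt X Y) by ring.
  apply: (le_trans (hd _ _)); first by apply: le_lt_trans hn; exact: small.
  by rewrite ler_pM2l //; exact: small.
have -> : 4 * (e / 8 * (w n + h n)) * (x + w n - x + (y + h n - y)) =
  e / 2 * (w n + h n) ^+ 2 by field.
by apply: ler_wpM2r; [exact: sqr_ge0|lra].
Qed.
End Goursat.

(** * Contour deformation and the Cauchy kernel *)

Section CauchyTaylor.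
Context {R : realType}.
Local Notation C := (cplx R).
Local Notation Re := (@complex.Re R).
Local Notation Im := (@complex.Im R).

Definition mklin (V W : lmodType C) (f : V -> W) (h : linear f) : {linear V -> W} :=
  HB.pack f (GRing.isLinear.Build C V W _ f h).

Lemma cdiffP (f : C -> C) z : cdiff f z <-> differentiable f z.
Proof.
split.
  move=> [L hL].
  have Llin : linear (fun h : C => h * L : C).
    by move=> a u v; rewrite mulrDl -mulrA.
  pose T : {linear C -> C} := mklin Llin.
  have hT h : nm (T h) <= nm L * nm h by rewrite /T /= nmM mulrC.
  have [|//] := @eps_differentiable R _ _ f z T _ hT.
  move=> e e0; have [d d0 hd] := hL e e0; exists d => // h hh.
  have := hd (z + h); rewrite [z + h - z]addrAC subrr add0r => /(_ hh).
  by rewrite [L * h]mulrC.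
move=> hf; exists ('d f z 1) => e e0; have [d d0 hd] := differentiable_eps hf e0.
exists d => // w /hd; rewrite addrCA subrr addr0.
suff -> : 'd f z (w - z) = 'd f z 1 * (w - z) by [].
by rewrite -[X in 'd f z X = _]mulr1 -[(w - z) * 1]/((w - z) *: (1 : C)) linearZ mulrC.
Qed.

Lemma JD a b c d (F G : C -> C) : a <= b -> c <= d ->
  (forall x y, on_border a b c d x y -> cont_at F (pt x y)) ->
  (forall x y, on_border a b c d x y -> cont_at G (pt x y)) ->
  J a b c d (fun z => F z + G z) = J a b c d F + J a b c d G.
Proof.
move=> ab cd hF hG.
have [bc bd ba bb] := border_sides ab cd.
have hs H : (forall x y, on_border a b c d x y -> cont_at H (pt x y)) ->
  [/\ cts a b (fun x => H (pt x c)), cts a b (fun x => H (pt x d)),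
      cts c d (fun x => H (pt b x)) & cts c d (fun x => H (pt a x))].
  move=> hH; split; [apply: cts_h|apply: cts_h|apply: cts_v|apply: cts_v];
  by move=> x hx; apply: hH; auto.
have [f1 f2 f3 f4] := hs F hF; have [g1 g2 g3 g4] := hs G hG.
by rewrite /J !cintD //; ring.
Qed.

Lemma JZ a b c d (F : C -> C) (k : C) : a <= b -> c <= d ->
  (forall x y, on_border a b c d x y -> cont_at F (pt x y)) ->
  J a b c d (fun z => k * F z) = k * J a b c d F.
Proof.
move=> ab cd hF.
have [bc bd ba bb] := border_sides ab cd.
have [f1 [f2 [f3 f4]]] : cts a b (fun x => F (pt x c)) /\ cts a b (fun x => F (pt x d))
  /\ cts c d (fun x => F (pt b x)) /\ cts c d (fun x => F (pt a x)).
  split; [|split; [|split]]; [apply: cts_h|apply: cts_h|apply: cts_v|apply: cts_v];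
  by move=> x hx; apply: hF; auto.
by rewrite /J !cintZ //; ring.
Qed.

Lemma eq_J a b c d (F G : C -> C) : a <= b -> c <= d ->
  (forall x y, on_border a b c d x y -> F (pt x y) = G (pt x y)) ->
  J a b c d F = J a b c d G.
Proof.
move=> ab cd h.
have [bc bd ba bb] := border_sides ab cd.
by congr (_ - _ + _ * (_ - _)); apply: eq_cint => x hx; apply: h; auto.
Qed.

(** The frame between the two rectangles is cut into a bottom, a top, a left and a right rectangle,
    and Goursat's theorem removes each of them. *)
Lemma J_shrink a b c d a' b' c' d' (F : C -> C) :
  a <= a' -> a' <= b' -> b' <= b -> c <= c' -> c' <= d' -> d' <= d ->
  (forall x y, a <= x <= b -> c <= y <= d ->
    [\/ x <= a', b' <= x, y <= c' | d' <= y] -> cdiff F (pt x y)) ->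
  J a b c d F = J a' b' c' d' F.
Proof.
move=> h1 h2 h3 h4 h5 h6 hF.
have hF' x y : a <= x <= b -> c <= y <= d ->
    [\/ x <= a', b' <= x, y <= c' | d' <= y] -> cont_at F (pt x y).
  by move=> *; apply: cdiff_cont; apply: hF.
have xx (z : R) : z <= z by [].
have tr (x y z : R) : x <= y -> y <= z -> x <= z by exact: le_trans.
have k1 := tr _ _ _ h1 h2; have k2 := tr _ _ _ h2 h3; have k3 := tr _ _ _ k1 h3.
have k4 := tr _ _ _ h4 h5; have k5 := tr _ _ _ h5 h6; have k6 := tr _ _ _ k4 h6.
rewrite (@J_splity _ _ _ _ c'); first last.
- by move=> y hy; apply: hF' => //; [rewrite xx /= ?andbT; eauto 3|constructor 2; eauto 3].
- by move=> y hy; apply: hF' => //; [rewrite xx /= ?andbT; eauto 3|constructor 1; eauto 3].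
- by rewrite h4 /=; eauto 3.
rewrite (@goursat _ a b c c'); first last.
- move=> x y hx /andP [hy1 hy2]; apply: hF => //; last by constructor 3.
  by rewrite hy1 /=; eauto 3.
- by [].
- by eauto 3.
rewrite add0r (@J_splity _ _ _ _ d'); first last.
- move=> y /andP [hy1 hy2]; apply: hF'; [rewrite xx /= ?andbT; eauto 3| |constructor 2; eauto 3].
  by rewrite hy2 andbT; eauto 3.
- move=> y /andP [hy1 hy2]; apply: hF'; [rewrite xx /= ?andbT; eauto 3| |constructor 1; eauto 3].
  by rewrite hy2 andbT; eauto 3.
- by rewrite h5 h6.
rewrite (@goursat _ a b d' d); first last.
- move=> x y hx /andP [hy1 hy2]; apply: hF => //; last by constructor 4.
  by rewrite hy2 andbT; eauto 3.
- by [].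
- by eauto 3.
rewrite addr0 (@J_splitx _ _ a'); first last.
- move=> x /andP [hx1 hx2]; apply: hF'; [by rewrite hx1| |by constructor 4].
  by rewrite h6 andbT; eauto 3.
- move=> x /andP [hx1 hx2]; apply: hF'; [by rewrite hx1| |by constructor 3].
  by rewrite h4 /=; eauto 3.
- by rewrite h1 /=; eauto 3.
rewrite (@goursat _ a a' c' d'); first last.
- move=> x y /andP [hx1 hx2] /andP [hy1 hy2]; apply: hF; last by constructor 1.
    by rewrite hx1 /=; eauto 3.
  by apply/andP; split; eauto 3.
- by [].
- by [].
rewrite add0r (@J_splitx _ _ b'); first last.
- move=> x /andP [hx1 hx2]; apply: hF'; [| |by constructor 4].
    by rewrite hx2 andbT; eauto 3.
  by rewrite h6 andbT; eauto 3.
- move=> x /andP [hx1 hx2]; apply: hF'; [| |by constructor 3].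
    by rewrite hx2 andbT; eauto 3.
  by rewrite h4 /=; eauto 3.
- by rewrite h2 h3.
rewrite (@goursat _ b' b c' d'); first last.
- move=> x y /andP [hx1 hx2] /andP [hy1 hy2]; apply: hF; last by constructor 2.
    by rewrite hx2 andbT; eauto 3.
  by apply/andP; split; eauto 3.
- by [].
- by [].
by rewrite addr0.
Qed.

Lemma differentiable_inv_sub (w z : C) : w != z -> differentiable (fun t : C => (t - w)^-1) z.
Proof.
move=> wz; apply: differentiableV; last by rewrite subr_eq0 eq_sym.
by apply: differentiableB => //; exact: differentiable_cst.
Qed.

Lemma border_nm (r x y : R) : 0 < r -> on_border (-r) r (-r) r x y ->
  r <= nm (pt x y) <= 2 * r.
Proof.
move=> r0 [hx [hy hh]]; apply/andP; split; last first.
  apply: (le_trans (nm_pt _ _)).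
  have : `|x| <= r by rewrite ler_norml.
  have : `|y| <= r by rewrite ler_norml.
  by lra.
case: hh => ->.
- by apply: le_trans (nm_Re _); rewrite /= normrN gtr0_norm.
- by apply: le_trans (nm_Re _); rewrite /= gtr0_norm.
- by apply: le_trans (nm_Im _); rewrite /= normrN gtr0_norm.
- by apply: le_trans (nm_Im _); rewrite /= gtr0_norm.
Qed.

Lemma nm_subl (V : normedModType C) (x y : V) : nm x - nm y <= nm (x - y).
Proof. by rewrite lerBlDr -{1}[x](subrK y) nmD. Qed.

Lemma nm_neq (V : normedModType C) (x y : V) : nm x != nm y -> x != y.
Proof. by apply: contraNneq => ->. Qed.

(* This is 2 pi i for z inside the square, but only kap r 0 <> 0 is needed. *)
Definition kap (r : R) (z : C) : C := J (-r) r (-r) r (fun t => (t - z)^-1).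

(** The difference is the integral of z / (t (t - z)), holomorphic off 0 and z and of order |t|^-2
    at infinity. Enlarging the square to half-side s leaves the integral unchanged and makes it O(1
    / s). *)
Lemma kap_const r z : 0 < r -> 2 * nm z <= r -> kap r z = kap r 0.
Proof.
move=> r0 hz; apply/eqP; rewrite -subr_eq0; apply/eqP/nm_eq0/eqP.
rewrite eq_le nm_ge0 andbT.
have nz := nm_ge0 z.
pose w t : C := z * ((t - 0)^-1 * (t - z)^-1).
have ncont (s : R) x y u : r <= s -> on_border (-s) s (-s) s x y -> nm u <= nm z ->
    pt x y != u.
  move=> rs hb hu; have s0 : 0 < s by lra.
  have /andP [h1 _] := border_nm s0 hb.
  by apply: nm_neq; rewrite gt_eqF //; lra.
have dw t : t != 0 -> t != z -> cdiff w t.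
  move=> t0 tz; apply/cdiffP; apply: differentiableM; first exact: differentiable_cst.
  by apply: differentiableM; apply: differentiable_inv_sub; rewrite eq_sym.
have -> : kap r z - kap r 0 = J (-r) r (-r) r w.
  have -> : - kap r 0 = J (-r) r (-r) r (fun t => -1 * (t - 0)^-1).
    rewrite JZ ?mulN1r //; try lra.
    move=> x y hb; apply/cdiff_cont/cdiffP/differentiable_inv_sub.
    by rewrite eq_sym; apply: (ncont r) => //; rewrite nm0.
  rewrite /kap.
  rewrite -JD; first last.
  - move=> x y hb; apply/cdiff_cont/cdiffP/differentiableM; first exact: differentiable_cst.
    by apply: differentiable_inv_sub; rewrite eq_sym; apply: (ncont r) => //; rewrite nm0.
  - move=> x y hb; apply/cdiff_cont/cdiffP/differentiable_inv_sub.
    by rewrite eq_sym; apply: (ncont r).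
  - lra.
  - lra.
  apply: eq_J; try lra.
  move=> x y hb; have n0 : pt x y != 0 by apply: (ncont r) => //; rewrite nm0.
  have nz' : pt x y != z by apply: (ncont r).
  by rewrite /w; field; rewrite subr_eq0 nz' n0.
have bound s : r <= s -> nm (J (-r) r (-r) r w) <= 32 * nm z / s.
  move=> rs; have s0 : 0 < s by lra.
  rewrite -(@J_shrink (-s) s (-s) s); try lra; first last.
    move=> x y hx hy hh; have hr : r <= nm (pt x y).
      case: hh => hh.
      - by apply: le_trans (nm_Re _); rewrite ler0_norm /=; lra.
      - by apply: le_trans (nm_Re _); rewrite ger0_norm /=; lra.
      - by apply: le_trans (nm_Im _); rewrite ler0_norm /=; lra.
      - by apply: le_trans (nm_Im _); rewrite ger0_norm /=; lra.
    by apply: dw; apply: nm_neq; rewrite ?nm0 gt_eqF //; lra.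
  (* On the large square |t| >= s and |t - z| >= s / 2. *)
  have -> : 32 * nm z / s = 4 * (2 * nm z / s ^+ 2) * (s - - s + (s - - s)).
    by field; rewrite gt_eqF.
  apply: J_bound; try lra.
    move=> x y hb; apply: cdiff_cont; apply: dw; apply: (ncont s) => //.
    by rewrite nm0.
  move=> x y hb; rewrite /w !nmM !nmV subr0.
  have /andP [h1 _] := border_nm s0 hb.
  have h2 := nm_subl (pt x y) z.
  rewrite [2 * _]mulrC -mulrA; apply: ler_wpM2l => //.
  rewrite -invfM -[leRHS]invrK; rewrite lef_pV2 ?posrE.
  - rewrite invfM invrK mulrC; nra.
  - by apply: mulr_gt0; lra.
  - by rewrite invr_gt0 divr_gt0 // exprn_gt0.
apply/ler_addgt0Pl => e e0; rewrite addr0.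
have h1 := bound (Num.max r (32 * nm z / e)).
apply: (le_trans (h1 _)); first by rewrite le_max lexx.
rewrite ler_pdivrMr; last by rewrite lt_max r0.
by rewrite -ler_pdivrMl // [e^-1 * _]mulrC le_max lexx orbT.
Qed.

(** Each pair of opposite sides contributes to the imaginary part an integrand 2 r / (x^2 + r^2) >=
    1 / r over a length 2 r, hence at least 2. *)
Lemma kap0_ge r : 0 < r -> 4 <= nm (kap r 0).
Proof.
move=> r0.
have hb x y : on_border (-r) r (-r) r x y -> cont_at (fun t : C => (t - 0)^-1) (pt x y).
  move=> hb; apply/cdiff_cont/cdiffP/differentiable_inv_sub.
  have /andP [h1 _] := border_nm r0 hb.
  by apply: nm_neq; rewrite nm0 lt_eqF //; lra.
have iv (x y : R) : (pt x y)^-1 = pt (x / (x^+2 + y^+2)) (- (y / (x^+2 + y^+2))) by [].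
have rr : -r <= r by lra.
have [c1 c2] : cts (-r) r (fun x => (pt x (-r) - 0)^-1) /\ cts (-r) r (fun x => (pt x r - 0)^-1).
  by split; apply: (@cts_h _ (-r) r _ (fun t : C => (t - 0)^-1)) => x hx; apply: hb;
  split=> //; split; rewrite ?lexx ?rr //; constructor.
have [c3 c4] : cts (-r) r (fun x => (pt r x - 0)^-1) /\ cts (-r) r (fun x => (pt (-r) x - 0)^-1).
  by split; apply: (@cts_v _ _ (-r) r (fun t : C => (t - 0)^-1)) => x hx; apply: hb;
  split=> //; rewrite ?lexx ?rr //; split=> //; constructor.
have key (x : R) : -r <= x <= r -> r^-1 <= 2 * r / (x ^+ 2 + r ^+ 2).
  move=> /andP [x1 x2]; rewrite -[r^-1]mul1r ler_pdivlMr; last by nra.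
  rewrite mul1r mulrC ler_pdivrMr //; nra.
have e1 : r^-1 * (r - - r) <= Im (cint (-r) r (fun x => (pt x (- r) - 0)^-1 - (pt x r - 0)^-1)).
  set c := cint _ _ _; have -> : Im c = Re (- 'i%C * c) by rewrite cReM /=; ring.
  rewrite -cintZ; last exact: ctsB.
  apply: cint_Re_ge; [lra|by apply: ctsZ; exact: ctsB|].
  move=> x hx; rewrite !subr0 !iv cReM /=.
  by apply: (le_trans (key x hx)); rewrite sqrrN; lra.
have e2 : r^-1 * (r - - r) <= Re (cint (-r) r (fun x => (pt r x - 0)^-1 - (pt (-r) x - 0)^-1)).
  apply: cint_Re_ge; [lra|exact: ctsB|].
  move=> x hx; rewrite !subr0 !iv /=.
  by apply: (le_trans (key x hx)); rewrite sqrrN [r^+2 + _]addrC; lra.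
have e3 : r^-1 * (r - - r) = 2 by field; rewrite gt_eqF.
apply: le_trans (nm_Im _); apply: le_trans (ler_norm _).
rewrite /kap /J -!cintB //; move: e1 e2; rewrite e3.
move: (cint _ _ _) (cint _ _ _) => X Y e1 e2.
by rewrite cImD cImM /=; clear -e1 e2; lra.
Qed.
End CauchyTaylor.

(** * Taylor polynomials with remainder on a disc *)

Section Taylor.
Context {R : realType}.
Local Notation C := (cplx R).
Local Notation Re := (@complex.Re R).
Local Notation Im := (@complex.Im R).

Lemma cdiff_nm (f : C -> C) z : cdiff f z -> exists2 B : R, 0 < B & exists2 d : R, 0 < d &
  forall w, nm (w - z) < d -> nm (f w - f z) <= B * nm (w - z).
Proof.
move=> [L hL]; have [d d0 hd] := hL 1 ltr01.
exists (nm L + 1); first by rewrite ltr_wpDl ?nm_ge0.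
exists d => // w /hd h1.
rewrite -[f w - f z](subrK (L * (w - z))).
apply: (le_trans (nmD _ _)); rewrite nmM; lra.
Qed.

Lemma differentiable_exp n (z : C) : differentiable (fun t : C => t ^+ n) z.
Proof.
elim: n => [|n IH].
  exact: differentiable_cst.
rewrite (_ : (fun _ => _) = (fun t : C => t * t ^+ n)); last by apply/funext => t; rewrite exprS.
exact: differentiableM.
Qed.

Section Fixed.
Variables (f : C -> C) (rho M r : R).
Hypothesis rho4 : rho = 4 * r.
Hypothesis rho0 : 0 < rho.
Hypothesis df : forall z, nm z < rho -> differentiable f z.
Hypothesis fM : forall z, nm z < rho -> nm (f z) <= M.

Let JJ := J (-r) r (-r) r.

Let r0 : 0 < r. Proof. by move: rho0; rewrite rho4; lra. Qed.

Let sq_nm x y : -r <= x <= r -> -r <= y <= r -> nm (pt x y) < rho.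
Proof.
move=> hx hy; apply: (le_lt_trans (nm_pt _ _)).
have : `|x| <= r by rewrite ler_norml.
have : `|y| <= r by rewrite ler_norml.
by have := r0; have := rho4; lra.
Qed.

Let kernel_diff (k : nat) (z t : C) : nm t < rho -> t != 0 -> t != z ->
  cdiff (fun t => f t * (t ^- k * (t - z)^-1)) t.
Proof.
move=> tr t0 tz; apply/cdiffP; apply: differentiableM; first exact: df.
apply: differentiableM; last by apply: differentiable_inv_sub; rewrite eq_sym.
by apply: differentiableV; [exact: differentiable_exp|rewrite expf_neq0].
Qed.

Let border_ne (z : C) x y : 2 * nm z <= r -> on_border (-r) r (-r) r x y -> pt x y != z.
Proof.
move=> hz hb; have /andP [h1 _] := border_nm r0 hb; have := nm_ge0 z.
by move=> z0; apply: nm_neq; rewrite gt_eqF //; have := r0; lra.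
Qed.

(** [T 0 z] is the Cauchy integral of [f], and [T k 0] is a Taylor coefficient up to the factor
    [kap r 0]. Iterating 1 / (t - z) = 1 / t + z / (t (t - z)) gives the Taylor polynomial with
    remainder z^k [T k z]. *)
Let T (k : nat) (z : C) : C := JJ (fun t => f t * (t ^- k * (t - z)^-1)).

Let T_cont (k : nat) z x y : 2 * nm z <= r -> on_border (-r) r (-r) r x y ->
  cont_at (fun t => f t * (t ^- k * (t - z)^-1)) (pt x y).
Proof.
move=> hz hb; apply: cdiff_cont; apply: kernel_diff.
- by case: hb => ? [? _]; exact: sq_nm.
- by apply: border_ne => //; rewrite nm0 mulr0 ltW.
- exact: border_ne.
Qed.

Let rr : -r <= r. Proof. by have := r0; lra. Qed.

Let nm00 : 2 * nm (0 : C) <= r. Proof. by rewrite nm0 mulr0 ltW. Qed.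

Let T_step k z : 2 * nm z <= r -> T k z = T k 0 + z * T k.+1 z.
Proof.
move=> hz; rewrite /T -JZ //; last by move=> x y; exact: T_cont.
rewrite -JD //; first last.
- move=> x y hb; apply: cdiff_cont; apply/cdiffP; apply: differentiableM; first exact: differentiable_cst.
  by apply/cdiffP; apply: kernel_diff; [case: hb => ? [? _]; exact: sq_nm|exact: border_ne|exact: border_ne].
- by move=> x y; exact: T_cont.
apply: eq_J => // x y hb.
have t0 : pt x y != 0 by exact: border_ne.
have tz : pt x y != z by exact: border_ne.
move: (pt x y) t0 tz => t t0 tz; rewrite exprS subr0.
by field; rewrite t0 subr_eq0 tz expf_neq0.
Qed.

Let T_sum k z : 2 * nm z <= r -> T 0 z = \sum_(i < k) T i 0 * z ^+ i + z ^+ k * T k z.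
Proof.
move=> hz; elim: k => [|k IH]; first by rewrite big_ord0 add0r expr0 mul1r.
by rewrite IH big_ord_recr /= -addrA (T_step _ hz) exprSr; congr (_ + _); ring.
Qed.

Let T_bound k z : 2 * nm z <= r -> nm (T k z) <= 32 * M / r ^+ k.
Proof.
move=> hz; have rk : 0 < r ^+ k by rewrite exprn_gt0 ?r0.
(* On the border |t| >= r and |t - z| >= r / 2. *)
have -> : 32 * M / r ^+ k = 4 * (M * (r ^- k * (2 / r))) * (r - - r + (r - - r)).
  by field; rewrite !gt_eqF // r0.
apply: J_bound => // x y hb; first exact: T_cont.
have /andP [h1 _] := border_nm r0 hb.
have h2 := nm_subl (pt x y) z.
rewrite !nmM !nmV nmX.
have M0 : 0 <= nm (f (pt x y)) by exact: nm_ge0.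
have nk : 0 <= nm (pt x y) ^+ k by rewrite exprn_ge0 ?nm_ge0.
apply: ler_pM => //.
- by rewrite mulr_ge0 // invr_ge0 // nm_ge0.
- by apply: fM; case: hb => ? [? _]; exact: sq_nm.
apply: ler_pM; rewrite ?invr_ge0 ?nm_ge0 //.
  rewrite lef_pV2 ?posrE //; last by apply: exprn_gt0; apply: lt_le_trans h1.
  by apply: lerXn2r; rewrite ?nnegrE ?nm_ge0 // ltW ?r0.
have -> : 2 / r = (r / 2)^-1 by rewrite invf_div.
by rewrite lef_pV2 ?posrE; have := r0; lra.
Qed.

(** The difference quotient of [f] at z is holomorphic off z and bounded near z, so its integral
    over the square equals the one over a square of half-side e about z, which is O(e). *)
Let cauchy z : 2 * nm z <= r -> T 0 z = f z * kap r z.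
Proof.
move=> hz; pose q t := (f t - f z) * (t - z)^-1.
have zr : nm z < rho by have := nm_ge0 z; have := r0; rewrite rho4; lra.
have dq t : nm t < rho -> t != z -> cdiff q t.
  move=> tr tz; apply/cdiffP; apply: differentiableM.
    by apply: differentiableB; [exact: df|exact: differentiable_cst].
  by apply: differentiable_inv_sub; rewrite eq_sym.
suff q0 : JJ q = 0.
  rewrite -[RHS]addr0 -q0 /kap -JZ //; last first.
    move=> x y hb; apply/cdiff_cont/cdiffP/differentiable_inv_sub.
    by rewrite eq_sym; exact: border_ne.
  rewrite /JJ -JD //; first last.
  - move=> x y hb; apply/cdiff_cont/dq; last exact: border_ne.
    by case: hb => ? [? _]; exact: sq_nm.
  - move=> x y hb; apply/cdiff_cont/cdiffP/differentiableM; first exact: differentiable_cst.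
    by apply: differentiable_inv_sub; rewrite eq_sym; exact: border_ne.
  by apply: eq_J => // x y hb; rewrite /q expr0 invr1; ring.
apply/nm_eq0/eqP; rewrite eq_le nm_ge0 andbT.
have [B B0 [d d0 hB]] : exists2 B : R, 0 < B & exists2 d : R, 0 < d &
  forall w, nm (w - z) < d -> nm (f w - f z) <= B * nm (w - z).
  by apply: cdiff_nm; apply/cdiffP; exact: df.
have hx : `|Re z| <= nm z := nm_Re z; have hy : `|Im z| <= nm z := nm_Im z.
move: hx hy; rewrite !ler_norml => /andP [hx1 hx2] /andP [hy1 hy2].
have main e : 0 < e -> 2 * e < d -> 2 * e < r -> nm (JJ q) <= 16 * B * e.
  move=> e0 ed er.
  rewrite /JJ (@J_shrink _ _ _ _ _ (Re z - e) (Re z + e) (Im z - e) (Im z + e)); try lra; last first.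
    move=> x y hx hy hh; apply: dq; first exact: sq_nm.
    by apply/negP => /eqP E; move: hh; rewrite -E /=; case=> hh; lra.
  have -> : 16 * B * e = 4 * B * (Re z + e - (Re z - e) + (Im z + e - (Im z - e))) by ring.
  have key x y : on_border (Re z - e) (Re z + e) (Im z - e) (Im z + e) x y ->
      nm (pt x y) < rho /\ e <= nm (pt x y - z) <= 2 * e.
    move=> [hx [hy hh]]; split.
      by apply: sq_nm; lra.
    rewrite {1 2}(ptE z) ptB.
    by apply: border_nm => //; split; [lra|split; [lra|case: hh => ->];
      [constructor 1; lra|constructor 2; lra|constructor 3; lra|constructor 4; lra]].
  apply: J_bound; try lra.
    move=> x y /key [h1 /andP[h2 h3]]; apply/cdiff_cont/dq => //.
    by apply: contraTneq h2 => ->; rewrite subrr nm0 -ltNge.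
  move=> x y /key [h1 /andP[h2 h3]]; rewrite /q nmM nmV ler_pdivrMr; last by lra.
  by apply: hB; lra.
apply/ler_addgt0Pl => e e0; rewrite addr0.
pose e1 := Num.min (Num.min d r / 3) (e / (16 * B)).
have dr0 : 0 < Num.min d r by rewrite lt_min d0 r0.
have e10 : 0 < e1 by rewrite lt_min !divr_gt0 // mulr_gt0.
have h1 : e1 <= Num.min d r / 3 by rewrite ge_min lexx.
have h2 : Num.min d r <= d by rewrite ge_min lexx.
have h3 : Num.min d r <= r by rewrite ge_min lexx orbT.
apply: (le_trans (main e1 _ _ _)) => //; try lra.
by rewrite mulrC -ler_pdivlMr ?mulr_gt0 // ge_min lexx orbT.
Qed.

(** The square of half-side r = rho / 4 lies in the disc, and rho / 8 = r / 2 is the range of the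
    Cauchy formula. The factor 8 is 32 from [T_bound] divided by 4 from [kap0_ge]. One sequence of
    coefficients serves every [k]. *)
Lemma taylor_fixed : exists a : nat -> C, forall k z, nm z < rho / 8 ->
  nm (f z - \sum_(i < k) a i * z ^+ i) <= 8 * M * (4 * nm z / rho) ^+ k.
Proof.
have k4 := kap0_ge r0; have k0 : kap r 0 != 0.
  by apply: contraTneq k4 => ->; rewrite nm0 -ltNge.
exists (fun i => T i 0 / kap r 0) => k z hz.
have {}hz : 2 * nm z <= r by move: hz; rewrite rho4; lra.
have -> : f z = (T 0 z) / kap r 0 by rewrite cauchy // kap_const ?r0 // mulfK.
rewrite (T_sum k hz) mulrDl mulr_suml.
rewrite (eq_bigr (fun i : 'I_k => T i 0 / kap r 0 * z ^+ i)); last first.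
  by move=> i _; rewrite mulrAC.
rewrite addrC addKr !nmM nmX nmV.
have -> : 8 * M * (4 * nm z / rho) ^+ k = nm z ^+ k * (32 * M / r ^+ k) / 4.
  have -> : 4 * nm z / rho = nm z / r by rewrite rho4; field; rewrite gt_eqF // r0.
  by rewrite expr_div_n; field; rewrite expf_neq0 // gt_eqF ?r0.
have z0 : 0 <= nm z ^+ k by rewrite exprn_ge0 ?nm_ge0.
apply: ler_pM.
- by rewrite mulr_ge0 ?nm_ge0.
- by rewrite invr_ge0 nm_ge0.
- by apply: ler_wpM2l => //; exact: T_bound.
- by rewrite lef_pV2 ?posrE //; lra.
Qed.
End Fixed.

Lemma taylor_disc (f : C -> C) (rho M : R) : 0 < rho ->
  (forall z, nm z < rho -> differentiable f z) ->
  (forall z, nm z < rho -> nm (f z) <= M) ->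
  exists a : nat -> C, forall k z, nm z < rho / 8 ->
  nm (f z - \sum_(i < k) a i * z ^+ i) <= 8 * M * (4 * nm z / rho) ^+ k.
Proof. by move=> h1 h2 h3; apply: (@taylor_fixed f rho M (rho / 4)) => //; field. Qed.
End Taylor.

(** * Orders of vanishing *)

Section LittleO.
Context {R : realType}.
Local Notation C := (cplx R).

(* f t = o(t^k); this forces f 0 = 0. *)
Definition lo (V : normedModType C) (k : nat) (f : C -> V) : Prop :=
  forall e : R, 0 < e -> exists2 d : R, 0 < d &
  forall t : C, nm t < d -> nm (f t) <= e * nm t ^+ k.

Lemma lo_le (V W : normedModType C) (k : nat) (f : C -> V) (g : C -> W) (K : R) :
  (exists2 d : R, 0 < d & forall t, nm t < d -> nm (g t) <= K * nm (f t)) ->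
  lo k f -> lo k g.
Proof.
move=> [d d0 hd] hf e e0; have K1 : 0 < `|K| + 1 by rewrite ltr_wpDl.
have [c c0 hc] := hf _ (divr_gt0 e0 K1).
exists (Num.min c d) => [|t]; first by rewrite lt_min c0.
rewrite lt_min => /andP [/hc h1 /hd h2].
apply: (le_trans h2); apply: (@le_trans _ _ ((`|K| + 1) * nm (f t))).
  rewrite ler_wpM2r ?nm_ge0 //; have := ler_norm K; lra.
by move: h1; rewrite mulrAC ler_pdivlMr // mulrC.
Qed.

Lemma eq_lo (V : normedModType C) (k : nat) (f g : C -> V) : f =1 g -> lo k f -> lo k g.
Proof. by move=> /funext ->. Qed.

Lemma loD (V : normedModType C) (k : nat) (f g : C -> V) :
  lo k f -> lo k g -> lo k (fun t => f t + g t).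
Proof.
move=> hf hg e e0; have e2 : 0 < e / 2 by rewrite divr_gt0.
have [c c0 hc] := hf _ e2; have [d d0 hd] := hg _ e2.
exists (Num.min c d) => [|t]; first by rewrite lt_min c0.
rewrite lt_min => /andP [/hc h1 /hd h2].
by apply: (le_trans (nmD _ _)); lra.
Qed.

Lemma loN (V : normedModType C) (k : nat) (f : C -> V) : lo k f -> lo k (fun t => - f t).
Proof. by apply: (@lo_le _ _ _ _ _ 1); exists 1 => // t _; rewrite nmN mul1r. Qed.

Lemma loB (V : normedModType C) (k : nat) (f g : C -> V) :
  lo k f -> lo k g -> lo k (fun t => f t - g t).
Proof. by move=> hf hg; apply: loD => //; exact: loN. Qed.

Lemma loZ (V : normedModType C) (k : nat) (a : C) (f : C -> V) :
  lo k f -> lo k (fun t => a *: f t).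
Proof. by apply: (@lo_le _ _ _ _ _ (nm a)); exists 1 => // t _; rewrite nmZ. Qed.

Lemma lo0 (V : normedModType C) (k : nat) : lo k (fun _ => 0 : V).
Proof.
move=> e e0; exists 1 => // t _; rewrite nm0 mulr_ge0 ?exprn_ge0 ?nm_ge0 //.
exact: ltW.
Qed.

Lemma lo_sum (V : normedModType C) (I : Type) (s : seq I) (k : nat) (f : I -> C -> V) :
  (forall i, lo k (f i)) -> lo k (fun t => \sum_(i <- s) f i t).
Proof.
move=> hf; elim: s => [|i s IH].
  by apply: eq_lo (lo0 V k) => t; rewrite big_nil.
by apply: eq_lo (loD (hf i) IH) => t; rewrite big_cons.
Qed.

Lemma lo_bigO (V : normedModType C) (k : nat) (f : C -> V) (K : R) :
  (exists2 d : R, 0 < d & forall t, nm t < d -> nm (f t) <= K * nm t ^+ k.+1) -> lo k f.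
Proof.
move=> [d d0 hd] e e0; have K1 : 0 < `|K| + 1 by rewrite ltr_wpDl.
exists (Num.min d (e / (`|K| + 1))) => [|t]; first by rewrite lt_min d0 divr_gt0.
rewrite lt_min => /andP [/hd h1]; rewrite ltr_pdivlMr // => h2.
apply: (le_trans h1); rewrite exprS mulrA; apply: ler_wpM2r.
  by rewrite exprn_ge0 ?nm_ge0.
have h3 : K * nm t <= `|K| * nm t by rewrite ler_wpM2r ?nm_ge0 ?ler_norm.
have := nm_ge0 t; lra.
Qed.

Lemma lo_leq (V : normedModType C) (k m : nat) (f : C -> V) : (k <= m)%N -> lo m f -> lo k f.
Proof.
move=> km hf e e0; have [d d0 hd] := hf _ e0.
exists (Num.min d 1) => [|t]; first by rewrite lt_min d0 ltr01.
rewrite lt_min => /andP [/hd h1 h2]; apply: (le_trans h1).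
by rewrite ler_pM2l // ler_wiXn2l ?nm_ge0 ?(ltW h2).
Qed.

Lemma lo_monom (V : normedModType C) (k n : nat) (v : V) : (k < n)%N ->
  lo k (fun t => t ^+ n *: v).
Proof.
move=> kn; apply: (@lo_leq _ _ n.-1); first by rewrite -ltnS prednK // (leq_trans _ kn).
apply: (@lo_bigO _ _ _ (nm v)); exists 1 => // t _.
by rewrite prednK ?(leq_trans _ kn) // nmZ nmX mulrC.
Qed.

Lemma lo_small (V : normedModType C) (k : nat) (f : C -> V) : lo k f ->
  forall e : R, 0 < e -> exists2 d : R, 0 < d & forall t, nm t < d -> nm (f t) < e.
Proof.
move=> /(lo_leq (leq0n k)) hf e e0; have [|d d0 hd] := hf (e / 2).
  by rewrite divr_gt0.
by exists d => // t /hd; rewrite expr0 mulr1; lra.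
Qed.

Lemma lo0_at0 (V : normedModType C) (k : nat) (f : C -> V) : lo k f -> f 0 = 0.
Proof.
move=> hf; apply: nm_eq0; apply/eqP; rewrite eq_le nm_ge0 andbT.
apply/ler_addgt0Pl => e e0; rewrite addr0.
by have [d d0 hd] := lo_small hf e0; apply: ltW; apply: hd; rewrite nm0.
Qed.

Lemma lo_divX (k : nat) (f : C -> C) : lo k.+1 (fun t => t * f t) -> f 0 = 0 -> lo k f.
Proof.
move=> hf f0 e e0; have [d d0 hd] := hf e e0; exists d => // t ht.
have [->|t0] := eqVneq t 0.
  by rewrite f0 nm0 mulr_ge0 ?exprn_ge0 // ltW.
have tp : 0 < nm t.
  by rewrite lt_neqAle nm_ge0 andbT eq_sym; apply: contra_neq t0 => /nm_eq0.
by have := hd t ht; rewrite nmM exprS mulrCA ler_pM2l.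
Qed.

Lemma lo_poly (m : nat) (a : nat -> C) :
  lo m (fun t => \sum_(i < m.+1) a i * t ^+ i) -> forall i, (i <= m)%N -> a i = 0.
Proof.
elim: m a => [|m IH] a ha i.
  rewrite leqn0 => /eqP ->; have := lo0_at0 ha.
  by rewrite big_ord1 expr0 mulr1.
have a0 : a 0%N = 0.
  have := lo0_at0 ha; rewrite big_ord_recl expr0 mulr1 big1 ?addr0 // => j _.
  by rewrite expr0n mulr0.
case: i => [//|i]; rewrite ltnS => im.
apply: (IH (fun i => a i.+1)) im.
have hS : lo m.+1 (fun t => t * \sum_(i < m.+1) a i.+1 * t ^+ i).
  apply: eq_lo ha => t; rewrite big_ord_recl a0 mul0r add0r mulr_sumr.
  by apply: eq_bigr => j _; rewrite exprS; ring.
(* Division by t yields a function that is o(t^m) only if its value [a 1] at 0 vanishes. If it does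
   not, the undivided estimate at small real t makes [a 1] arbitrarily small. *)
have [e1|e1] := eqVneq (a 1%N) 0.
  apply: lo_divX => //; rewrite big_ord_recl e1 mul0r add0r big1 // => j _.
  by rewrite expr0n mulr0.
exfalso; move/eqP: e1; apply.
apply: nm_eq0; apply/eqP; rewrite eq_le nm_ge0 andbT.
apply/ler_addgt0Pl => e e0; rewrite addr0.
have e2 : 0 < e / 2 by rewrite divr_gt0.
pose S t := \sum_(i < m) a i.+2 * t ^+ i.+1.
have hq t : \sum_(i < m.+1) a i.+1 * t ^+ i = a 1%N + S t.
  by rewrite big_ord_recl expr0 mulr1.
have [d d0 hd] : exists2 d : R, 0 < d & forall t, nm t < d -> nm (S t) < e / 2.
  apply: (@lo_small _ 0) => //; apply: (@lo_sum C 'I_m _ 0 (fun (i : 'I_m) (t : C) => a i.+2 * t ^+ i.+1 : C)).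
  move=> j; apply: eq_lo (@lo_monom C 0 j.+1 (a j.+2) isT) => t.
  by rewrite [RHS]mulrC.
have [c c0 hc] := hS _ e2.
pose t : C := (Num.min (Num.min c d / 2) 1)%:C%C.
have t0 : 0 < Num.min (Num.min c d / 2) 1 by rewrite lt_min ltr01 divr_gt0 // lt_min c0.
have tn : nm t = Num.min (Num.min c d / 2) 1 by rewrite nmR gtr0_norm.
have tcd : nm t < Num.min c d.
  rewrite tn; apply: (@le_lt_trans _ _ (Num.min c d / 2)); first by rewrite ge_min lexx.
  have : 0 < Num.min c d by rewrite lt_min c0.
  by lra.
move: tcd; rewrite lt_min => /andP [/hc h1 /hd h2].
have t1 : nm t <= 1 by rewrite tn ge_min lexx orbT.
move: h1; rewrite hq nmM exprS mulrCA ler_pM2l ?tn // -tn => h1.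
have h3 : nm (a 1%N + S t) <= e / 2.
  apply: (le_trans h1); rewrite -[leRHS]mulr1; apply: ler_wpM2l; first exact: ltW.
  by apply: exprn_ile1; rewrite ?nm_ge0.
have := nmB (a 1%N + S t) (S t); rewrite addrK; lra.
Qed.

(** The Taylor coefficients up to order m vanish, so [f] is its own remainder. *)
Lemma schwarz (m : nat) (f : C -> C) (rho M : R) : 0 < rho ->
  (forall z, nm z < rho -> differentiable f z) ->
  (forall z, nm z < rho -> nm (f z) <= M) -> lo m f ->
  forall z, nm z < rho / 8 -> nm (f z) <= 8 * M * (4 * nm z / rho) ^+ m.+1.
Proof.
move=> r0 df fM hf; have [a ha] := taylor_disc r0 df fM.
have r8 : 0 < rho / 8 by rewrite divr_gt0.
have a0 : forall i, (i <= m)%N -> a i = 0.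
  apply: lo_poly.
  have h1 : lo m (fun t => f t - \sum_(i < m.+1) a i * t ^+ i).
    apply: (@lo_bigO _ _ _ (8 * M * (4 / rho) ^+ m.+1)); exists (rho / 8) => // t ht.
    by apply: (le_trans (ha m.+1 t ht)); rewrite [4 * nm t / _]mulrAC exprMn mulrA.
  by apply: eq_lo (loB hf h1) => t; rewrite opprB addrC subrK.
move=> z hz; have := ha m.+1 z hz.
rewrite big1 ?subr0 // => i _; by rewrite a0 ?mul0r // -ltnS.
Qed.

(** This extracts the leading term of an error of order o(t^m). No bound on [f] is assumed: [lo]
    provides one on a smaller disc. *)
Lemma taylor_lo (m : nat) (f : C -> C) (rho : R) : 0 < rho ->
  (forall z, nm z < rho -> differentiable f z) -> lo m f ->
  exists b : C, lo m.+1 (fun t => f t - t ^+ m.+1 * b).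
Proof.
move=> r0 df hf.
have [d d0 hd] : exists2 d : R, 0 < d & forall t, nm t < d -> nm (f t) < 1.
  exact: lo_small hf _ ltr01.
pose r := Num.min rho d.
have rp : 0 < r by rewrite lt_min r0.
have df' z : nm z < r -> differentiable f z by rewrite lt_min => /andP [/df].
have fM z : nm z < r -> nm (f z) <= 1 by rewrite lt_min => /andP [_ /hd /ltW].
have [a ha] := taylor_disc rp df' fM.
have r8 : 0 < r / 8 by rewrite divr_gt0.
have hk k : lo k (fun t => f t - \sum_(i < k.+1) a i * t ^+ i).
  apply: (@lo_bigO _ _ _ (8 * 1 * (4 / r) ^+ k.+1)); exists (r / 8) => // t ht.
  by apply: (le_trans (ha k.+1 t ht)); rewrite [4 * nm t / _]mulrAC exprMn mulrA.
have a0 : forall i, (i <= m)%N -> a i = 0.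
  apply: lo_poly.
  by apply: eq_lo (loB hf (hk m)) => t; rewrite opprB addrC subrK.
exists (a m.+1); apply: eq_lo (hk m.+1) => t.
rewrite big_ord_recr /= big1 ?add0r => [|i _]; first by rewrite mulrC.
by rewrite a0 ?mul0r // -ltnS.
Qed.

(** Cauchy's estimate for the leading coefficient, through the Schwarz lemma at small t. It turns a
    bound on all lifts over one disc into a bound on their coefficient vectors. *)
Lemma coef_bound (m : nat) (f : C -> C) (b : C) (rho M : R) : 0 < rho -> 
  (forall z, nm z < rho -> differentiable f z) ->
  (forall z, nm z < rho -> nm (f z) <= M) ->
  lo m.+1 (fun t => f t - t ^+ m.+1 * b) -> nm b <= 8 * M * (4 / rho) ^+ m.+1.
Proof.
move=> r0 df fM hf.
have r8 : 0 < rho / 8 by rewrite divr_gt0.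
have lom : lo m f.
  have h := @lo_monom C m m.+1 b (leqnn _).
  by apply: eq_lo (loD (lo_leq (leqnSn m) hf) h) => t; rewrite subrK.
have hs := schwarz r0 df fM lom.
apply/ler_addgt0Pl => e e0.
have [d d0 hd] := hf _ e0.
pose t : C := (Num.min d (rho / 8) / 2)%:C%C.
have md : 0 < Num.min d (rho / 8) by rewrite lt_min d0.
have tn : nm t = Num.min d (rho / 8) / 2 by rewrite nmR gtr0_norm // divr_gt0.
have t0 : 0 < nm t by rewrite tn divr_gt0.
have : nm t < Num.min d (rho / 8) by rewrite tn; lra.
rewrite lt_min => /andP [/hd h1 /hs h2].
have tk : 0 < nm t ^+ m.+1 by rewrite exprn_gt0.
rewrite -(ler_pM2l tk) -nmX -nmM -[t ^+ m.+1 * b](subKr (f t)) opprB addrC.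
have := nmD (t ^+ m.+1 * b - f t) (f t); rewrite subrK => h3.
apply: (le_trans h3).
have -> : nm (t ^+ m.+1) * (e + 8 * M * (4 / rho) ^+ m.+1) =
  e * nm t ^+ m.+1 + 8 * M * (4 * nm t / rho) ^+ m.+1.
  rewrite nmX [4 * nm t / rho]mulrAC [(4 / rho * _) ^+ _]exprMn; ring.
by apply: lerD => //; rewrite nmC.
Qed.

(** On the complex line through y and x this is the Taylor estimate with [k = 1]. Any constant [c]
    may be subtracted first, so [M] measures oscillation only. *)
Lemma lipschitz_holomorphic (V : normedModType C) (f : V -> C) (y : V) (c : C) (rho M : R) :
  0 < rho ->
  (forall z, nm (z - y) < rho -> differentiable f z) ->
  (forall z, nm (z - y) < rho -> nm (f z - c) <= M) ->
  forall x, nm (x - y) < rho / 8 -> nm (f x - f y) <= 32 * M / rho * nm (x - y).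
Proof.
move=> r0 df fM x hx.
have [->|xy] := eqVneq x y; first by rewrite !subrr !nm0 mulr0.
have n0 : 0 < nm (x - y).
  rewrite lt_neqAle nm_ge0 andbT eq_sym; apply: contra_neq xy => /nm_eq0 /eqP.
  by rewrite subr_eq0 => /eqP.
pose v := (nm (x - y))^-1%:C%C *: (x - y).
have v1 : nm v = 1 by rewrite nmZ nmR normfV gtr0_norm // mulVf // gt_eqF.
have hyp (t : C) : nm (y + t *: v - y) = nm t by rewrite addrC addKr nmZ v1 mulr1.
pose g (t : C) := f (y + t *: v) - c.
have dg t : nm t < rho -> differentiable g t.
  move=> ht; apply: differentiableB; last exact: differentiable_cst.
  apply: differentiable_comp; last by apply: df; rewrite hyp.
  apply: differentiableD; first exact: differentiable_cst.
  exact: differentiableZl.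
have gM t : nm t < rho -> nm (g t) <= M by move=> ht; apply: fM; rewrite hyp.
have [a ha] := taylor_disc r0 dg gM.
have r8 : 0 < rho / 8 by rewrite divr_gt0.
have a0 : g 0 = a 0%N.
  have := ha 1%N 0; rewrite nm0 big_ord1 !expr1 expr0 mulr1 mulr0 mul0r mulr0.
  move=> /(_ r8) h; apply/eqP; rewrite -subr_eq0; apply/eqP/nm_eq0/eqP.
  by rewrite eq_le h nm_ge0.
pose t : C := (nm (x - y))%:C%C.
have tn : nm t = nm (x - y) by rewrite nmR gtr0_norm.
have := ha 1%N t; rewrite tn big_ord1 expr0 mulr1 -a0 expr1 => /(_ hx).
have -> : g t - g 0 = f x - f y.
  rewrite /g scale0r addr0 opprB addrA subrK /v scalerA /t.
  rewrite -rmorphM /= mulfV ?gt_eqF // scale1r.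
  by congr (f _ - _); rewrite addrC subrK.
move=> h; apply: (le_trans h); rewrite le_eqVlt; apply/orP; left; apply/eqP.
by field; rewrite gt_eqF.
Qed.

(** Strict differentiability: both points move near [a]. For holomorphic maps it follows from
    differentiability on a ball, by the Lipschitz estimate for f minus its derivative. *)
Definition sdiff (V W : normedModType C) (f : V -> W) (a : V) (L : V -> W) : Prop :=
  forall e : R, 0 < e -> exists2 d : R, 0 < d &
  forall x y, nm (x - a) < d -> nm (y - a) < d ->
  nm (f x - f y - L (x - y)) <= e * nm (x - y).

Lemma sdiff_scalar (V : normedModType C) (f : V -> C) (a : V) (rho : R) :
  0 < rho -> (forall z, nm (z - a) < rho -> differentiable f z) ->
  sdiff f a ('d f a).
Proof.
move=> r0 df e e0; have daf : differentiable f a by apply: df; rewrite subrr nm0.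
have Tc := diff_continuous daf.
(* The Lipschitz constant is 32 (e / 64 D) / (D / 2) = e. *)
have e' : 0 < e / 64 by rewrite divr_gt0.
have [d d0 hd] := differentiable_eps daf e'.
pose D := Num.min d rho; have D0 : 0 < D by rewrite lt_min d0.
exists (D / 32) => [|x y hx hy]; first by rewrite divr_gt0.
pose g z := f z - 'd f a (z - a).
have D2 : 0 < D / 2 by rewrite divr_gt0.
have inD z : nm (z - y) < D / 2 -> nm (z - a) < D.
  move=> hz; have := nmD (z - y) (y - a); rewrite addrA subrK; lra.
have dg z : nm (z - y) < D / 2 -> differentiable g z.
  move=> /inD; rewrite lt_min => /andP [_ hz]; apply: differentiableB; first exact: df.
  apply: (@differentiable_comp _ _ _ _ (fun z => z - a) ('d f a)).
    by apply: differentiableB => //; exact: differentiable_cst.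
  exact: linear_differentiable.
have gM z : nm (z - y) < D / 2 -> nm (g z - f a) <= e / 64 * D.
  move=> /inD hz; move: (hz); rewrite lt_min => /andP [hz1 _].
  have := hd _ hz1; rewrite [a + _]addrC subrK /g addrAC => h.
  by apply: (le_trans h); rewrite ler_pM2l // ltW.
have hxy : nm (x - y) < D / 2 / 8.
  have := nmB (x - a) (y - a); rewrite opprB addrA subrK; lra.
have := lipschitz_holomorphic D2 dg gM hxy.
have -> : g x - g y = f x - f y - 'd f a (x - y).
  have -> : x - y = (x - a) - (y - a) by rewrite opprB addrA subrK.
  rewrite /g [in RHS]linearB opprB; set u := 'd f a (x - a); set w := 'd f a (y - a).
  by ring.
move=> h; apply: (le_trans h); rewrite le_eqVlt; apply/orP; left; apply/eqP.
by field; rewrite gt_eqF.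
Qed.

(** The radius [d] comes from the differentiability of the row-valued map itself, so one radius
    serves all coordinates in the scalar argument. *)
Lemma sdiff_row (V : normedModType C) n (f : V -> 'rV[C]_n) (a : V) (rho : R) :
  0 < rho -> (forall z, nm (z - a) < rho -> differentiable f z) ->
  sdiff f a ('d f a).
Proof.
move=> r0 df e e0; have daf : differentiable f a by apply: df; rewrite subrr nm0.
have dcoord i z : nm (z - a) < rho -> differentiable (fun z => f z 0 i) z.
  move=> /df h; apply: (@differentiable_comp _ _ _ _ f (fun w => w 0 i)) => //.
  exact: differentiable_coord.
have Tc := diff_continuous daf.
have e' : 0 < e / 64 by rewrite divr_gt0.
have [d d0 hd] := differentiable_eps daf e'.
pose D := Num.min d rho; have D0 : 0 < D by rewrite lt_min d0.
exists (D / 32) => [|x y hx hy]; first by rewrite divr_gt0.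
apply/nm_rV => [|i]; first by rewrite mulr_ge0 ?nm_ge0 // ltW.
pose L (z : V) : C := ('d f a z) 0 i.
have Ll : linear L by move=> k u v; rewrite /L linearP !mxE.
pose g z := f z 0 i - mklin Ll (z - a).
have D2 : 0 < D / 2 by rewrite divr_gt0.
have inD z : nm (z - y) < D / 2 -> nm (z - a) < D.
  move=> hz; have := nmD (z - y) (y - a); rewrite addrA subrK; lra.
have dg z : nm (z - y) < D / 2 -> differentiable g z.
  move=> /inD; rewrite lt_min => /andP [_ hz]; apply: differentiableB; first exact: dcoord.
  apply: (@differentiable_comp _ _ _ _ (fun z => z - a) (mklin Ll)).
    by apply: differentiableB => //; exact: differentiable_cst.
  apply: linear_differentiable => u /=.
  apply: (@continuous_comp _ _ _ ('d f a) (fun w => w 0 i)); first exact: Tc.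
  exact: coord_continuous.
have gM z : nm (z - y) < D / 2 -> nm (g z - f a 0 i) <= e / 64 * D.
  move=> /inD hz; move: (hz); rewrite lt_min => /andP [hz1 _].
  have := hd _ hz1; rewrite [a + _]addrC subrK => h.
  have -> : g z - f a 0 i = (f z - f a - 'd f a (z - a)) 0 i.
    by rewrite /g /= /L !mxE addrAC.
  apply: (le_trans (nm_coord _ _)).
  by apply: (le_trans h); rewrite ler_pM2l // ltW.
have hxy : nm (x - y) < D / 2 / 8.
  have := nmB (x - a) (y - a); rewrite opprB addrA subrK; lra.
have := lipschitz_holomorphic D2 dg gM hxy.
have -> : g x - g y = (f x - f y - 'd f a (x - y)) 0 i.
  have -> : x - y = (x - a) - (y - a) by rewrite opprB addrA subrK.
  rewrite /g /= /L [in RHS]linearB !mxE opprB.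
  set u := 'd f a (x - a) 0 i; set w := 'd f a (y - a) 0 i.
  by ring.
move=> h; apply: (le_trans h); rewrite le_eqVlt; apply/orP; left; apply/eqP.
by field; rewrite gt_eqF.
Qed.
End LittleO.

(** * Zero sets along approximate curves *)

Section InverseFunction.
Context {R : realType}.
Local Notation C := (cplx R).
Local Notation Re := (@complex.Re R).
Local Notation Im := (@complex.Im R).

(** The intervals of radius 2 B / 2^k about [u k] are nested. *)
Lemma geometric_limit (u : nat -> R) (B : R) : 0 <= B ->
  (forall k, `|u k.+1 - u k| <= B / 2 ^+ k) ->
  exists l, forall k, `|u k - l| <= 2 * B / 2 ^+ k.
Proof.
move=> B0 hu.
have p k : 0 < 2 ^+ k :> R by rewrite exprn_gt0.
have hS k : B / 2 ^+ k = 2 * (B / 2 ^+ k.+1).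
  by rewrite exprS; field; rewrite gt_eqF // p.
pose b k := B / 2 ^+ k.
have b0 k : 0 <= b k by rewrite divr_ge0 // ltW // p.
have step m : u m - 2 * b m <= u m.+1 - 2 * b m.+1 /\
   u m.+1 + 2 * b m.+1 <= u m + 2 * b m.
  have := hu m; rewrite -/(b m) ler_norml => /andP [h1 h2].
  have hb : b m = 2 * b m.+1 := hS m.
  by move: (u m) (u m.+1) (b m) (b m.+1) hb h1 h2 => ? ? ? ? hb h1 h2; clear -hb h1 h2; split; lra.
have [|m n mn|l hl] := @nested_limit R (fun k => u k - 2 * b k) (fun k => 4 * b k).
- by move=> k; rewrite mulr_ge0.
- elim: n mn => [|n IH]; first by rewrite leqn0 => /eqP ->.
  rewrite leq_eqVlt => /orP [/eqP ->//|/IH [i1 i2]].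
  have [s1 s2] := step n.
  move: (u m) (u n) (u n.+1) (b m) (b n) (b n.+1) i1 i2 s1 s2 => ? ? ? ? ? ? i1 i2 s1 s2.
  by clear -i1 i2 s1 s2; split; lra.
exists l => k; have /andP [h1 h2] := hl k; rewrite -mulrA -/(b k) ler_norml.
by move: (u k) (b k) h1 h2 => ? ? h1 h2; clear -h1 h2; lra.
Qed.

Lemma geometric_limit_C (u : nat -> C) (B : R) : 0 <= B ->
  (forall k, nm (u k.+1 - u k) <= B / 2 ^+ k) ->
  exists l, forall k, nm (u k - l) <= 4 * B / 2 ^+ k.
Proof.
move=> B0 hu.
have [|a ha] := @geometric_limit (fun k => Re (u k)) B B0.
  by move=> k; apply: le_trans (hu k); rewrite -cReN -cReD nm_Re.
have [|b hb] := @geometric_limit (fun k => Im (u k)) B B0.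
  by move=> k; apply: le_trans (hu k); rewrite -cImN -cImD nm_Im.
exists (pt a b) => k; apply: (le_trans (nm_ReIm _)).
rewrite cReD cReN cImD cImN /=; have := ha k; have := hb k; rewrite -!mulrA.
by move: (_ / _) => ?; lra.
Qed.

Lemma geometric_limit_row n (u : nat -> 'rV[C]_n) (B : R) : 0 <= B ->
  (forall k, nm (u k.+1 - u k) <= B / 2 ^+ k) ->
  exists l, forall k, nm (u k - l) <= 4 * B / 2 ^+ k.
Proof.
move=> B0 hu.
have H i : exists l, forall k, nm (u k 0 i - l) <= 4 * B / 2 ^+ k.
  apply: geometric_limit_C => // k; apply: le_trans (hu k).
  by have := nm_coord (u k.+1 - u k) i; rewrite !mxE.
have [l hl] := choice H.
exists (\row_i l i) => k; apply/nm_rV => [|i]; last by rewrite !mxE.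
by rewrite divr_ge0 ?mulr_ge0 // exprn_ge0.
Qed.

Lemma nm_mulmx m n (A : 'M[C]_(m, n)) : exists2 K : R, 0 < K &
  forall u : 'rV[C]_m, nm (u *m A) <= K * nm u.
Proof.
exists (1 + \sum_i \sum_j nm (A i j)) => [|u].
  by rewrite ltr_wpDr // sumr_ge0 // => i _; rewrite sumr_ge0 // => j _; exact: nm_ge0.
have S0 : 0 <= \sum_i \sum_j nm (A i j).
  by rewrite sumr_ge0 // => i _; rewrite sumr_ge0 // => j _; exact: nm_ge0.
apply/nm_rV => [|j]; first by rewrite mulr_ge0 ?nm_ge0 // addr_ge0.
rewrite mxE; apply: (le_trans (nm_sum _ _ _)).
apply: (@le_trans _ _ (\sum_i nm (A i j) * nm u)).
  apply: ler_sum => i _; rewrite nmM mulrC; apply: ler_wpM2l; [exact: nm_ge0|exact: nm_coord].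
rewrite -mulr_suml; apply: ler_wpM2r; first exact: nm_ge0.
apply: (@le_trans _ _ (\sum_i \sum_j nm (A i j))); last by rewrite lerDr.
apply: ler_sum => i _; rewrite (bigD1 j) //= lerDl sumr_ge0 // => k _.
exact: nm_ge0.
Qed.

Lemma half_pow (B e : R) : 0 < e -> exists k, B / 2 ^+ k < e.
Proof.
move=> e0; pose k := Num.bound (`|B| / e).
exists k; rewrite ltr_pdivrMr ?exprn_gt0 // mulrC -ltr_pdivrMr //.
apply: (@le_lt_trans _ _ (`|B| / e)).
  by apply: ler_wpM2r; [rewrite invr_ge0 ltW|exact: ler_norm].
apply: (@lt_trans _ _ k%:R); first by rewrite archi_boundP // divr_ge0 // ltW.
by rewrite -natrX ltr_nat ltn_expl.
Qed.

Section IFT.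
Variables (n : nat) (phi : 'rV[C]_n -> 'rV[C]_n) (c : 'rV[C]_n) (rho : R) (N : 'M[C]_n).
Hypothesis rho0 : 0 < rho.
Hypothesis dphi : forall z, nm (z - c) < rho -> differentiable phi z.
Hypothesis unitN : N \in unitmx.
Hypothesis phiN : forall u, 'd phi c u = u *m N.

Lemma almost_identity : exists2 K : R, 0 < K & exists2 r : R, 0 < r <= rho &
  (forall u : 'rV[C]_n, nm (u *m invmx N) <= K * nm u) /\
  forall x y, nm (x - c) < r -> nm (y - c) < r ->
  nm ((phi x - phi y) *m invmx N - (x - y)) <= nm (x - y) / 2.
Proof.
have [K K0 hK] := nm_mulmx (invmx N); exists K => //.
have e0 : 0 < (2 * K)^-1 by rewrite invr_gt0 mulr_gt0.
have [d d0 hd] := sdiff_row rho0 dphi e0.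
exists (Num.min d rho); first by rewrite lt_min d0 rho0 ge_min lexx orbT.
split=> // x y; rewrite !lt_min => /andP [hx _] /andP [hy _].
have -> : (phi x - phi y) *m invmx N - (x - y) =
   (phi x - phi y - 'd phi c (x - y)) *m invmx N.
  by rewrite phiN [in RHS]mulmxBl mulmxK.
apply: (le_trans (hK _)); have := hd x y hx hy; rewrite -(ler_pM2l K0) => h.
by apply: (le_trans h); rewrite le_eqVlt; apply/orP; left; apply/eqP; field; rewrite gt_eqF.
Qed.

(** Preimages are limits of the Newton iteration with the derivative frozen at [c], a contraction by
    1/2. The same estimate makes [phi] expanding up to a constant, so [psi] is well defined and
    Lipschitz. *)
Lemma inverse_function : exists r s K : R, exists psi : 'rV[C]_n -> 'rV[C]_n,
  [/\ 0 < r <= rho, 0 < s, 0 < K &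
  [/\ forall y, nm (y - phi c) < s -> nm (psi y - c) < r /\ phi (psi y) = y,
      forall x, nm (x - c) < r -> nm (phi x - phi c) < s -> psi (phi x) = x,
      forall x y, nm (x - phi c) < s -> nm (y - phi c) < s ->
        nm (psi x - psi y) <= K * nm (x - y)
    & forall y, nm (y - phi c) < s -> differentiable psi y]].
Proof.
have [K K0 [r /andP [r0 rrho] [hK hr]]] := almost_identity.
(* The first Newton step then has length at most K s = r / 4; the steps halve, so all iterates stay
   within r / 2 of [c]. *)
pose s := r / (4 * K); have s0 : 0 < s by rewrite divr_gt0 // mulr_gt0.
have Ks : K * s = r / 4 by rewrite /s; field; rewrite gt_eqF.
have expand x y : nm (x - c) < r -> nm (y - c) < r -> nm (x - y) <= 2 * K * nm (phi x - phi y).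
  move=> hx hy; have h1 := hr x y hx hy; have h2 := hK (phi x - phi y).
  have := nmB ((phi x - phi y) *m invmx N) ((phi x - phi y) *m invmx N - (x - y)).
  rewrite subKr; move: (nm (x - y)) h1 h2 => t h1 h2 h3.
  by move: (nm _) (nm _) (nm _) h1 h2 h3 => ? ? ? h1 h2 h3; lra.
have surj y : nm (y - phi c) < s -> exists x, nm (x - c) < r /\ phi x = y.
  move=> hy; pose T x := x + (y - phi x) *m invmx N.
  have Tc x x' : nm (x - c) < r -> nm (x' - c) < r -> nm (T x - T x') <= nm (x - x') / 2.
    move=> hx hx'; apply: le_trans (hr x x' hx hx').
    rewrite -nmN le_eqVlt; apply/orP; left; apply/eqP; congr nm.
    rewrite /T !mulmxBl; move: (y *m _) (phi x *m _) (phi x' *m _) => a b b'.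
    by apply/rowP => i; rewrite !mxE; ring.
  have [x [x0 xS]] : exists x : nat -> 'rV[C]_n, x 0 = c /\ forall k, x k.+1 = T (x k).
    by exists (fun k => iter k T c).
  have q k : 0 <= (2 ^+ k)^-1 :> R by rewrite invr_ge0 exprn_ge0.
  have e k : (2 ^+ k.+1)^-1 = (2 ^+ k)^-1 / 2 :> R by rewrite exprS invfM mulrC.
  have hc : nm (T c - c) <= r / 4.
    rewrite /T [c + _]addrC addrK -Ks; apply: (le_trans (hK _)).
    by rewrite ler_pM2l // ltW.
  have Tl l : T l = l -> phi l = y.
    move=> Tl; have : (y - phi l) *m invmx N = 0.
      by move: Tl; rewrite /T => /(canRL (addKr _)); rewrite addNr.
    move/(congr1 (mulmx^~ N)); rewrite mulmxKV // mul0mx => /eqP.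
    by rewrite subr_eq0 => /eqP.
  clearbody T.
  have hx k : nm (x k.+1 - x k) <= r / 4 / 2 ^+ k /\ nm (x k - c) <= r / 2 - r / 2 / 2 ^+ k.
    elim: k => [|k [IH1 IH2]].
      by rewrite xS x0 expr0 !divr1 subrr subrr nm0.
    have p1 : 0 <= r / 4 / 2 ^+ k by rewrite mulr_ge0 // divr_ge0 // ltW.
    have p2 : r / 2 / 2 ^+ k = 2 * (r / 4 / 2 ^+ k) by field; rewrite expf_neq0 // pnatr_eq0.
    have p3 : r / 4 / 2 ^+ k.+1 = (r / 4 / 2 ^+ k) / 2 by rewrite e mulrA.
    have p4 : r / 2 / 2 ^+ k.+1 = r / 4 / 2 ^+ k by rewrite e mulrA p2; field; rewrite expf_neq0 // pnatr_eq0.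
    have hk1 : nm (x k.+1 - c) <= r / 2 - r / 2 / 2 ^+ k.+1.
      have -> : x k.+1 - c = (x k.+1 - x k) + (x k - c) by rewrite addrA subrK.
      apply: (le_trans (nmD _ _)); apply: (le_trans (lerD IH1 IH2)).
      by rewrite p2 p4; lra.
    split=> //.
    have hk : nm (x k - c) < r by apply: (le_lt_trans IH2); rewrite p2 {IH1 IH2}; lra.
    have hk2 : nm (x k.+1 - c) < r by apply: (le_lt_trans hk1); rewrite p4 {IH1 IH2 hk1 hk}; lra.
    have h1 := Tc _ _ hk2 hk; rewrite -!xS in h1.
    by apply: (le_trans h1); rewrite p3 ler_pM2r // invr_gt0.
  have r40 : 0 <= r / 4 by lra.
  have [l hl] := geometric_limit_row r40 (fun k => (hx k).1).
  have e4 : 4 * (r / 4) = r by field.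
  rewrite e4 in hl.
  have xr k : nm (x k - c) <= r / 2.
    apply: (le_trans (hx k).2); have : 0 <= r / 2 / 2 ^+ k by rewrite mulr_ge0 // divr_ge0 // ltW.
    by lra.
  have lr : nm (l - c) <= r / 2.
    apply/ler_addgt0Pl => d d0; have [k hk] := half_pow r d0.
    have -> : l - c = (l - x k) + (x k - c) by rewrite addrA subrK.
    apply: (le_trans (nmD _ _)); apply: lerD; last exact: xr.
    by rewrite nmC; apply: (le_trans (hl k)); exact: ltW.
  have lr' : nm (l - c) < r by lra.
  exists l; split=> //; apply: Tl; apply/eqP; rewrite -subr_eq0; apply/eqP.
  apply: nm_eq0; apply/eqP; rewrite eq_le nm_ge0 andbT.
  apply/ler_addgt0Pl => d d0; rewrite addr0.
  have d2 : 0 < d / 2 by rewrite divr_gt0.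
  have [k hk] := half_pow r d2.
  have -> : T l - l = (T l - T (x k)) + (x k.+1 - l) by rewrite xS addrA subrK.
  apply: (le_trans (nmD _ _)); rewrite [d]splitr; apply: lerD.
    have xr' : nm (x k - c) < r by apply: (le_lt_trans (xr k)); lra.
    apply: (le_trans (Tc _ _ lr' xr')); rewrite nmC.
    apply: (@le_trans _ _ (nm (x k - l))); last by apply: (le_trans (hl k)); exact: ltW.
    by rewrite ler_pdivrMr // ler_peMr ?nm_ge0 // ler1n.
  apply: (le_trans (hl _)); apply: le_trans (ltW hk); rewrite ler_pM2l //.
  by rewrite e; have := q k; move: (_^-1) => t; lra.
pose psi y := xget 0 [set x | nm (x - c) < r /\ phi x = y].
have psiP y : nm (y - phi c) < s -> nm (psi y - c) < r /\ phi (psi y) = y.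
  by move=> /surj [x hx]; exact: (@xgetI _ 0 [set x | nm (x - c) < r /\ phi x = y] x hx).
have psiL x y : nm (x - phi c) < s -> nm (y - phi c) < s ->
    nm (psi x - psi y) <= 2 * K * nm (x - y).
  move=> /psiP [hx ex] /psiP [hy ey].
  by have := expand _ _ hx hy; rewrite ex ey.
exists r, s, (2 * K), psi; split=> //; first by rewrite r0.
  by rewrite mulr_gt0.
split=> //.
  move=> x hx hs; have [h1 h2] := psiP _ hs.
  have := expand _ _ h1 hx; rewrite h2 subrr nm0 mulr0 => h3.
  by apply/eqP; rewrite -subr_eq0; apply/eqP/nm_eq0/eqP; rewrite eq_le h3 nm_ge0.
move=> y hy; have [h1 h2] := psiP y hy.
set x := psi y in h1 h2.
have dx : differentiable phi x by apply: dphi; lra.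
(* The expansion between x and x + t h, for small t > 0, passes to the derivative at x, which is
   therefore invertible. *)
have Dlow h : nm h <= 4 * K * nm ('d phi x h).
  have e0 : 0 < (4 * K)^-1 by rewrite invr_gt0 mulr_gt0.
  have [d d0 hd] := differentiable_eps dx e0.
  pose m := Num.min d (r - nm (x - c)).
  have m0 : 0 < m by rewrite lt_min d0 subr_gt0.
  pose t := m / (nm h + 1).
  have h0 := nm_ge0 h.
  have t0 : 0 < t by rewrite divr_gt0 //; lra.
  have th : t * nm h < m.
    by rewrite /t mulrAC ltr_pdivrMr; [rewrite ltr_pM2l //; lra|lra].
  have ntC : nm (t%:C%C *: h) = t * nm h by rewrite nmZ nmR gtr0_norm.
  have hmd : t * nm h < d by apply: (lt_le_trans th); rewrite ge_min lexx.
  have hmr : t * nm h < r - nm (x - c) by apply: (lt_le_trans th); rewrite ge_min lexx orbT.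
  have k1 := hd (t%:C%C *: h); rewrite ntC in k1; have {}k1 := k1 hmd.
  have hx' : nm (x + t%:C%C *: h - c) < r.
    by rewrite addrAC; apply: (le_lt_trans (nmD _ _)); rewrite ntC -ltrBrDl.
  have := expand _ _ hx' h1; rewrite [x + _ - x]addrC addKr ntC => k2.
  have k3 := nmD (phi (x + t%:C%C *: h) - phi x - 'd phi x (t%:C%C *: h)) ('d phi x (t%:C%C *: h)).
  rewrite subrK linearZ nmZ nmR gtr0_norm // in k3.
  have k4 : nm (phi (x + t%:C%C *: h) - phi x) <= (4 * K)^-1 * (t * nm h) + t * nm ('d phi x h).
    by apply: (le_trans k3); rewrite lerD2r; move: k1; rewrite linearZ.
  have k5 : 2 * K * ((4 * K)^-1 * (t * nm h) + t * nm ('d phi x h)) =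
    t * (nm h / 2 + 2 * K * nm ('d phi x h)) by field; rewrite gt_eqF.
  have k6 : t * nm h <= t * (nm h / 2 + 2 * K * nm ('d phi x h)).
    by rewrite -k5; apply: (le_trans k2); rewrite ler_pM2l // mulr_gt0.
  move: k6; rewrite ler_pM2l // => {k1 k2 k3 k4 k5 hmd hmr hx' ntC th}.
  by move: (nm h) (nm _) {h0 t t0} => a b k6; lra.
pose M := lin1_mx ('d phi x).
have DM u : 'd phi x u = u *m M by exact: (esym (mul_rV_lin1 ('d phi x) u)).
have unitM : M \in unitmx.
  rewrite -row_free_unit -kermx_eq0; apply/eqP/row_matrixP => i; rewrite row0.
  have := Dlow (row i (kermx M)); rewrite DM -row_mul mulmx_ker row0 nm0 mulr0 => h.
  by apply: nm_eq0; apply/eqP; rewrite eq_le h nm_ge0.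
have [K' K'0 hK'] := nm_mulmx (invmx M).
have Ll : linear (fun u : 'rV[C]_n => u *m invmx M).
  by move=> a u v; rewrite mulmxDl scalemxAl.
suff [] : differentiable psi y /\ 'd psi y = mklin Ll :> ('rV[C]_n -> 'rV[C]_n) by [].
apply: (@eps_differentiable R _ _ psi y (mklin Ll) K' hK') => e e0.
have e1 : 0 < e / (K' * (2 * K)) by rewrite divr_gt0 // !mulr_gt0.
have [d d0 hd] := differentiable_eps dx e1.
exists (Num.min (s - nm (y - phi c)) (d / (2 * K))) => [|k].
  by rewrite lt_min subr_gt0 hy divr_gt0 // mulr_gt0.
rewrite lt_min => /andP [k1]; rewrite ltr_pdivlMr ?mulr_gt0 // => k2.
have hyk : nm (y + k - phi c) < s.
  by rewrite addrAC; apply: (le_lt_trans (nmD _ _)); rewrite -ltrBrDl.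
have l1 := psiL _ _ hyk hy; rewrite [y + k - y]addrC addKr in l1.
pose h := psi (y + k) - x.
have hh : nm h < d by apply: (le_lt_trans l1); rewrite mulrC.
have ex : x + h = psi (y + k) by rewrite /h addrC subrK.
have := hd h hh; rewrite ex (psiP _ hyk).2 h2 [y + k - y]addrC addKr => l2.
rewrite /mklin /= -/x -/h.
have -> : h - k *m invmx M = - ((k - 'd phi x h) *m invmx M).
  by rewrite DM mulmxBl mulmxK // opprB.
rewrite nmN; apply: (le_trans (hK' _)).
apply: (@le_trans _ _ (K' * (e / (K' * (2 * K)) * (2 * K * nm k)))).
  rewrite ler_pM2l //; apply: (le_trans l2); rewrite ler_pM2l //.
rewrite le_eqVlt; apply/orP; left; apply/eqP; field.
by rewrite !gt_eqF.
Qed.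
End IFT.
End InverseFunction.

(** * Vanishing to infinite order along directions *)

Section Vanishing.
Context {R : realType}.
Local Notation C := (cplx R).

(** The weights come from the inverse Vandermonde matrix at the nodes 0, ..., k - 1. They are
    independent of the polynomial, so estimates at the nodes carry over to [x]. *)
Lemma interpolation (k : nat) (x : C) : exists l : 'I_k -> C, forall a : 'I_k -> C,
  \sum_i a i * x ^+ i = \sum_j l j * \sum_i a i * (j%:R : C) ^+ i.
Proof.
pose node : 'rV[C]_k := \row_j (j%:R : C).
pose V := Vandermonde k node.
have unitV : V \in unitmx.
  rewrite unitmxE det_Vandermonde unitfE prodf_seq_neq0; apply/allP => i _ /=.
  rewrite prodf_seq_neq0; apply/allP => j _; apply/implyP => ij; rewrite !mxE subr_eq0.
  by rewrite eqr_nat; apply: contraTneq ij => ->; rewrite ltnn.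
pose b : 'cV[C]_k := \col_i x ^+ i.
pose l := invmx V *m b.
exists (fun j => l j 0) => a.
have hb (i : 'I_k) : \sum_j l j 0 * (j%:R : C) ^+ i = x ^+ i.
  have : (V *m l) i 0 = b i 0 by rewrite /l mulKVmx.
  rewrite !mxE => <-; apply: eq_bigr => j _; by rewrite !mxE mulrC.
rewrite (eq_bigr (fun i => \sum_j a i * (l j 0 * (j%:R : C) ^+ i))); last first.
  by move=> i _; rewrite -mulr_sumr hb.
rewrite exchange_big; apply: eq_bigr => j _; rewrite mulr_sumr.
by apply: eq_bigr => i _; rewrite mulrCA.
Qed.

Lemma differentiable_affine (V : normedModType C) (u v : V) (t : C) :
  differentiable (fun t : C => u + t *: v) t.
Proof.
by apply: differentiableD; [exact: differentiable_cst|exact: differentiableZl].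
Qed.

Lemma differentiable_coordf (V : normedModType C) n (f : V -> 'rV[C]_n) i z :
  differentiable f z -> differentiable (fun z => f z 0 i) z.
Proof.
move=> h; apply: (@differentiable_comp _ _ _ _ f (fun w => w 0 i)) => //.
exact: differentiable_coord.
Qed.

Lemma nm_pos (V : normedModType C) (x : V) : x != 0 -> 0 < nm x.
Proof. by move=> x0; rewrite lt_neqAle nm_ge0 andbT eq_sym; apply: contra_neq x0 => /nm_eq0. Qed.

(* The Taylor polynomial of mu |-> f (lam u1 + mu u2) is evaluated at mu = i lam
   by interpolation from its values at mu = j lam. *)
Lemma lo_complexify (V : normedModType C) (f : V -> C) (s : R) (u1 u2 : V) (k : nat) :
  0 < s -> (forall z, nm z < s -> differentiable f z) ->
  (forall z, nm z < s -> nm (f z) <= 1) ->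
  (forall j : nat, lo k (fun t => f (t *: (u1 + j%:R *: u2)))) ->
  lo k (fun t => f (t *: (u1 + 'i%C *: u2))).
Proof.
move=> s0 df fM hf.
pose K1 := nm u1 + 1; pose K2 := nm u2 + 1.
have K10 : 0 < K1 by rewrite ltr_wpDl ?nm_ge0.
have K20 : 0 < K2 by rewrite ltr_wpDl ?nm_ge0.
(* [s1] and [t0] allot s / 2 each to mu u2 and to t u1; [t1] below also keeps i t and all j t, j <=
   k, within s1 / 8, the range of the Taylor estimate. *)
pose s1 := s / (2 * K2); have s10 : 0 < s1 by rewrite divr_gt0 // mulr_gt0.
pose t0 := s / (2 * K1); have t00 : 0 < t0 by rewrite divr_gt0 // mulr_gt0.
have [l hl] := interpolation k.+1 'i%C.
pose B := 8 * 1 * (4 / s1) ^+ k.+1.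
have B0 : 0 <= B by rewrite mulr_ge0 // exprn_ge0 // divr_ge0 // ltW.
have s18 : 0 < s1 / 8 by rewrite divr_gt0.
have k1 : 0 < k.+1%:R :> R by [].
pose t1 := Num.min t0 (s1 / 8 / k.+1%:R).
have t10 : 0 < t1 by rewrite lt_min t00 divr_gt0.
have key (t : C) : nm t < t1 ->
    nm (f (t *: (u1 + 'i%C *: u2)) - \sum_j l j * f (t *: (u1 + (j%:R : C) *: u2))) <=
    (B + \sum_j nm (l j) * (B * k.+1%:R ^+ k.+1)) * nm t ^+ k.+1.
  rewrite lt_min => /andP [ht ht'].
  pose q (mu : C) := f (t *: u1 + mu *: u2).
  have small (mu : C) : nm mu < s1 -> nm (t *: u1 + mu *: u2) < s.
    move=> hm; apply: (le_lt_trans (nmD _ _)); rewrite !nmZ.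
    have h1 : nm t * nm u1 <= s / 2.
      apply: (@le_trans _ _ (nm t * K1)); first by rewrite ler_wpM2l ?nm_ge0 // lerDl.
      have -> : s / 2 = t0 * K1 by rewrite /t0; field; rewrite gt_eqF.
      by rewrite ler_pM2r // ltW.
    have h2 : nm mu * nm u2 < s / 2.
      apply: (@le_lt_trans _ _ (nm mu * K2)); first by rewrite ler_wpM2l ?nm_ge0 // lerDl.
      have -> : s / 2 = s1 * K2 by rewrite /s1; field; rewrite gt_eqF.
      by rewrite ltr_pM2r.
    by rewrite [s]splitr; apply: ler_ltD.
  have dq mu : nm mu < s1 -> differentiable q mu.
    move=> hm; rewrite /q; apply: (@differentiable_comp _ _ _ _ (fun mu : C => t *: u1 + mu *: u2) f).
      exact: differentiable_affine.
    by apply: df; exact: small.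
  have qM mu : nm mu < s1 -> nm (q mu) <= 1 by move=> hm; apply: fM; exact: small.
  have [a ha] := taylor_disc s10 dq qM.
  pose p (x : C) := \sum_(i < k.+1) (a i * t ^+ i) * x ^+ i.
  have hp (x : C) : nm x <= k.+1%:R ->
      nm (f (t *: (u1 + x *: u2)) - p x) <= B * nm x ^+ k.+1 * nm t ^+ k.+1.
    move=> hx; have hxt : nm (x * t) < s1 / 8.
      rewrite nmM; apply: (@le_lt_trans _ _ (k.+1%:R * nm t)).
        by rewrite ler_wpM2r ?nm_ge0.
      by rewrite mulrC -ltr_pdivlMr.
    have := ha k.+1 (x * t) hxt.
    have -> : q (x * t) = f (t *: (u1 + x *: u2)).
      by rewrite /q scalerDr scalerA [t * x]mulrC.
    have -> : \sum_(i < k.+1) a i * (x * t) ^+ i = p x.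
      by apply: eq_bigr => i _; rewrite exprMn mulrAC mulrA.
    have -> : 8 * 1 * (4 * nm (x * t) / s1) ^+ k.+1 = B * nm x ^+ k.+1 * nm t ^+ k.+1.
      by rewrite nmM /B -!mulrA -!exprMn; congr (_ * (_ * _ ^+ _)); ring.
    by [].
  have -> : f (t *: (u1 + 'i%C *: u2)) - \sum_j l j * f (t *: (u1 + (j%:R : C) *: u2)) =
    (f (t *: (u1 + 'i%C *: u2)) - p 'i%C) -
    \sum_j l j * (f (t *: (u1 + (j%:R : C) *: u2)) - p j%:R).
    rewrite (eq_bigr (fun j => l j * f (t *: (u1 + (j%:R : C) *: u2)) - l j * p j%:R)
      (F1 := fun j => l j * (f (t *: (u1 + (j%:R : C) *: u2)) - p j%:R))); last first.
      by move=> j _; rewrite mulrBr.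
    by rewrite sumrB -(hl (fun i => a i * t ^+ i)) opprB addrA subrK.
  apply: (le_trans (nmB _ _)); rewrite mulrDl; apply: lerD.
    have := hp 'i%C; rewrite nm_i expr1n mulr1; apply.
    by rewrite ler1n.
  rewrite mulr_suml; apply: (le_trans (nm_sum _ _ _)); apply: ler_sum => j _.
  rewrite nmM -mulrA; apply: ler_wpM2l; first exact: nm_ge0.
  have nj : nm (j%:R : C) = j%:R.
    by apply: complexI; rewrite -nmE normr_nat rmorph_nat.
  have jk : nm (j%:R : C) <= k.+1%:R by rewrite nj ler_nat ltnW // ltn_ord.
  apply: (le_trans (hp _ jk)); apply: ler_wpM2r; first by rewrite exprn_ge0 ?nm_ge0.
  by apply: ler_wpM2l => //; apply: lerXn2r; rewrite ?nnegrE ?nm_ge0.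
have h1 : lo k (fun t => f (t *: (u1 + 'i%C *: u2)) -
    \sum_j l j * f (t *: (u1 + (j%:R : C) *: u2))).
  by apply: lo_bigO; exists t1; [exact: t10|exact: key].
have h2 : lo k (fun t : C => \sum_j l j * f (t *: (u1 + (j%:R : C) *: u2)) : C).
  by apply: (@lo_sum R C 'I_k.+1 _ k (fun j t => l j *: f (t *: (u1 + j%:R *: u2)))) => j; exact: loZ.
by apply: eq_lo (loD h1 h2) => t; rewrite subrK.
Qed.

(* By induction on k, Phi = O(|z|^k): along a curve y(t) = t u + o(t) on which Phi
   is o(t^k), the Lipschitz constant of Phi is O(t^(k-1)), so Phi (t u) = o(t^k),
   and the Schwarz lemma improves the exponent. *)
Lemma vanishing n (Phi : 'rV[C]_n -> 'rV[C]_n) (s : R) (T : 'rV[C]_n -> Prop) :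
  0 < s -> (forall z, nm z < s -> differentiable Phi z) ->
  (forall z, nm z < s -> nm (Phi z) <= 1) ->
  (forall u, T u -> forall k, exists y : C -> 'rV[C]_n,
     lo 1 (fun t => y t - t *: u) /\ lo k (fun t => Phi (y t))) ->
  (forall z, exists u1 u2, (forall t, Phi (t *: z) = Phi (t *: (u1 + 'i%C *: u2))) /\
     forall j : nat, T (u1 + j%:R *: u2)) ->
  forall z, nm z < s / 8 -> Phi z = 0.
Proof.
move=> s0 dP PM hT hz.
have s8 : 0 < s / 8 by rewrite divr_gt0.
pose f i z := Phi z 0 i.
have df i z : nm z < s -> differentiable (f i) z.
  by move=> /dP; exact: differentiable_coordf.
have fM i z : nm z < s -> nm (f i z) <= 1.
  by move=> /PM; apply: le_trans; exact: nm_coord.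
have main k z : nm z < s / 8 -> nm (Phi z) <= 8 * (4 * nm z / s) ^+ k.
  elim: k z => [z hz8|k IH].
    rewrite expr0 mulr1; apply: (le_trans (PM z _)); last by rewrite ler1n.
    by apply: (lt_trans hz8); rewrite ltr_pdivrMr // ltr_pMr // ltr1n.
  have loT i u : T u -> lo k (fun t => f i (t *: u)).
    move=> Tu; have [y [hy1 hy2]] := hT u Tu k.
    suff h : lo k (fun t => f i (y t) - f i (t *: u)).
      have h' : lo k (fun t => f i (y t)).
        apply: (@lo_le _ _ _ _ _ _ 1) hy2; exists 1 => // t _; rewrite mul1r; exact: nm_coord.
      by apply: eq_lo (loB h' h) => t; rewrite subKr.
    pose K := nm u + 1; have K0 : 0 < K by rewrite ltr_wpDl ?nm_ge0.
    pose B := 8 * (4 * K / s) ^+ k.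
    have B0 : 0 <= B by rewrite mulr_ge0 // exprn_ge0 // divr_ge0 ?mulr_ge0 ?ltW.
    have B1 : 0 < B + 1 by rewrite ltr_wpDl.
    (* On the ball of radius |t| about t u the induction hypothesis gives |Phi| <= B |t|^k, hence
       the Lipschitz constant 32 B |t|^k / |t|. The first bound offsets it; 1 / 16 puts y(t) within
       |t| / 8 of t u, where it is valid. *)
    move=> e e0; pose e' := Num.min (e / (32 * (B + 1))) (1 / 16).
    have e'0 : 0 < e' by rewrite lt_min !divr_gt0 // mulr_gt0.
    have [d d0 hd] := hy1 e' e'0.
    have sK : 0 < s / 8 / K by rewrite !divr_gt0.
    exists (Num.min d (s / 8 / K)) => [|t]; first by rewrite lt_min d0.
    rewrite lt_min => /andP [/hd h1 h2]; rewrite expr1 in h1.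
    have [t0|t0] := eqVneq t 0.
      have y0 : y t = t *: u.
        apply/eqP; rewrite -subr_eq0; apply/eqP/nm_eq0/eqP.
        by rewrite eq_le nm_ge0 andbT; apply: (le_trans h1); rewrite t0 nm0 mulr0.
      by rewrite y0 subrr nm0 mulr_ge0 ?exprn_ge0 ?nm_ge0 // ltW.
    have tp := nm_pos t0.
    have ball_s x : nm (x - t *: u) < nm t -> nm x < K * nm t /\ nm x < s / 8.
      move=> hx; have hK : nm x < K * nm t.
        rewrite -[x](subrK (t *: u)); apply: (le_lt_trans (nmD _ _)); rewrite nmZ.
        by rewrite mulrDl mul1r addrC [nm u * _]mulrC; apply: ler_ltD.
      split=> //; apply: (lt_trans hK); rewrite mulrC -ltr_pdivlMr //.
    have bs x : nm (x - t *: u) < nm t -> nm x < s.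
      move=> /ball_s [_ hx]; apply: (lt_trans hx).
      by rewrite ltr_pdivrMr // ltr_pMr // ltr1n.
    have h3 : nm (y t - t *: u) < nm t / 8.
      apply: (le_lt_trans h1); apply: (@le_lt_trans _ _ (1 / 16 * nm t)).
        by rewrite ler_wpM2r ?nm_ge0 // ge_min lexx orbT.
      by rewrite mulrC ltr_pM2l //; lra.
    have := @lipschitz_holomorphic R _ (f i) (t *: u) 0 (nm t) (B * nm t ^+ k) tp _ _ (y t) h3.
    move=> /(_ (fun z hz => df i z (bs z hz))) h4.
    apply: (le_trans (h4 _)).
      move=> x hx; have [hx1 hx2] := ball_s x hx.
      rewrite subr0; apply: (le_trans (nm_coord _ _)); apply: (le_trans (IH x hx2)).
      have -> : B * nm t ^+ k = 8 * (4 * K / s * nm t) ^+ k.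
        by rewrite /B [(4 * K / s * nm t) ^+ k]exprMn mulrA.
      rewrite ler_pM2l //; apply: lerXn2r; rewrite ?nnegrE.
      - by rewrite divr_ge0 ?mulr_ge0 ?nm_ge0 // ltW.
      - by rewrite mulr_ge0 ?divr_ge0 ?mulr_ge0 ?nm_ge0 // ltW.
      - rewrite [leRHS]mulrAC ler_pM2r ?invr_gt0 // -mulrA ler_pM2l //; exact: ltW.
    apply: (@le_trans _ _ (32 * (B * nm t ^+ k) / nm t * (e / (32 * (B + 1)) * nm t))).
      apply: ler_wpM2l.
        have tk : 0 <= nm t ^+ k by rewrite exprn_ge0 ?nm_ge0.
        apply: divr_ge0; last exact: nm_ge0.
        by apply: mulr_ge0 => //; exact: mulr_ge0.
      apply: (le_trans h1); rewrite ler_wpM2r ?nm_ge0 // ge_min lexx //.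
    have -> : 32 * (B * nm t ^+ k) / nm t * (e / (32 * (B + 1)) * nm t) =
      e * nm t ^+ k * (B / (B + 1)) by field; rewrite !gt_eqF.
    rewrite ler_piMr //; first by apply: mulr_ge0; [exact: ltW|rewrite exprn_ge0 ?nm_ge0].
    by rewrite ler_pdivrMr // mul1r lerDl.
  have loz i z : lo k (fun t => f i (t *: z)).
    have [u1 [u2 [e12 hj]]] := hz z.
    have h := @lo_complexify _ (f i) s u1 u2 k s0 (df i) (fM i) (fun j => loT i _ (hj j)).
    by apply: eq_lo h => t; rewrite /f e12.
  move=> z hz8; apply/nm_rV => [|i].
    by rewrite mulr_ge0 // exprn_ge0 // divr_ge0 ?mulr_ge0 ?nm_ge0 // ltW.
  have [->|z0] := eqVneq z 0.
    have := lo0_at0 (loz i 0); rewrite /f scale0r => ->.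
    by rewrite !nm0 mulr_ge0 // exprn_ge0 // mulr0 mul0r.
  have zp := nm_pos z0.
  pose v := (nm z)^-1%:C%C *: z.
  have v1 : nm v = 1 by rewrite nmZ nmR normfV gtr0_norm // mulVf // gt_eqF.
  pose g (t : C) := f i (t *: v).
  have dg t : nm t < s -> differentiable g t.
    move=> ht; rewrite /g; apply: (@differentiable_comp _ _ _ _ (fun t : C => t *: v) (f i)).
      exact: differentiableZl.
    by apply: df; rewrite nmZ v1 mulr1.
  have gM t : nm t < s -> nm (g t) <= 1 by move=> ht; apply: fM; rewrite nmZ v1 mulr1.
  pose t : C := (nm z)%:C%C.
  have tn : nm t = nm z by rewrite nmR gtr0_norm.
  have ht : nm t < s / 8 by rewrite tn.
  have := schwarz s0 dg gM (loz i v) ht.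
  rewrite tn mulr1 /g /t /v scalerA -rmorphM /= mulfV ?gt_eqF // scale1r.
  by [].
move=> z hz8; apply: nm_eq0; apply/eqP; rewrite eq_le nm_ge0 andbT.
apply/ler_addgt0Pl => e e0; rewrite addr0.
have [k hk] := half_pow 8 e0.
apply: (le_trans (main k z hz8)); apply: le_trans (ltW hk); rewrite ler_pM2l //.
(* For |z| < s / 8 the ratio 4 |z| / s is below 1 / 2. *)
rewrite -exprVn; apply: lerXn2r; rewrite ?nnegrE ?invr_ge0 //.
  by rewrite divr_ge0 ?mulr_ge0 ?nm_ge0 // ltW.
rewrite ler_pdivrMr //; move: hz8; rewrite ltr_pdivlMr //; move: (nm z) => a; lra.
Qed.
End Vanishing.

(** * Straightening the zero set *)

Section ZeroSet.
Context {R : realType}.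
Local Notation C := (cplx R).

Lemma mulmx_linear m n (A : 'M[C]_(m, n)) : linear (fun u : 'rV[C]_m => u *m A).
Proof. by move=> a u v; rewrite mulmxDl scalemxAl. Qed.

Lemma differentiable_mulmx (V : normedModType C) m n (A : 'M[C]_(m, n))
  (f : V -> 'rV[C]_m) z : differentiable f z -> differentiable (fun z => f z *m A) z.
Proof.
move=> h; apply: (@differentiable_comp _ _ _ _ f (fun u => u *m A)) => //.
have [K K0 hK] := nm_mulmx A.
suff [] : differentiable (fun u : 'rV[C]_m => u *m A) (f z) /\
  'd (fun u : 'rV[C]_m => u *m A) (f z) = mklin (mulmx_linear A) :> ('rV[C]_m -> 'rV[C]_n) by [].
apply: (@eps_differentiable R _ _ _ _ (mklin (mulmx_linear A)) K hK) => e e0.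
exists 1 => // k _; rewrite /mklin /= mulmxDl [_ + k *m A]addrC addrK subrr nm0.
by rewrite mulr_ge0 ?nm_ge0 // ltW.
Qed.

Lemma differentiable_idm (V : normedModType C) (z : V) : differentiable (id : V -> V) z.
Proof. exact: ex_diff. Qed.

Lemma sdiff_lipschitz (V W : normedModType C) (f : V -> W) (a : V) :
  differentiable f a -> sdiff f a ('d f a) ->
  exists2 K : R, 0 < K & exists2 d : R, 0 < d & forall x y, nm (x - a) < d -> nm (y - a) < d ->
  nm (f x - f y) <= K * nm (x - y).
Proof.
move=> dfa hs; have [K K0 hK] := linear_nm_bounded (diff_continuous dfa).
have [d d0 hd] := hs 1 ltr01.
exists (1 + K); first by rewrite addr_gt0.
exists d => // x y hx hy; rewrite -(subrK ('d f a (x - y)) (f x - f y)).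
by apply: (le_trans (nmD _ _)); rewrite mulrDl; apply: lerD; [exact: hd|exact: hK].
Qed.

Lemma nm_copid n k (z : 'rV[C]_n) : nm (z *m copid_mx k) <= nm z.
Proof.
apply/nm_rV => [|i]; first exact: nm_ge0.
have -> : (z *m copid_mx k) 0 i = if (k <= i)%N then z 0 i else 0.
  rewrite /copid_mx mulmxBr mulmx1 !mxE (bigD1 i) //= big1 => [|j ji].
    rewrite !mxE eqxx /= addr0 ltnNge; case: (k <= i)%N => /=.
      by rewrite mulr0 subr0.
    by rewrite mulr1 subrr.
  by rewrite !mxE (_ : (j == i :> nat) = false) ?mulr0 //; exact: negbTE.
by case: ifP => _; [exact: nm_coord|rewrite nm0 nm_ge0].
Qed.

Lemma mulmx_pid_eq0 n k (z : 'rV[C]_n) :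
  (z *m (pid_mx k : 'M[C]_n) = 0) <-> forall i : 'I_n, (i < k)%N -> z 0 i = 0.
Proof.
have hE i : (z *m (pid_mx k : 'M[C]_n)) 0 i = if (i < k)%N then z 0 i else 0.
  rewrite !mxE (bigD1 i) //= big1 => [|j ji].
    by rewrite !mxE eqxx /= addr0; case: (i < k)%N; rewrite ?mulr1 ?mulr0.
  by rewrite !mxE (_ : (j == i :> nat) = false) ?mulr0 //; exact: negbTE.
split.
  by move=> h i ik; have := hE i; rewrite h mxE ik.
by move=> h; apply/rowP => i; rewrite hE mxE; case: ifP => // /h.
Qed.

Lemma nm_perm n (s : 'S_n) (z : 'rV[C]_n) : nm (col_perm s z) = nm z.
Proof.
have h (t : 'S_n) (y : 'rV[C]_n) : nm (col_perm t y) <= nm y.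
  by apply/nm_rV => [|i]; [exact: nm_ge0|rewrite mxE; exact: nm_coord].
apply/eqP; rewrite eq_le h /=.
have {1}-> : z = col_perm s^-1%g (col_perm s z) by apply/rowP => i; rewrite !mxE permKV.
exact: h.
Qed.

Lemma open_nm (V : normedModType C) (A : set V) :
  (forall x, A x -> exists2 d : R, 0 < d & forall y, nm (y - x) < d -> A y) -> open A.
Proof. by move=> h; rewrite openE => x /h hx; apply/nbhs_nm. Qed.

Lemma differentiable_near (V W : normedModType C) (f : V -> W) x : differentiable f x ->
  forall e : R, 0 < e -> exists2 d : R, 0 < d & forall y, nm (y - x) < d -> nm (f y - f x) < e.
Proof.
move=> /differentiable_continuous hf e e0.
have /hf /nbhs_nm [d d0 hd] : nbhs (f x) [set z | nm (z - f x) < e].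
  by apply/nbhs_nm; exists e.
by exists d.
Qed.

Lemma flat_rev n k (y : 'rV[C]_n) : (k <= n)%N ->
  flat (n - k) (col_perm (perm (@rev_ord_inj n)) y) <-> forall i : 'I_n, (i < k)%N -> y 0 i = 0.
Proof.
move=> kn; split=> h i hi.
  have := h (rev_ord i); rewrite mxE permE rev_ordK; apply => /=.
  by rewrite leq_sub2l.
rewrite mxE permE; apply: h => /=; have := ltn_ord i.
by move: hi kn; move: (nat_of_ord i) => j; clear; lia.
Qed.

(** With L = CE pid RE of rank k, the first k coordinates of F RE^-1 have independent derivatives
    and cut out a submanifold. The curves show that the other coordinates vanish on it. [T] may be
    as small as a set of real directions whose complex combinations fill the kernel. *)
Lemma zero_set_submanifold n (F : 'rV[C]_n -> 'rV[C]_n) (c : 'rV[C]_n) (rho : R)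
    (L : 'M[C]_n) (T : 'rV[C]_n -> Prop) :
  0 < rho -> (forall z, nm (z - c) < rho -> differentiable F z) ->
  (forall u, 'd F c u = u *m L) ->
  (forall u, T u -> u *m L = 0 /\ forall k, exists y : C -> 'rV[C]_n,
     lo 1 (fun t => y t - c - t *: u) /\ lo k (fun t => F (y t))) ->
  (forall u, u *m L = 0 -> exists u1 u2, u = u1 + 'i%C *: u2 /\
     forall j : nat, T (u1 + j%:R *: u2)) ->
  exists V : set 'rV[C]_n, [/\ open V, V c, forall w, V w -> nm (w - c) < rho &
    submanifold V (n - \rank L) [set w | V w /\ F w = 0]].
Proof.
move=> rho0 dF dFc hT hK.
pose k := \rank L; pose CE := col_ebase L; pose RE := row_ebase L.
have kn : (k <= n)%N by exact: rank_leq_row.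
have LE : CE *m pid_mx k *m RE = L by exact: mulmx_ebase.
have uCE : CE \in unitmx by exact: col_ebase_unit.
have uRE : RE \in unitmx by exact: row_ebase_unit.
pose pid : 'M[C]_n := pid_mx k; pose copid : 'M[C]_n := copid_mx k.
have pp : pid *m pid = pid by rewrite /pid pid_mx_id.
have cp : copid *m pid = 0 by exact: mul_copid_mx_pid.
have pc : pid *m copid = 0 by exact: mul_pid_mx_copid.
have cc : copid *m copid = copid by exact: copid_mx_id.
have pDc : copid + pid = 1%:M by rewrite /copid /copid_mx subrK.
clearbody CE RE.
(* Each curve in the hypothesis passes through [c] at t = 0, where a [lo] function vanishes. *)
have Fc : F c = 0.
  have [u1 [u2 [_ /(_ 0) /hT [_ /(_ 0) [y [h1 h2]]]]]] := hK 0 (mul0mx _ _).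
  have := lo0_at0 h1; rewrite scale0r subr0 => /eqP; rewrite subr_eq0 => /eqP <-.
  exact: lo0_at0 h2.
(* Coordinates with the first k entries of F RE^-1 in front and n - k linear functions behind; by
   the choice of the factors their derivative at [c] is CE. *)
pose phi w := (w - c) *m (CE *m copid) + F w *m (invmx RE *m pid).
have phic : phi c = 0 by rewrite /phi Fc subrr !mul0mx addr0.
have dphi z : nm (z - c) < rho -> differentiable phi z.
  move=> hz; apply: differentiableD; apply: differentiable_mulmx; last exact: dF.
  by apply: differentiableB => //; exact: differentiable_cst.
have LQ u : u *m (CE *m copid) + u *m L *m (invmx RE *m pid) = u *m CE.
  rewrite -LE !mulmxA mulmxK // -!mulmxA pp -mulmxDr -mulmxDr pDc mulmx1.
  by [].
have dFc' : differentiable F c by apply: dF; rewrite subrr nm0.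
have dphiN u : 'd phi c u = u *m CE.
  have [K1 K10 hK1] := nm_mulmx CE; have [K2 K20 hK2] := nm_mulmx (invmx RE *m pid).
  suff [_ ->] : differentiable phi c /\
    'd phi c = mklin (mulmx_linear CE) :> ('rV[C]_n -> 'rV[C]_n) by [].
  apply: (@eps_differentiable R _ _ _ _ (mklin (mulmx_linear CE)) K1 hK1) => e e0.
  have [d d0 hd] := differentiable_eps dFc' (divr_gt0 e0 K20).
  exists d => // h /hd hh; rewrite /mklin /= phic subr0 -LQ /phi [c + h]addrC addrK.
  have -> : h *m (CE *m copid) + F (h + c) *m (invmx RE *m pid) -
    (h *m (CE *m copid) + h *m L *m (invmx RE *m pid)) =
    (F (c + h) - F c - 'd F c h) *m (invmx RE *m pid).
    by rewrite Fc subr0 dFc [c + h]addrC [_ + F _ *m _]addrC addrKA mulmxBl.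
  apply: (le_trans (hK2 _)); rewrite mulrC.
  by rewrite -ler_pdivlMr // mulrAC.
have [r [s [K [psi [/andP [r0 rrho] s0 K0 [p1 p2 p3 p4]]]]]] :=
  inverse_function rho0 dphi uCE dphiN.
rewrite phic in p1 p2 p3 p4.
have {}p1 y : nm y < s -> nm (psi y - c) < r /\ phi (psi y) = y.
  by have := p1 y; rewrite subr0.
have {}p2 x : nm (x - c) < r -> nm (phi x) < s -> psi (phi x) = x.
  by have := p2 x; rewrite subr0.
have {}p4 y : nm y < s -> differentiable psi y by have := p4 y; rewrite subr0.
have psi0 : psi 0 = c by rewrite -phic p2 ?phic ?subrr ?nm0.
have phipid w : phi w *m pid = F w *m invmx RE *m pid.
  have e1 : (w - c) *m (CE *m copid) *m pid = 0 by rewrite -!mulmxA cp !mulmx0.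
  have e2 : F w *m (invmx RE *m pid) *m pid = F w *m invmx RE *m pid.
    by rewrite -!mulmxA pp.
  by rewrite /phi [LHS]mulmxDl e2 [X in X + _]e1 add0r.
pose S y := F (psi y) *m invmx RE.
have dS y : nm y < s -> differentiable S y.
  move=> hy; apply: differentiable_mulmx.
  apply: (@differentiable_comp _ _ _ _ psi F); first exact: p4.
  by apply: dF; apply: lt_le_trans rrho; have [] := p1 y hy.
have S0 : S 0 = 0 by rewrite /S psi0 Fc mul0mx.
have [d1 d10 hd1] : exists2 d : R, 0 < d & forall y, nm (y - 0) < d -> nm (S y - S 0) < 1.
  by apply: differentiable_near; [apply: dS; rewrite nm0|exact: ltr01].
pose s1 := Num.min s d1; have s10 : 0 < s1 by rewrite lt_min s0.
have s1s : s1 <= s by rewrite ge_min lexx.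
(* F in the new coordinates, restricted to the slice where the first k coordinates vanish and
   extended constantly along them. *)
pose Phi z := S (z *m copid).
have copid_lt (z : 'rV[C]_n) e : nm z < e -> nm (z *m copid) < e.
  by move=> h; apply: le_lt_trans h; exact: nm_copid.
have dPhi z : nm z < s1 -> differentiable Phi z.
  move=> hz; apply: (@differentiable_comp _ _ _ _ (fun z => z *m copid) S).
    exact: (@differentiable_mulmx _ n n copid id z (differentiable_idm z)).
  by apply: dS; apply: lt_le_trans s1s; exact: copid_lt.
have PhiM z : nm z < s1 -> nm (Phi z) <= 1.
  move=> /copid_lt; rewrite lt_min => /andP [_ hz].
  by have := hd1 (z *m copid); rewrite S0 !subr0 => /(_ hz) /ltW.
have vanish z : nm z < s1 / 8 -> Phi z = 0.
  apply: (@vanishing R n Phi s1 (fun v => exists2 u, T u & v = u *m CE)) => //.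
    move=> v [u Tu ->] m; have [uL /(_ m) [y [h1 h2]]] := hT u Tu.
    exists (fun t => phi (y t)).
    have small e : 0 < e -> exists2 d : R, 0 < d & forall t, nm t < d -> nm (y t - c) < e.
      move=> e0; have e2 : 0 < e / 2 by rewrite divr_gt0.
      have [d d0 hd] := lo_small h1 e2.
      have h3 : lo 0 (fun t : C => t *: u).
        by have := @lo_monom R 'rV[C]_n 0 1 u isT; apply: eq_lo => t; rewrite expr1.
      have [d' d'0 hd'] := lo_small h3 e2.
      exists (Num.min d d') => [|t]; first by rewrite lt_min d0.
      rewrite lt_min => /andP [/hd a1 /hd' a2].
      rewrite -[y t - c](subrK (t *: u)) [e]splitr.
      by apply: (le_lt_trans (nmD _ _)); apply: ltrD.
    split.
      have [K1 K10 hK1] := nm_mulmx CE.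
      have a1 : lo 1 (fun t => (y t - c - t *: u) *m CE).
        by apply: (@lo_le _ _ _ _ _ _ K1) h1; exists 1.
      have a2 : lo 1 (fun t => phi (y t) - (y t - c) *m CE).
        move=> e e0; pose U := nm u + 1; have U0 : 0 < U by rewrite ltr_wpDl ?nm_ge0.
        have dpc : differentiable phi c by apply: dphi; rewrite subrr nm0.
        have [d d0 hd] := differentiable_eps dpc (divr_gt0 e0 U0).
        have [d' d'0 hd'] := small _ d0; have [b b0 hb] := h1 1 ltr01.
        exists (Num.min b d') => [|t]; first by rewrite lt_min b0.
        rewrite lt_min => /andP [/hb b1 /hd' /hd].
        rewrite dphiN phic subr0 [c + (y t - c)]addrC subrK => b2.
        apply: (le_trans b2); rewrite expr1 mulrAC ler_pdivrMr // -mulrA ler_pM2l //.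
        rewrite -[y t - c](subrK (t *: u)); apply: (le_trans (nmD _ _)).
        by rewrite nmZ /U mulrDr mulr1 addrC lerD2l; move: b1; rewrite expr1 mul1r.
      apply: eq_lo (loD a2 a1) => t.
      by rewrite [(_ - t *: u) *m CE]mulmxBl addrA subrK scalemxAl.
    have dS0 : differentiable S 0 by apply: dS; rewrite nm0.
    have sd := @sdiff_row R _ _ S 0 s s0 (fun z hz => dS z (eq_ind _ (fun x => nm x < s) hz _ (subr0 z))).
    have [K1 K10 [d d0 hd]] := sdiff_lipschitz dS0 sd.
    have [b b0 hb] := small r r0.
    have dpc : differentiable phi c by apply: dphi; rewrite subrr nm0.
    have m0 : 0 < Num.min s d by rewrite lt_min s0.
    have [a a0 ha] := differentiable_near dpc m0.
    have [a' a'0 ha'] := small a a0.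
    have [KR KR0 hKR] := nm_mulmx (invmx RE).
    have [KP KP0 hKP] := nm_mulmx pid.
    apply: (@lo_le _ _ _ _ _ _ (KR + K1 * (KP * KR))) h2.
    exists (Num.min b a') => [|t]; first by rewrite lt_min b0.
    rewrite lt_min => /andP [/hb hr /ha' /ha]; rewrite phic subr0 lt_min => /andP [hs hd'].
    have Sphi : S (phi (y t)) = F (y t) *m invmx RE by rewrite /S p2.
    (* The curve lies in the slice only approximately. Its first k coordinates are entries of F(y t)
       RE^-1, so projecting it to the slice changes S by no more than a multiple of |F(y t)|. *)
    have -> : Phi (phi (y t)) = S (phi (y t)) - (S (phi (y t)) - S (phi (y t) *m copid)).
      by rewrite subKr.
    apply: (le_trans (nmB _ _)); rewrite mulrDl; apply: lerD.
      by rewrite Sphi; exact: hKR.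
    apply: (le_trans (hd _ _ _ _)); rewrite ?subr0 //; first exact: copid_lt.
    rewrite -mulrA ler_pM2l //.
    have -> : phi (y t) - phi (y t) *m copid = F (y t) *m invmx RE *m pid.
      by rewrite -phipid -{1}[phi (y t)]mulmx1 -mulmxBr -pDc [copid + pid]addrC addrK.
    by apply: (le_trans (hKP _)); rewrite -mulrA ler_pM2l //; exact: hKR.
  (* [Phi] sees only [w *m copid], which corresponds to a vector of the kernel of L. *)
  move=> w; pose u := w *m copid *m invmx CE.
  have uL : u *m L = 0.
    by rewrite /u -LE !mulmxA mulmxKV // -[w *m copid *m _]mulmxA cp mulmx0 mul0mx.
  have [u1 [u2 [eu hj]]] := hK u uL.
  exists (u1 *m CE), (u2 *m CE); split=> [t|j].
    have -> : u1 *m CE + 'i%C *: (u2 *m CE) = w *m copid.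
      by rewrite scalemxAl -mulmxDl -eu /u mulmxKV.
    by rewrite /Phi -!scalemxAl -[w *m copid *m copid]mulmxA cc.
  by exists (u1 + j%:R *: u2); [exact: hj|rewrite scalemxAl mulmxDl].
pose s2 := s1 / 8; have s20 : 0 < s2 by rewrite divr_gt0.
have s2s1 : s2 < s1 by rewrite ltr_pdivrMr // ltr_pMr // ltr1n.
have s2s : s2 <= s by apply: (le_trans (ltW s2s1)).
have zeroP y : nm y < s2 -> (F (psi y) = 0 <-> y *m pid = 0).
  move=> hy; have hs : nm y < s by apply: lt_le_trans hy s2s.
  split=> h.
    by rewrite -[y](p1 y hs).2 phipid h !mul0mx.
  have : Phi y = 0 by exact: vanish.
  have ey : y *m copid = y by rewrite -[RHS]mulmx1 -pDc [RHS]mulmxDr h addr0.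
  rewrite /Phi ey.
  by move/(congr1 (mulmx^~ RE)); rewrite /S mulmxKV // mul0mx.
pose V := [set w | nm (w - c) < r /\ nm (phi w) < s2].
have openV : open V.
  apply: open_nm => w [h1 h2].
  have dw : differentiable phi w by apply: dphi; apply: lt_le_trans rrho.
  have e0 : 0 < s2 - nm (phi w) by rewrite subr_gt0.
  have [d d0 hd] := differentiable_near dw e0.
  exists (Num.min d (r - nm (w - c))) => [|y]; first by rewrite lt_min d0 subr_gt0.
  rewrite lt_min => /andP [/hd a1 a2]; split.
    have -> : y - c = (y - w) + (w - c) by rewrite addrA subrK.
    by apply: (le_lt_trans (nmD _ _)); rewrite -ltrBrDr.
  by rewrite -[phi y](subrK (phi w)); apply: (le_lt_trans (nmD _ _)); rewrite -ltrBrDr.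
exists V; split=> //.
- by split; rewrite ?phic ?subrr nm0.
- by move=> w [h _]; apply: lt_le_trans rrho.
(* [flat] requires the last coordinates to vanish, [pid] selects the first ones; hence the
   reversal. *)
pose rev : 'S_n := perm (@rev_ord_inj n).
pose rv (y : 'rV[C]_n) := col_perm rev y.
have revE i : rev i = rev_ord i by rewrite permE.
have rvK y : rv (rv y) = y by apply/rowP => i; rewrite !mxE !revE rev_ordK.
have nmrv y : nm (rv y) = nm y by exact: nm_perm.
have drv (W : normedModType C) (f : W -> 'rV[C]_n) z : differentiable f z -> differentiable (fun z => rv (f z)) z.
  move=> h; have -> : (fun z => rv (f z)) = (fun z => f z *m perm_mx rev^-1%g).
    by apply/funext => x; rewrite /rv col_permE.
  exact: differentiable_mulmx.
have imV : (rv \o phi) @` V = [set y | nm y < s2].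
  apply/seteqP; split=> y.
    by move=> [w [h1 h2] <-] /=; rewrite nmrv.
  move=> hy; have hs : nm (rv y) < s by rewrite nmrv; apply: lt_le_trans s2s.
  have [a1 a2] := p1 _ hs; exists (psi (rv y)); last by rewrite /= a2 rvK.
  by split=> //; rewrite a2 nmrv.
split; first by move=> w [].
  by rewrite leq_subr.
move=> a [Va _]; exists V, (rv \o phi), (fun y => psi (rv y)).
split; [split; [exact: openV|exact: Va|by []|]|split].
- rewrite imV; apply: open_nm => x hx.
  exists (s2 - nm x) => [|y hy]; first by rewrite subr_gt0.
  by rewrite /= -[y](subrK x); apply: (le_lt_trans (nmD _ _)); rewrite -ltrBrDr.
- by move=> w [h _]; apply: drv; apply: dphi; apply: lt_le_trans rrho.
- move=> y; rewrite imV => hy; apply: (@differentiable_comp _ _ _ _ rv psi).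
    exact: (drv _ id _ (differentiable_idm _)).
  by apply: p4; rewrite nmrv; apply: lt_le_trans s2s.
- by move=> w [h1 h2] /=; rewrite rvK p2 //; apply: lt_le_trans s2s.
have flatP y : flat (n - k) (rv y) <-> y *m pid = 0.
  by rewrite mulmx_pid_eq0; exact: flat_rev.
apply/seteqP; split=> y.
  move=> [w [[[h1 h2] Fw] _] <-]; split.
    by apply: imageP; split; [exact: h1|exact: h2].
  have hs : nm (phi w) < s by apply: lt_le_trans h2 s2s.
  by apply/flatP; rewrite -(zeroP _ h2) (p2 _ h1 hs).
move=> [[w [h1 h2] <-] hf]; have hs : nm (phi w) < s by apply: lt_le_trans h2 s2s.
exists w; last reflexivity; split; last by split; [exact: h1|exact: h2].
split; first by split; [exact: h1|exact: h2].
by move: hf => /flatP; rewrite -(zeroP _ h2) (p2 _ h1 hs).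
Qed.
End ZeroSet.

(** * Expansions along curves *)

Section Expansions.
Context {R : realType}.
Local Notation C := (cplx R).

Lemma lo_row n (k : nat) (f : C -> 'rV[C]_n) : (forall i, lo k (fun t => f t 0 i)) -> lo k f.
Proof.
move=> hf e e0.
have H i : exists d : R, 0 < d /\ forall t, nm t < d -> nm (f t 0 i) <= e * nm t ^+ k.
  by have [d d0 hd] := hf i e e0; exists d.
have [d hd] := choice H.
pose D := \big[Num.min/1]_i d i.
exists D => [|t ht].
  by rewrite /D; elim/big_ind : _ => // [x y hx hy|i _]; [rewrite lt_min hx|have [] := hd i].
apply/nm_rV => [|i]; first by rewrite mulr_ge0 ?exprn_ge0 ?nm_ge0 // ltW.
have [_ h] := hd i; apply: h; apply: (lt_le_trans ht).
by rewrite /D; apply: bigmin_le_cond.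
Qed.

Lemma lo_coord n (k : nat) (f : C -> 'rV[C]_n) i : lo k f -> lo k (fun t => f t 0 i).
Proof. by apply: (@lo_le _ _ _ _ _ _ 1); exists 1 => // t _; rewrite mul1r nm_coord. Qed.

Lemma lo_pair (V W : normedModType C) (k : nat) (f : C -> V) (g : C -> W) :
  lo k f -> lo k g -> lo k (fun t => (f t, g t)).
Proof.
move=> hf hg e e0; have [d d0 hd] := hf e e0; have [d' d'0 hd'] := hg e e0.
exists (Num.min d d') => [|t]; first by rewrite lt_min d0.
by rewrite lt_min nm_pair => /andP [/hd -> /hd' ->].
Qed.

Lemma lo_scale (V : normedModType C) (k : nat) (f : C -> V) (a : C) :
  lo k f -> lo k (fun t => f (a * t)).
Proof.
move=> hf e e0; have a1 : 0 < nm a + 1 by rewrite ltr_wpDl ?nm_ge0.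
have ak : 0 < (nm a + 1) ^+ k by rewrite exprn_gt0.
have [d d0 hd] := hf (e / (nm a + 1) ^+ k) (divr_gt0 e0 ak).
exists (d / (nm a + 1)) => [|t]; first by rewrite divr_gt0.
rewrite ltr_pdivlMr // => ht.
have hat : nm (a * t) <= nm t * (nm a + 1).
  by rewrite nmM mulrDr mulr1 mulrC lerDl nm_ge0.
apply: (le_trans (hd _ (le_lt_trans hat ht))).
rewrite -mulrA ler_pM2l // mulrC ler_pdivrMr // -exprMn.
by apply: lerXn2r; rewrite ?nnegrE ?mulr_ge0 ?nm_ge0 // ltW.
Qed.

Lemma lo_pow_bound (V : normedModType C) (k : nat) (f : C -> V) (v : V) :
  lo k (fun t => f t - t ^+ k *: v) ->
  exists2 d : R, 0 < d & forall t, nm t < d -> nm (f t) <= (nm v + 1) * nm t ^+ k.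
Proof.
move=> hf; have [d d0 hd] := hf 1 ltr01; exists d => // t /hd h.
rewrite -(subrK (t ^+ k *: v) (f t)); apply: (le_trans (nmD _ _)).
by rewrite nmZ nmX mulrDl addrC [nm v * _]mulrC; apply: lerD.
Qed.

(** Both curves merely tend to [a], while their difference is known to order k; strict
    differentiability transfers this order to the images. *)
Lemma sdiff_lo (V W : normedModType C) (f : V -> W) (a : V) (L : {linear V -> W})
    (x y : C -> V) (v : V) (k : nat) :
  continuous L -> sdiff f a L ->
  lo 0 (fun t => x t - a) -> lo 0 (fun t => y t - a) ->
  lo k (fun t => x t - y t - t ^+ k *: v) ->
  lo k (fun t => f (x t) - f (y t) - t ^+ k *: L v).
Proof.
move=> Lc hs hx hy hxy.
have [K K0 hK] := linear_nm_bounded Lc.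
have h1 : lo k (fun t => L (x t - y t - t ^+ k *: v)).
  by apply: (@lo_le _ _ _ _ _ _ K) hxy; exists 1.
have [b b0 hb] := lo_pow_bound hxy.
suff h2 : lo k (fun t => f (x t) - f (y t) - L (x t - y t)).
  apply: eq_lo (loD h2 h1) => t.
  by rewrite [L (_ - _ *: v)]linearB linearZ addrA subrK.
move=> e e0; have v1 : 0 < nm v + 1 by rewrite ltr_wpDl ?nm_ge0.
have [d d0 hd] := hs _ (divr_gt0 e0 v1).
have [dx dx0 hdx] := lo_small hx d0; have [dy dy0 hdy] := lo_small hy d0.
exists (Num.min b (Num.min dx dy)) => [|t]; first by rewrite !lt_min b0 dx0.
rewrite !lt_min => /andP [/hb h3 /andP [/hdx h4 /hdy h5]].
apply: (le_trans (hd _ _ h4 h5)).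
by rewrite mulrAC ler_pdivrMr // -mulrA ler_pM2l // mulrC.
Qed.

Lemma lo_linear_eq0 (V : normedModType C) (v : V) : lo 1 (fun t : C => t *: v) -> v = 0.
Proof.
move=> hv; apply: nm_eq0; apply/eqP; rewrite eq_le nm_ge0 andbT.
apply/ler_addgt0Pl => e e0; rewrite addr0; have [d d0 hd] := hv e e0.
pose t : C := (d / 2)%:C%C; have tn : nm t = d / 2 by rewrite nmR gtr0_norm // divr_gt0.
have htd : nm t < d by rewrite tn ltr_pdivrMr // ltr_pMr // ltr1n.
by have := hd t htd; rewrite nmZ expr1 [nm t * _]mulrC ler_pM2r // tn divr_gt0.
Qed.

Lemma real_ImP (z : C) : z \is Num.real <-> complex.Im z = 0.
Proof. by case: z => a b; rewrite complex_real /=; split=> [/eqP|->]. Qed.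

(** At real t the imaginary part of the error is -t^k Im b. *)
Lemma real_coef (k : nat) (f : C -> C) (b : C) :
  lo k (fun t => f t - t ^+ k * b) ->
  (exists2 d : R, 0 < d & forall t : C, nm t < d -> t \is Num.real -> f t \is Num.real) ->
  b \is Num.real.
Proof.
move=> hf [d d0 hd]; apply/real_ImP; apply/eqP; rewrite -normr_le0.
apply/ler_addgt0Pl => e e0; rewrite addr0; have [d' d'0 hd'] := hf e e0.
pose m := Num.min d d'; have m0 : 0 < m by rewrite lt_min d0.
pose s := m / 2; have s0 : 0 < s by rewrite divr_gt0.
pose t : C := s%:C%C; have tn : nm t = s by rewrite nmR gtr0_norm.
have : nm t < m by rewrite tn ltr_pdivrMr // ltr_pMr // ltr1n.
rewrite lt_min => /andP [/hd h1 /hd' h2].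
have tr : t \is Num.real by apply/complex_realP; exists s.
have /real_ImP f0 := h1 tr.
have := le_trans (nm_Im _) h2.
rewrite cImD cImN f0 sub0r normrN.
have -> : t ^+ k = (s ^+ k)%:C%C by rewrite rmorphXn.
rewrite cImM /= mul0r addr0 normrM tn gtr0_norm ?exprn_gt0 // mulrC ler_pM2r //.
by rewrite exprn_gt0.
Qed.

Lemma differentiable_row (V : normedModType C) n (f : V -> 'rV[C]_n) z :
  (forall i, differentiable (fun z => f z 0 i) z) -> differentiable f z.
Proof.
move=> hf; have -> : f = \sum_i (fun z => f z 0 i *: (delta_mx 0 i : 'rV[C]_n)).
  by apply/funext => x; rewrite fct_sumE [LHS]row_sum_delta.
by apply: differentiable_sum => i; exact: differentiableZl.
Qed.

Lemma uniform_radius (I : eqType) (T : Type) (f : T -> R) (s : seq I) (Q : I -> T -> Prop) :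
  (forall i, i \in s -> exists2 d : R, 0 < d & forall t, f t < d -> Q i t) ->
  exists2 d : R, 0 < d & forall i t, i \in s -> f t < d -> Q i t.
Proof.
elim: s => [|i s IH] h; first by exists 1.
have [|d d0 hd] := IH; first by move=> j js; apply: h; rewrite inE js orbT.
have [d' d'0 hd'] := h i (mem_head _ _).
exists (Num.min d d') => [|j t]; first by rewrite lt_min d0.
by rewrite inE lt_min => /orP [/eqP ->|js] /andP [h1 h2]; [exact: hd'|exact: hd].
Qed.

(** The quantitative injectivity of s |-> f (w, s), uniform in w: it identifies a lift from an
    approximate solution of the equation defining it. *)
Lemma sdiff_local_inj (V : normedModType C) (f : V * C -> C) (a : V) (x : C)
    (L : {linear (V * C)%type -> C}) (c : C) : c != 0 -> (forall s, L (0, s) = c * s) ->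
  sdiff f (a, x) L ->
  exists2 K : R, 0 < K & exists2 d : R, 0 < d & forall w s s',
    nm (w - a) < d -> nm (s - x) < d -> nm (s' - x) < d ->
    nm (s - s') <= K * nm (f (w, s) - f (w, s')).
Proof.
move=> c0 hL hs; have cp := nm_pos c0.
have c2 : 0 < nm c / 2 by rewrite divr_gt0.
have [d d0 hd] := hs _ c2.
exists (2 / nm c); first by rewrite divr_gt0.
exists d => // w s s' hw h1 h2.
have pE (u : C) : nm ((0 : V), u) = nm u.
  apply/eqP; rewrite eq_le nm_pair nm0 nm_ge0 lexx /=.
  by have := lexx (nm ((0 : V), u)); rewrite nm_pair => /andP [].
have hp (u : C) : nm (u - x) < d -> nm ((w, u) - (a, x)) < d.
  by move=> hu; rewrite -[(w, u) - (a, x)]/(w - a, u - x) nm_pair_lt hw.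
have := hd _ _ (hp _ h1) (hp _ h2).
rewrite -[(w, s) - (w, s')]/(w - w, s - s') subrr hL pE.
move=> h3; have h4 := nmB (f (w, s) - f (w, s')) (f (w, s) - f (w, s') - c * (s - s')).
rewrite subKr nmM in h4.
rewrite mulrAC ler_pdivlMr // mulrC.
rewrite mulrAC in h3.
by move: (nm c * _) (nm (f _ - f _)) (nm (_ - _)) h3 h4 => *; lra.
Qed.
End Expansions.

(** * Lifts and the transfer operator *)

Section Deformation.
Context {R : realType}.
Local Notation C := (cplx R).

Lemma lo_diff (V V' : normedModType C) (f : V -> V') (a v : V) : differentiable f a ->
  lo 1 (fun t : C => f (a + t *: v) - f a - t *: 'd f a v).
Proof.
move=> df e e0; have v1 : 0 < nm v + 1 by rewrite ltr_wpDl ?nm_ge0.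
have [d d0 hd] := differentiable_eps df (divr_gt0 e0 v1).
exists (d / (nm v + 1)) => [|t]; first by rewrite divr_gt0.
rewrite ltr_pdivlMr // => ht.
have htv : nm (t *: v) <= nm t * (nm v + 1) by rewrite nmZ mulrDr mulr1 lerDl nm_ge0.
rewrite -linearZ; apply: (le_trans (hd _ (le_lt_trans htv ht))).
by rewrite mulrAC ler_pdivrMr // expr1 -mulrA ler_pM2l.
Qed.

Lemma lo1_unique (V V' : normedModType C) (f : C -> V') (v w : V') :
  lo 1 (fun t : C => f t - t *: v) -> lo 1 (fun t : C => f t - t *: w) -> v = w.
Proof.
move=> h1 h2; apply/eqP; rewrite -subr_eq0; apply/eqP/lo_linear_eq0.
by apply: eq_lo (loB h2 h1) => t; rewrite opprB addrC addrA subrK scalerBr.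
Qed.

Variables (nu : nat) (c0 : 'rV[C]_nu) (U : set C) (g : C -> C) (P : {fset C}).
Variables (W : set 'rV[C]_nu) (p : 'rV[C]_nu -> 'rV[C]_nu) (G : 'rV[C]_nu -> C -> C).
Hypotheses (hg : marked_map c0 U g P) (hG : local_deformation c0 U g W p G).

Let c1 := crit c0 g 1.
Let pts := gP g P.

Definition pcoord (j : 'I_nu) (w : 'rV[C]_nu) : C := p w 0 j.
Definition Gpair (wz : 'rV[C]_nu * C) : C := G wz.1 wz.2.
(** The velocity of [motion_c1] along a motion with velocity [v]. *)
Definition ev (v : {ffun pts -> C^o}) : 'rV[C]_nu := \row_k at_pt v (c1 0 k).

Lemma c1E k : c1 0 k = g (c0 0 k).
Proof. by rewrite /c1 /crit mxE. Qed.

Lemma mem_P0 x : x \in P0 c0 -> exists j, x = c0 0 j.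
Proof. by move=> /imfsetP [j _ ->]; exists j. Qed.

Lemma c0_P0 j : c0 0 j \in P0 c0.
Proof. by apply/imfsetP; exists j. Qed.

Lemma c0_P j : c0 0 j \in P.
Proof. by have /fsubsetP h := mm_P0 hg; apply: h; exact: c0_P0. Qed.

Lemma g_pts x : x \in P -> g x \in pts.
Proof. by move=> xP; apply/imfsetP; exists x. Qed.

Lemma pts_P x : x \in pts -> x \in P.
Proof. by move=> /imfsetP [y /= yP ->]; exact: (mm_stable hg). Qed.

Lemma c1_pts k : c1 0 k \in pts.
Proof. by rewrite c1E; apply: g_pts; exact: c0_P. Qed.

Lemma iter_P n x : x \in P -> iter n g x \in P.
Proof. by move=> xP; elim: n => //= n IH; exact: (mm_stable hg). Qed.

Lemma W_ball : exists2 rho : R, 0 < rho & forall w, nm (w - c1) < rho -> W w.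
Proof.
have := ld_open hG; rewrite openE => /(_ _ (ld_base hG)) /nbhs_nm [d d0 hd].
by exists d.
Qed.

Lemma WU_ball x : U x -> exists2 rho : R, 0 < rho &
  forall wz : 'rV[C]_nu * C, nm (wz - (c1, x)) < rho -> W wz.1 /\ U wz.2.
Proof.
move=> xU; have [d d0 hd] := W_ball.
have := mm_open hg; rewrite openE => /(_ _ xU) /nbhs_nm [d' d'0 hd'].
exists (Num.min d d') => [|[w z]]; first by rewrite lt_min d0.
rewrite lt_min => /andP [h1 h2].
rewrite -[(w, z) - (c1, x)]/(w - c1, z - x) in h1 h2.
move: h1 h2; rewrite !nm_pair_lt => /andP [h1 _] /andP [_ h2].
by split; [exact: hd|exact: hd'].
Qed.

Lemma pcoord_diff j w : W w -> differentiable (pcoord j) w.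
Proof. by move=> /(ld_p hG); exact: differentiable_coordf. Qed.

Lemma pcoord_diff1 j : differentiable (pcoord j) c1.
Proof. by apply: pcoord_diff; exact: (ld_base hG). Qed.

Lemma pcoord_sdiff j : sdiff (pcoord j) c1 ('d (pcoord j) c1).
Proof.
have [d d0 hd] := W_ball.
by apply: (sdiff_scalar d0) => w /hd; exact: pcoord_diff.
Qed.

Lemma Gpair_diff wz : W wz.1 -> U wz.2 -> differentiable Gpair wz.
Proof. by move=> h1 h2; apply: (ld_G hG). Qed.

Lemma Gpair_diff1 x : U x -> differentiable Gpair (c1, x).
Proof. by move=> xU; apply: Gpair_diff => //; exact: (ld_base hG). Qed.

Lemma Gpair_sdiff x : U x -> sdiff Gpair (c1, x) ('d Gpair (c1, x)).
Proof.
move=> xU; have [d d0 hd] := WU_ball xU.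
by apply: (sdiff_scalar d0) => w /hd [h1 h2]; exact: Gpair_diff.
Qed.

Lemma Gpair_lo x u s : U x ->
  lo 1 (fun t : C => G (c1 + t *: u) (x + t * s) - g x - t * 'd Gpair (c1, x) (u, s)).
Proof.
move=> xU; have := lo_diff (u, s) (Gpair_diff1 xU); apply: eq_lo => t.
by rewrite {2}/Gpair /= (ld_G_base hG).
Qed.

Lemma g_diff x : U x -> differentiable g x.
Proof. by move=> /(mm_holomorphic hg). Qed.

Lemma dGpair x u s : U x ->
  'd Gpair (c1, x) (u, s) = 'd Gpair (c1, x) (u, 0) + derive1 g x * s.
Proof.
move=> xU; have -> : (u, s) = (u, 0) + s *: (0, 1).
  by rewrite -[RHS]/(u + s *: 0, 0 + s * 1) scaler0 addr0 add0r mulr1.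
rewrite linearD linearZ mulrC; congr (_ + _ * _).
rewrite derive1E'; last exact: g_diff.
apply: (@lo1_unique C C (fun t => g (x + t) - g x)).
  have [d d0 hd] := WU_ball xU.
  apply: (@lo_le _ _ _ _ _ _ 1) (Gpair_lo 0 1 xU).
  exists d => // t ht; rewrite mul1r mulr1 scaler0 addr0 -(ld_G_base hG) //.
  have [] := hd (c1, x + t) => //.
  rewrite -[(c1, x + t) - (c1, x)]/(c1 - c1, x + t - x) subrr [x + t]addrC addrK.
  by rewrite nm_pair_lt nm0 d0.
have := lo_diff (1 : C) (g_diff xU); apply: eq_lo => t.
by rewrite -[t *: 1]/(t * 1) mulr1.
Qed.

Lemma sum_derive (f : 'rV[C]_nu -> C) (u : 'rV[C]_nu) : differentiable f c1 ->
  \sum_k 'D_('e_k) f c1 * u 0 k = 'd f c1 u.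
Proof.
move=> df; rewrite [in RHS](row_sum_delta u) linear_sum.
by apply: eq_bigr => k _; rewrite deriveE // linearZ mulrC.
Qed.

Lemma transfer_P0 v j : c0 0 j \in pts ->
  at_pt (transfer c0 g P p G v) (c0 0 j) = 'd (pcoord j) c1 (ev v).
Proof.
move=> jp; rewrite /transfer lfunE /= /at_pt insubT /= /transfer_fun ffunE.
case: pickP => [i /= /eqP ij|/(_ j)]; last by rewrite /= eqxx.
have -> : i = j by exact: (mm_distinct hg).
rewrite -sum_derive; last exact: pcoord_diff1.
by apply: eq_bigr => k _; rewrite [ev v 0 k]mxE.
Qed.

Lemma transfer_other v x : x \in pts -> x \notin P0 c0 ->
  derive1 g x * at_pt (transfer c0 g P p G v) x = at_pt v (g x) - 'd Gpair (c1, x) (ev v, 0).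
Proof.
move=> xp xP0; have xU := mm_P hg (pts_P xp) xP0.
rewrite /transfer lfunE /= {1}/at_pt insubT /= /transfer_fun ffunE.
case: pickP => [i /= /eqP ij|_].
  by move: xP0; rewrite -ij c0_P0.
rewrite (mulVKf (mm_noncritical hg (pts_P xp) xP0)).
congr (_ - _); have dG : differentiable (fun w => G w x) c1.
  apply: (@differentiable_comp _ _ _ _ (fun w => (w, x)) Gpair); last exact: Gpair_diff1.
  by apply: differentiable_pair; [exact: differentiable_idm|exact: differentiable_cst].
have -> : 'd Gpair (c1, x) (ev v, 0) = 'd (fun w => G w x) c1 (ev v).
  apply: (@lo1_unique C C (fun t => G (c1 + t *: ev v) x - g x)).
    by apply: eq_lo (Gpair_lo (ev v) 0 xU) => t; rewrite mulr0 addr0.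
  by apply: eq_lo (lo_diff (ev v) dG) => t; rewrite (ld_G_base hG).
by rewrite -sum_derive //; apply: eq_bigr => k _; rewrite [ev v 0 k]mxE.
Qed.

Lemma at_ptE (b : C -> C) x : x \in pts ->
  at_pt ([ffun y : pts => b (val y) : C^o]) x = b x.
Proof. by move=> xp; rewrite /at_pt insubT /= ffunE. Qed.

Lemma at_pt_ext (u v : {ffun pts -> C^o}) :
  (forall x, x \in pts -> at_pt u x = at_pt v x) -> u = v.
Proof.
move=> h; apply/ffunP => x; have := h (val x) (valP x).
by rewrite /at_pt valK.
Qed.
End Deformation.

Section Lifts.
Context {R : realType}.
Local Notation C := (cplx R).
Variables (nu : nat) (c0 : 'rV[C]_nu) (U : set C) (g : C -> C) (P : {fset C}).
Variables (W : set 'rV[C]_nu) (p : 'rV[C]_nu -> 'rV[C]_nu) (G : 'rV[C]_nu -> C -> C).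
Hypotheses (hg : marked_map c0 U g P) (hG : local_deformation c0 U g W p G).

Let c1 := crit c0 g 1.
Let pts := gP g P.
Let A := transfer c0 g P p G.
Let row := @motion_c1 R nu c0 g.
Let Ev := @ev R nu c0 g P.
Let vec := {ffun pts -> C^o}.

(** Continuity at t = 0 is all that the comparison of motions with lifts uses; it holds for lifts,
    which live on a small disc, and for curves alike. *)
Definition germ (h : C -> C -> C) : Prop :=
  forall x, x \in pts -> lo 0 (fun t => h t x - x).

(** Entire in t, so that rescaling t is unrestricted; injectivity in x is left to [curve_motion]. *)
Definition curve (h : C -> C -> C) : Prop :=
  forall x, x \in pts -> (forall t, differentiable (h^~ x) t) /\ h 0 x = x.

(** The equations saying that [h] is a lift of itself, up to o(t^k); no lift has to exist. *)
Definition invariant_upto (k : nat) (h : C -> C -> C) : Prop :=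
  (forall j, c0 0 j \in pts -> lo k (fun t => p (row h t) 0 j - h t (c0 0 j))) /\
  (forall x, x \in pts -> x \notin P0 c0 ->
     lo k (fun t => G (row h t) (h t x) - h t (g x))).

(** To order k a lift of [h] would be h + t^k b. Off P0 the lift is inside G, so linearizing G
    produces the factor g'(x) and the opposite sign. *)
Definition inv_defect (k : nat) (h : C -> C -> C) (b : C -> C) : Prop :=
  (forall j, c0 0 j \in pts ->
     lo k (fun t => p (row h t) 0 j - h t (c0 0 j) - t ^+ k * b (c0 0 j))) /\
  (forall x, x \in pts -> x \notin P0 c0 ->
     lo k (fun t => G (row h t) (h t x) - h t (g x) + t ^+ k * (derive1 g x * b x))).

Lemma disc_nm (eps t : C) : 0 < eps -> disc eps t <-> nm t < complex.Re eps.
Proof. by move=> e0; rewrite /disc /= nmE -[eps in X in X <-> _]RRe_real ?gtr0_real // ltcR. Qed.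

Lemma Re_gt0 (eps : C) : 0 < eps -> 0 < complex.Re eps.
Proof. by move=> e0; rewrite -ltcR RRe_real // gtr0_real. Qed.

Lemma differentiable_lo0 (f : C -> C) : differentiable f 0 -> lo 0 (fun t => f t - f 0).
Proof.
move=> df e e0; have [d d0 hd] := differentiable_near df e0.
by exists d => // t ht; rewrite expr0 mulr1 ltW // hd // subr0.
Qed.

Lemma curve_germ h : curve h -> germ h.
Proof. by move=> hh x xp; have [d e] := hh x xp; rewrite -{2}e; exact: differentiable_lo0. Qed.

Lemma motion_germ eps h : 0 < eps -> holomorphic_motion g P (disc eps) h -> germ h.
Proof.
move=> e0 [_ hd h0] x xp; rewrite -{2}(h0 x xp).
apply: differentiable_lo0; apply: (hd x xp).
by apply/disc_nm => //; rewrite nm0; exact: Re_gt0.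
Qed.

Lemma row_germ h : germ h -> lo 0 (fun t => row h t - c1).
Proof.
move=> hh; apply: lo_row => j; apply: eq_lo (hh _ (c1_pts hg j)) => t.
by rewrite !mxE.
Qed.

Lemma row_expand k h1 h2 (v : vec) :
  (forall x, x \in pts -> lo k (fun t => h1 t x - h2 t x - t ^+ k * at_pt v x)) ->
  lo k (fun t => row h1 t - row h2 t - t ^+ k *: Ev v).
Proof.
move=> hh; apply: lo_row => j; apply: eq_lo (hh _ (c1_pts hg j)) => t.
by rewrite !mxE.
Qed.

(** The affine recursion v |-> b + A v. On P0 the lift is given by p. Off P0 the candidate z = h +
    t^k (b + A v) satisfies the lift equation up to o(t^k); since [h2] tends to x as well, local
    injectivity of G in its second variable makes it agree with z. *)
Lemma lift_step k h b h1 h2 (v : vec) eps : (0 < k)%N -> 0 < eps -> germ h -> germ h1 -> germ h2 ->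
  inv_defect k h b ->
  (forall x, x \in pts -> lo k (fun t => h1 t x - h t x - t ^+ k * at_pt v x)) ->
  is_lift c0 U g P W p G (disc eps) h1 h2 ->
  forall x, x \in pts -> lo k (fun t => h2 t x - h t x - t ^+ k * (b x + at_pt (A v) x)).
Proof.
move=> k0 eps0 gh gh1 gh2 [hP hO] h1h hl x xp.
have e0 := Re_gt0 eps0.
have rexp := row_expand h1h.
have [xP0|xP0] := boolP (x \in P0 c0).
  have [j xj] := mem_P0 xP0; rewrite xj in xp *.
  have k1 : lo k (fun t => p (row h1 t) 0 j - p (row h t) 0 j - t ^+ k * at_pt (A v) (c0 0 j)).
    rewrite (transfer_P0 hg hG) //.
    exact: (sdiff_lo (diff_continuous (pcoord_diff1 hG j)) (pcoord_sdiff hG j)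
      (row_germ gh1) (row_germ gh) rexp).
  apply: (@lo_le _ _ _ _ _ _ 1) (loD k1 (hP j xp)).
  exists (complex.Re eps) => // t ht; rewrite mul1r.
  have [_ /(_ j xp) -> _] := hl t ((disc_nm t eps0).2 ht).
  rewrite le_eqVlt; apply/orP; left; apply/eqP; congr nm; rewrite /row.
  by move: (p _ 0 j) (p _ 0 j) => a a'; ring.
have xU := mm_P hg (pts_P hg xp) xP0.
have c0' := mm_noncritical hg (pts_P hg xp) xP0.
set c := derive1 g x in c0'.
pose s := b x + at_pt (A v) x.
pose z t := h t x + t ^+ k * s.
have gxp : g x \in pts by exact: (g_pts g (pts_P hg xp)).
have tk : lo 0 (fun t : C => t ^+ k * s) by exact: (@lo_monom R C 0 k s k0).
have gz : lo 0 (fun t => z t - x).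
  by apply: eq_lo (loD (gh x xp) tk) => t; rewrite /z addrAC.
have k2 : lo k (fun t => G (row h1 t) (z t) - G (row h t) (h t x) -
    t ^+ k * (c * b x + at_pt v (g x))).
  have -> : c * b x + at_pt v (g x) = 'd (Gpair G) (c1, x) (Ev v, s).
    rewrite (dGpair hg hG) // -/c /s mulrDr (transfer_other hg hG) // -/Ev -/c1.
    by rewrite [RHS]addrCA [X in _ = _ + X]addrCA subrr addr0.
  have hp : lo 0 (fun t => (row h1 t, z t) - (c1, x)) := lo_pair (row_germ gh1) gz.
  have hq : lo 0 (fun t => (row h t, h t x) - (c1, x)) := lo_pair (row_germ gh) (gh x xp).
  have he : lo k (fun t => (row h1 t, z t) - (row h t, h t x) - t ^+ k *: (Ev v, s)).
    apply: eq_lo (lo_pair rexp (lo0 C k)) => t.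
    rewrite -[RHS]/(row h1 t - row h t - t ^+ k *: Ev v, z t - h t x - t ^+ k * s).
    by congr (_, _); rewrite /z addrAC addrK subrr.
  exact: (@sdiff_lo R _ _ (Gpair G) (c1, x) ('d (Gpair G) (c1, x)) _ _ _ k
    (diff_continuous (Gpair_diff1 hG xU)) (Gpair_sdiff hg hG xU) hp hq he).
have k3 : lo k (fun t => G (row h1 t) (z t) - h1 t (g x)).
  apply: eq_lo (loB (loD k2 (hO x xp xP0)) (h1h _ gxp)) => t; rewrite -/c.
  by move: (G _ _) (G _ _) (h1 t _) (h t (g x)) (at_pt v _) => *; ring.
have dG0 u : 'd (Gpair G) (c1, x) (0, u) = c * u.
  by rewrite (dGpair hg hG) // -[X in _ + X]/(c * u) (linear0 ('d (Gpair G) (c1, x))) add0r.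
have [K K0 [d d0 hd]] := sdiff_local_inj c0' dG0 (Gpair_sdiff hg hG xU).
have k4 : lo k (fun t => h2 t x - z t).
  have [r1 r10 hr1] := lo_small (row_germ gh1) d0.
  have [r2 r20 hr2] := lo_small gz d0.
  have [r3 r30 hr3] := lo_small (gh2 x xp) d0.
  apply: (@lo_le _ _ _ _ _ _ K) k3.
  exists (Num.min (Num.min (complex.Re eps) r1) (Num.min r2 r3)) => [|t].
    by rewrite !lt_min e0 r10 r20.
  rewrite !lt_min => /andP [/andP [t1 /hr1 t2] /andP [/hr2 t3 /hr3 t4]].
  have [_ _ /(_ x xp xP0) [_ e]] := hl t ((disc_nm t eps0).2 t1).
  by rewrite nmC -e; have := hd _ _ _ t2 t3 t4; rewrite nmC [nm (_ - z t)]nmC.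
apply: eq_lo k4 => t; rewrite /z /s; ring.
Qed.

(* [vt - A vt = b] cancels the defect. *)
Lemma inv_defect_step k h b (vt : vec) : (0 < k)%N -> germ h -> inv_defect k h b ->
  (forall x, x \in pts -> at_pt vt x - at_pt (A vt) x = b x) ->
  invariant_upto k (fun t x => h t x + t ^+ k * at_pt vt x).
Proof.
move=> k0 gh [hP hO] hb; set h1 := fun t x => _.
have tk x : lo 0 (fun t : C => t ^+ k * at_pt vt x) by exact: (@lo_monom R C 0 k (at_pt vt x) k0).
have gh1 : germ h1.
  by move=> x xp; apply: eq_lo (loD (gh x xp) (tk x)) => t; rewrite /h1 addrAC.
have h1h x : x \in pts -> lo k (fun t => h1 t x - h t x - t ^+ k * at_pt vt x).
  by move=> xp; apply: eq_lo (lo0 C k) => t; rewrite /h1; ring.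
have rexp := row_expand h1h; split.
  move=> j jp.
  have k1 : lo k (fun t => p (row h1 t) 0 j - p (row h t) 0 j - t ^+ k * at_pt (A vt) (c0 0 j)).
    rewrite (transfer_P0 hg hG) //.
    exact: (sdiff_lo (diff_continuous (pcoord_diff1 hG j)) (pcoord_sdiff hG j)
      (row_germ gh1) (row_germ gh) rexp).
  apply: eq_lo (loD k1 (hP j jp)) => t; rewrite -hb // /h1.
  by move: (p _ 0 j) (p _ 0 j) (at_pt _ _) (at_pt _ _) => *; ring.
move=> x xp xP0; have xU := mm_P hg (pts_P hg xp) xP0.
set c := derive1 g x.
have k2 : lo k (fun t => G (row h1 t) (h1 t x) - G (row h t) (h t x) -
    t ^+ k * 'd (Gpair G) (c1, x) (Ev vt, at_pt vt x)).
  have hp : lo 0 (fun t => (row h1 t, h1 t x) - (c1, x)) := lo_pair (row_germ gh1) (gh1 x xp).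
  have hq : lo 0 (fun t => (row h t, h t x) - (c1, x)) := lo_pair (row_germ gh) (gh x xp).
  have he : lo k (fun t => (row h1 t, h1 t x) - (row h t, h t x) - t ^+ k *: (Ev vt, at_pt vt x)).
    exact: (lo_pair rexp (h1h x xp)).
  exact: (@sdiff_lo R _ _ (Gpair G) (c1, x) ('d (Gpair G) (c1, x)) _ _ _ k
    (diff_continuous (Gpair_diff1 hG xU)) (Gpair_sdiff hg hG xU) hp hq he).
have e : 'd (Gpair G) (c1, x) (Ev vt, at_pt vt x) = at_pt vt (g x) + c * b x.
  rewrite (dGpair hg hG) // -hb // mulrBr (transfer_other hg hG) // -/Ev -/c1 -/c.
  by rewrite opprB [RHS]addrCA [X in _ = _ + X]addrCA subrr addr0 addrC.
apply: eq_lo (loD k2 (hO x xp xP0)) => t; rewrite e -/c /h1.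
by move: (G _ _) (G (row h t) _) (at_pt vt (g x)) => *; ring.
Qed.

(** The errors are holomorphic near t = 0 and o(t^k), so they have Taylor terms of order k + 1; off
    P0 the coefficient is divided by -g'(x). *)
Lemma invariant_upto_defect k h : curve h -> invariant_upto k h -> exists b, inv_defect k.+1 h b.
Proof.
move=> ch [hP hO]; have gh := curve_germ ch.
have drow t : differentiable (row h) t.
  apply: differentiable_row => j.
  have -> : (fun t => row h t 0 j) = h^~ (c1 0 j) by apply/funext => s; rewrite mxE.
  by have [] := ch _ (c1_pts hg j).
(* Both clauses are stated for every x, with value 0 off g(P), so that one [choice] defines [b] on
   all of C. *)
have H x : exists b : C, (forall j, x = c0 0 j -> x \in pts ->
      lo k.+1 (fun t => p (row h t) 0 j - h t (c0 0 j) - t ^+ k.+1 * b)) /\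
    (x \in pts -> x \notin P0 c0 ->
      lo k.+1 (fun t => G (row h t) (h t x) - h t (g x) + t ^+ k.+1 * (derive1 g x * b))).
  have [xp|xp] := boolP (x \in pts); last by exists 0; split.
  have [xP0|xP0] := boolP (x \in P0 c0).
    have [j xj] := mem_P0 xP0; rewrite xj in xp *.
    have [d d0 hd] := W_ball hG; have [r r0 hr] := lo_small (row_germ gh) d0.
    have [|b hb] := @taylor_lo R k (fun t => p (row h t) 0 j - h t (c0 0 j)) r r0 _ (hP j xp).
      move=> t /hr /hd Wt; apply: differentiableB; last by have [] := ch _ xp.
      apply: (@differentiable_comp _ _ _ _ (row h) (pcoord p j)); first exact: drow.
      exact: (pcoord_diff hG).
    exists b; split=> // i /(mm_distinct hg) <- _; exact: hb.
  have xU := mm_P hg (pts_P hg xp) xP0.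
  have c0' := mm_noncritical hg (pts_P hg xp) xP0.
  have gxp : g x \in pts by exact: (g_pts g (pts_P hg xp)).
  have [d d0 hd] := WU_ball hg hG xU.
  have [r r0 hr] := lo_small (lo_pair (row_germ gh) (gh x xp)) d0.
  have [|b hb] := @taylor_lo R k (fun t => G (row h t) (h t x) - h t (g x)) r r0 _ (hO x xp xP0).
    move=> t /hr /(hd (row h t, h t x)) [Wt Ut]; apply: differentiableB; last by have [] := ch _ gxp.
    apply: (@differentiable_comp _ _ _ _ (fun t => (row h t, h t x)) (Gpair G)).
      by apply: differentiable_pair; [exact: drow|have [] := ch _ xp].
    exact: (Gpair_diff hG).
  exists (- (derive1 g x)^-1 * b); split.
    by move=> j xj; move: xP0; rewrite xj c0_P0.
  by move=> _ _; apply: eq_lo hb => t; rewrite mulNr mulrN mulrN mulVKf.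
have [b hb] := choice H.
exists b; split=> [j jp|x xp xP0]; first by have [h1 _] := hb (c0 0 j); exact: h1.
by have [_ h2] := hb x; exact: h2.
Qed.
End Lifts.

(** * Bounded iterated lifts and almost invariant curves *)

Section Boundedness.
Context {R : realType}.
Local Notation C := (cplx R).
Variables (nu : nat) (c0 : 'rV[C]_nu) (U : set C) (g : C -> C) (P : {fset C}).
Variables (W : set 'rV[C]_nu) (p : 'rV[C]_nu -> 'rV[C]_nu) (G : 'rV[C]_nu -> C -> C).
Hypotheses (hg : marked_map c0 U g P) (hG : local_deformation c0 U g W p G).

Let c1 := crit c0 g 1.
Let pts := gP g P.
Let A := transfer c0 g P p G.
Let vec := {ffun pts -> C^o}.

Lemma at_ptD (u v : vec) x : at_pt (u + v) x = at_pt u x + at_pt v x.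
Proof. by rewrite -[u in LHS]scale1r at_pt_linear mul1r. Qed.

Lemma at_pt0 x : at_pt (0 : vec) x = 0.
Proof. by apply: (addrI (at_pt (0 : vec) x)); rewrite -at_ptD !addr0. Qed.

Lemma at_ptZ a (u : vec) x : at_pt (a *: u) x = a * at_pt u x.
Proof. by rewrite -[_ *: _]addr0 at_pt_linear at_pt0 addr0. Qed.

Lemma at_ptB (u v : vec) x : at_pt (u - v) x = at_pt u x - at_pt v x.
Proof. by rewrite at_ptD -[- v]scaleN1r at_ptZ mulN1r. Qed.

(** The n-th lift of [h0] differs from the reference curve [h] by the n-th iterate of v |-> b + A v
    in order m + 1, and Cauchy's estimate applies on the common disc. With h0 = h this bounds the
    sums of the A^i b; with [h] constant it bounds the powers of A. *)
Lemma lifted_bounded m h b h0 (bF v0 : vec) (M' : R) : curve g P h ->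
  inv_defect c0 g P p G m.+1 h b -> (forall x, x \in pts -> at_pt bF x = b x) ->
  (forall x t, x \in pts -> nm t < 1 -> nm (h t x) <= M') ->
  holomorphic_motion g P (disc 1) h0 -> liftable c0 U g P W p G h0 ->
  (forall x, x \in pts -> lo m.+1 (fun t => h0 t x - h t x - t ^+ m.+1 * at_pt v0 x)) ->
  exists B : R, forall n x, x \in pts -> nm (at_pt (iter n (fun v => bF + A v) v0) x) <= B.
Proof.
move=> ch hb hbF hM hm [eps [M [hs [/andP [e0 e1] M0 hs0 hsm hsl]]]] hv0.
have gh := curve_germ ch.
have e0' := Re_gt0 e0.
have e1' : complex.Re eps <= 1.
  by move: e1; rewrite lecE /= => /andP [].
have ghs n : germ g P (hs n).
  case: n => [|n]; last exact: (motion_germ e0 (hsm n)).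
  by rewrite hs0; apply: (motion_germ ltr01 hm).
have main n x : x \in pts -> lo m.+1 (fun t => hs n t x - h t x -
    t ^+ m.+1 * at_pt (iter n (fun v => bF + A v) v0) x).
  elim: n x => [|n IH] x xp; first by rewrite hs0; exact: hv0.
  have := @lift_step R nu c0 U g P W p G hg hG m.+1 h b (hs n) (hs n.+1) _ eps isT
    e0 gh (ghs n) (ghs n.+1) hb IH (hsl n).1 x xp.
  by apply: eq_lo => t; rewrite /= at_ptD hbF.
exists (8 * (complex.Re M + M') * (4 / complex.Re eps) ^+ m.+1) => n x xp.
apply: (coef_bound e0' _ _ (main n x xp)).
  move=> z hz; apply: differentiableB; last by have [] := ch x xp.
  have hz1 : disc eps z by apply/disc_nm.
  case: n => [|n]; last by have [_ hd _] := hsm n; apply: (hd x xp).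
  rewrite hs0; have [_ hd _] := hm; apply: (hd x xp).
  by apply/disc_nm => //; apply: (lt_le_trans hz).
move=> z hz; apply: (le_trans (nmB _ _)); apply: lerD.
  have := (hsl n).2 x z xp ((disc_nm z e0).2 hz).
  by rewrite nmE -[M in _ <= M -> _]RRe_real ?gtr0_real // lecR.
by apply: hM => //; apply: (lt_le_trans hz).
Qed.

(** A projection [q] with kernel the range of 1 - A satisfies q A = q, so it maps the n-th iterate
    to n q(bF). Boundedness forces q(bF) = 0. *)
Lemma bounded_range (bF : vec) (B : R) :
  (forall n x, x \in pts -> nm (at_pt (iter n (fun v => bF + A v) 0) x) <= B) ->
  exists w : vec, bF = w - A w.
Proof.
move=> hB; pose Q := (\1 - A)%VF.
suff : bF \in limg Q.
  by move=> /memv_imgP [w _ ->]; exists w; rewrite /Q add_lfunE opp_lfunE id_lfunE.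
pose q : 'End(vec) := (\1 - projv (limg Q))%VF.
have qE (v : vec) : q v = v - projv (limg Q) v by rewrite /q add_lfunE opp_lfunE id_lfunE.
have qQ (w : vec) : q (w - A w) = 0.
  have -> : w - A w = Q w by rewrite /Q add_lfunE opp_lfunE id_lfunE.
  by rewrite qE projv_id ?subrr // memv_img // memvf.
have qA (v : vec) : q (A v) = q v.
  by have := qQ v; rewrite linearB => /eqP; rewrite subr_eq0 => /eqP.
pose v n : vec := iter n (fun v => bF + A v) 0.
have qv n : q (v n) = n%:R *: q bF.
  elim: n => [|n IH]; first by rewrite scale0r /v /= linear0.
  have -> : v n.+1 = bF + A (v n) by [].
  by rewrite linearD /= qA IH -{1}[q bF]scale1r -scalerDl -natr1 addrC.
suff q0 : q bF = 0.
  by move: q0; rewrite qE => /eqP; rewrite subr_eq0 => /eqP ->; exact: memv_proj.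
clearbody q.
apply: at_pt_ext => x xp; rewrite at_pt0.
pose e (y : pts) : vec := [ffun z => if z == y then 1 else 0].
pose S := \sum_(y : pts) nm (at_pt (q (e y)) x).
have vE (u : vec) : u = \sum_y u y *: e y.
  apply/ffunP => z; rewrite sum_ffunE (bigD1 z) //= big1 => [|y yz].
    by rewrite !ffunE eqxx addr0 -[_ *: _]/(_ * _) mulr1.
  by rewrite !ffunE eq_sym (negbTE yz) scaler0.
have q_sum (u : vec) : at_pt (q u) x = \sum_y (u y : C) * at_pt (q (e y)) x.
  rewrite [in LHS](vE u) linear_sum.
  rewrite (big_morph (fun u => at_pt u x) (fun u v => at_ptD u v x) (at_pt0 x)).
  by apply: eq_bigr => y _; rewrite linearZ at_ptZ.
have bound n : n%:R * nm (at_pt (q bF) x) <= B * S.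
  have -> : n%:R * nm (at_pt (q bF) x) = nm (at_pt (q (v n)) x).
    rewrite qv at_ptZ nmM; congr (_ * _).
    by apply: complexI; rewrite -nmE normr_nat rmorph_nat.
  rewrite q_sum /S mulr_sumr; apply: (le_trans (nm_sum _ _ _)).
  apply: ler_sum => y _; rewrite nmM.
  apply: ler_wpM2r; first exact: nm_ge0.
  by have := hB n (val y) (valP y); rewrite /at_pt valK.
apply: nm_eq0; apply/eqP; rewrite eq_le nm_ge0 andbT leNgt; apply/negP => h.
have := archi_boundP (_ : 0 <= `|B * S| / nm (at_pt (q bF) x)).
rewrite divr_ge0 ?nm_ge0 // => /(_ isT); rewrite ltr_pdivrMr // ltNge => /negP; apply.
by apply: (le_trans (bound _)); exact: ler_norm.
Qed.

(** Finitely many distinct points stay distinct, and near their initial positions, for small t. The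
    scaling factor is real, so real curves remain real at real t. *)
Lemma curve_motion h : curve g P h ->
  exists2 d : R, 0 < d & holomorphic_motion g P (disc 1) (fun t x => h ((d%:C%C : C) * t) x) /\
    exists M : R, forall x t : C, x \in pts -> nm t < 1 -> nm (h ((d%:C%C : C) * t) x) <= M.
Proof.
move=> ch; have gh := curve_germ ch.
pose Q (x t : C) := nm (h t x - x) < 1 /\ forall y, y \in pts -> y != x -> h t x != h t y.
have [|d d0 hd] := @uniform_radius R _ _ nm (enum_fset pts) Q.
  move=> x xp; have xp' : x \in pts by [].
  have [d1 d10 hd1] := lo_small (gh x xp') ltr01.
  have [|d2 d20 hd2] := @uniform_radius R _ _ nm (enum_fset pts) (fun y t => y != x -> h t x != h t y).
    move=> y yp; have yp' : y \in pts by [].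
    have [->|yx] := eqVneq y x; first by exists 1.
    have e0 : 0 < nm (y - x) / 2 by rewrite divr_gt0 // nm_pos // subr_eq0.
    have [r r0 hr] := lo_small (gh x xp') e0; have [s s0 hs] := lo_small (gh y yp') e0.
    exists (Num.min r s) => [|t]; first by rewrite lt_min r0.
    rewrite lt_min => /andP [/hr h1 /hs h2] _; apply/negP => /eqP E.
    have e : y - x = (h t x - x) - (h t y - y) by rewrite E; ring.
    have h3 : nm (y - x) <= nm (h t x - x) + nm (h t y - y) by rewrite {1}e; exact: nmB.
    by have := le_lt_trans h3 (ltrD h1 h2); rewrite -splitr ltxx.
  exists (Num.min d1 d2) => [|t]; first by rewrite lt_min d10.
  by rewrite lt_min => /andP [/hd1 h1 h2]; split=> // y yp; exact: hd2.
exists d => //.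
have small (t : C) : nm t < 1 -> nm ((d%:C%C : C) * t) < d.
  by move=> ht; rewrite nmM nmR gtr0_norm // gtr_pMr.
split.
  split.
  - move=> t /(disc_nm t ltr01) ht x y xp yp; apply: contra_eq => xy.
    have [_ h1] := hd x ((d%:C%C : C) * t) xp (small t ht); apply: h1 => //.
    by rewrite eq_sym.
  - move=> x xp t _; apply: (@differentiable_comp _ _ _ _ (fun t => (d%:C%C : C) * t) (h^~ x)).
      by apply: differentiableM; [exact: differentiable_cst|exact: differentiable_idm].
    by have [] := ch x xp.
  - by move=> x xp; rewrite mulr0; have [] := ch x xp.
exists (1 + \sum_(y : pts) nm (val y)) => x t xp ht.
have [h1 _] := hd x ((d%:C%C : C) * t) xp (small t ht).
rewrite -(subrK x (h _ x)); apply: (le_trans (nmD _ _)); apply: lerD; first exact: ltW.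
rewrite (bigD1 (FSetSub xp)) //= lerDl sumr_ge0 // => y _; exact: nm_ge0.
Qed.

Section Admissible.
(** A condition on the values at real t, preserved by every operation in the construction of curves;
    it carries the real and the complex case through the same induction. *)
Variable ad : C -> Prop.
Hypothesis LP : forall h0, holomorphic_motion g P (disc 1) h0 ->
  (forall t x, t \is Num.real -> x \in pts -> ad (h0 t x)) -> liftable c0 U g P W p G h0.
Hypothesis ad_pts : forall x, x \in pts -> ad x.
Hypothesis adD : forall a b, ad a -> ad b -> ad (a + b).
Hypothesis adM : forall t a, t \is Num.real -> ad a -> ad (t * a).
Hypothesis ad_defect : forall k h b, curve g P h -> inv_defect c0 g P p G k h b ->
  (forall t x, t \is Num.real -> x \in pts -> ad (h t x)) -> forall x, x \in pts -> ad (b x).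
Hypothesis ad_solve : forall w : vec, (forall x, x \in pts -> ad (at_pt (w - A w) x)) ->
  exists2 w' : vec, w' - A w' = w - A w & forall x, x \in pts -> ad (at_pt w' x).

Lemma curve_add h m (w : vec) : curve g P h -> curve g P (fun t x => h t x + t ^+ m.+1 * at_pt w x).
Proof.
move=> ch x xp; have [h1 h2] := ch x xp; split=> [t|].
  apply: differentiableD; first exact: h1.
  by apply: differentiableM; [exact: differentiable_exp|exact: differentiable_cst].
by rewrite h2 expr0n mul0r addr0.
Qed.

Lemma const_curve : curve g P (fun _ x => x).
Proof. by move=> x xp; split=> // t; exact: differentiable_cst. Qed.

Lemma const_defect k : inv_defect c0 g P p G k (fun _ x => x) (fun _ => 0).
Proof.
have rE t : motion_c1 c0 g (fun _ x => x) t = c1 by apply/rowP => i; rewrite !mxE.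
split=> [j jp|x xp xP0]; apply: eq_lo (lo0 C k) => t; rewrite rE ?mulr0.
  by rewrite (ld_p_base hG) subrr subr0.
by rewrite (ld_G_base hG) ?subrr ?addr0 //; exact: (mm_P hg (pts_P hg xp) xP0).
Qed.

Lemma real_scale (d : R) t : t \is Num.real -> (d%:C%C : C) * t \is Num.real.
Proof. by move=> tr; apply: realM => //; apply/complex_realP; exists d. Qed.

(** Induction on the order, starting from x + t v, which has no defect of order 1 because A v = v.
    Later corrections have order at least 2 and leave the tangent unchanged. *)
Lemma invariant_curve (v : vec) m : A v = v -> (forall x, x \in pts -> ad (at_pt v x)) ->
  exists h, [/\ curve g P h, invariant_upto c0 g P p G m.+1 h,
    forall x, x \in pts -> lo 1 (fun t => h t x - x - t * at_pt v x) &
    forall t x, t \is Num.real -> x \in pts -> ad (h t x)].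
Proof.
move=> Av adv; elim: m => [|m [h [ch ih h1 adh]]].
  exists (fun t x => x + t ^+ 1 * at_pt v x); split.
  - exact: curve_add const_curve.
  - apply: (@inv_defect_step R nu c0 U g P W p G hg hG 1 (fun _ x => x) (fun _ => 0) v isT
      (curve_germ const_curve) (const_defect 1)) => x xp.
    by rewrite -/A Av subrr.
  - by move=> x xp; apply: eq_lo (lo0 C 1) => t; rewrite expr1 [x + _]addrC addrK subrr.
  - by move=> t x tr xp; rewrite expr1; apply: adD; [exact: ad_pts|apply: adM => //; exact: adv].
have [b hb] := invariant_upto_defect hg hG ch ih.
have adb := ad_defect ch hb adh.
pose bF : vec := [ffun y : pts => b (val y) : C^o].
have bFE x : x \in pts -> at_pt bF x = b x by exact: at_ptE.
have [d d0 [hm [M' hM]]] := curve_motion ch.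
pose D : C := d%:C%C; have D0 : D != 0 by rewrite /D (inj_eq (@complexI R)) gt_eqF.
pose h' t x := h (D * t) x.
have ch' : curve g P h'.
  move=> x xp; have [k1 k2] := ch x xp; split=> [t|]; last by rewrite /h' mulr0.
  apply: (@differentiable_comp _ _ _ _ (fun t => D * t) (h^~ x)); last exact: k1.
  by apply: differentiableM; [exact: differentiable_cst|exact: differentiable_idm].
(* Only the rescaled curve can be lifted; its defect is that of [h] times a nonzero constant, which
   is divided out in [w1]. *)
have hb' : inv_defect c0 g P p G m.+2 h' (fun x => D ^+ m.+2 * b x).
  have [k1 k2] := hb; split=> [j jp|x xp xP0].
    apply: eq_lo (lo_scale D (k1 j jp)) => t.
    have e : (D * t) ^+ m.+2 * b (c0 0 j) = t ^+ m.+2 * (D ^+ m.+2 * b (c0 0 j)).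
      by rewrite exprMn; ring.
    by rewrite e.
  apply: eq_lo (lo_scale D (k2 x xp xP0)) => t.
  have e c : (D * t) ^+ m.+2 * (c * b x) = t ^+ m.+2 * (c * (D ^+ m.+2 * b x)).
    by rewrite exprMn; ring.
  by rewrite e.
have liftable' : liftable c0 U g P W p G h'.
  by apply: LP => // t x tr xp; apply: adh => //; exact: real_scale.
have bF'E x : x \in pts -> at_pt (D ^+ m.+2 *: bF) x = D ^+ m.+2 * b x.
  by move=> xp; rewrite at_ptZ bFE.
have zero x : x \in pts -> lo m.+2 (fun t => h' t x - h' t x - t ^+ m.+2 * at_pt (0 : vec) x).
  by move=> xp; apply: eq_lo (lo0 C m.+2) => t; rewrite at_pt0 mulr0 subrr subr0.
have [B hB] := lifted_bounded ch' hb' bF'E hM hm liftable' zero.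
have [w0 ew0] := bounded_range hB.
have Dm : D ^+ m.+2 != 0 by rewrite expf_neq0.
pose w1 : vec := (D ^+ m.+2)^-1 *: w0.
have ew1 : bF = w1 - A w1.
  by rewrite /w1 linearZ -scalerBr -ew0 scalerA mulVf // scale1r.
(* The solution given by the projection argument may be inadmissible; it is replaced by an
   admissible one with the same image under 1 - A. *)
have [|w ew adw] := ad_solve (w := w1).
  by move=> x xp; rewrite -ew1 bFE //; exact: adb.
exists (fun t x => h t x + t ^+ m.+2 * at_pt w x); split.
- exact: curve_add.
- apply: (@inv_defect_step R nu c0 U g P W p G hg hG m.+2 h b w isT (curve_germ ch) hb) => x xp.
  by rewrite -/A -at_ptB ew -ew1 bFE.
- move=> x xp; have k1 := @lo_monom R C 1 m.+2 (at_pt w x) isT.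
  by apply: eq_lo (loD (h1 x xp) k1) => t; rewrite -[_ *: _]/(_ * _); ring.
- move=> t x tr xp; apply: adD; first exact: adh.
  by apply: adM; [exact: realX|exact: adw].
Qed.

(** The reference curve is constant, with zero defect, and the lifted motion is the rescaled line x
    + t v. *)
Lemma power_bounded_ad (v : vec) : (forall x, x \in pts -> ad (at_pt v x)) ->
  exists B : R, forall n x, x \in pts -> nm (at_pt (iter n A v) x) <= B.
Proof.
move=> adv; pose h t x := x + t ^+ 1 * at_pt v x.
have ch : curve g P h by exact: curve_add const_curve.
have [d d0 [hm _]] := curve_motion ch.
pose D : C := d%:C%C; have D0 : D != 0 by rewrite /D (inj_eq (@complexI R)) gt_eqF.
have lft : liftable c0 U g P W p G (fun t x => h (D * t) x).
  apply: LP => // t x tr xp; rewrite /h expr1; apply: adD; first exact: ad_pts.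
  by apply: adM; [exact: real_scale|exact: adv].
have [|||B hB] := lifted_bounded (v0 := D *: v) (bF := 0) (M' := \sum_(y : pts) nm (val y))
  const_curve (const_defect 1) _ _ hm lft.
- by move=> x _; rewrite at_pt0.
- move=> x t xp _; rewrite (bigD1 (FSetSub xp)) //= lerDl sumr_ge0 // => y _; exact: nm_ge0.
- by move=> x xp; apply: eq_lo (lo0 C 1) => t; rewrite /h !expr1 at_ptZ; ring.
exists (B / nm D) => n x xp; rewrite ler_pdivlMr; last exact: nm_pos.
rewrite mulrC -nmM -at_ptZ.
suff -> : D *: iter n A v = iter n (fun v => 0 + A v) (D *: v) by exact: hB.
by elim: n => //= n IH; rewrite add0r -IH linearZ.
Qed.
End Admissible.
End Boundedness.

(** * The complex and the real lifting property *)

Section RealCase.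
Context {R : realType}.
Local Notation C := (cplx R).
Variables (nu : nat) (c0 : 'rV[C]_nu) (U : set C) (g : C -> C) (P : {fset C}).
Variables (W : set 'rV[C]_nu) (p : 'rV[C]_nu -> 'rV[C]_nu) (G : 'rV[C]_nu -> C -> C).
Hypotheses (hg : marked_map c0 U g P) (hG : local_deformation c0 U g W p G).

Let c1 := crit c0 g 1.
Let pts := gP g P.
Let A := transfer c0 g P p G.
Let vec := {ffun pts -> C^o}.

(* Both versions of the lifting property at once: ad is True or "is real". *)
Record admissible (ad : C -> Prop) : Prop := Admissible {
  ad_lift : forall h0, holomorphic_motion g P (disc 1) h0 ->
    (forall t x, t \is Num.real -> x \in pts -> ad (h0 t x)) -> liftable c0 U g P W p G h0;
  ad_pts : forall x, x \in pts -> ad x;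
  ad_add : forall a b, ad a -> ad b -> ad (a + b);
  ad_mul : forall t a, t \is Num.real -> ad a -> ad (t * a);
  ad_defect : forall k h b, curve g P h -> inv_defect c0 g P p G k h b ->
    (forall t x, t \is Num.real -> x \in pts -> ad (h t x)) -> forall x, x \in pts -> ad (b x);
  ad_solve : forall w : vec, (forall x, x \in pts -> ad (at_pt (w - A w) x)) ->
    exists2 w' : vec, w' - A w' = w - A w & forall x, x \in pts -> ad (at_pt w' x);
  ad_split : forall v : vec, exists v1 v2 : vec, [/\ v = v1 + 'i%C *: v2,
    forall x, x \in pts -> ad (at_pt v1 x) /\ ad (at_pt v2 x) &
    A v = v -> A v1 = v1 /\ A v2 = v2]
}.

Lemma admissible_complex : lifting_property c0 U g P W p G -> admissible (fun _ => True).
Proof.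
move=> LP; split=> //; first by move=> h0 hm _; exact: LP.
  by move=> w _; exists w.
move=> v; exists v, 0; split=> [||Av]; [by rewrite scaler0 addr0|by []|].
by split=> //; rewrite linear0.
Qed.

Section Real.
Hypothesis rd : real_deformation c0 U g P W p G.

Let real (z : C) : Prop := z \is Num.real.

Lemma real_pts x : x \in pts -> real x.
Proof. by move=> /(pts_P hg) /(rd_P rd). Qed.

Lemma conj_real (z : C) : (z^* = z) <-> real z.
Proof. by split=> /CrealP. Qed.

Lemma real_row (w : 'rV[C]_nu) : (forall i, real (w 0 i)) -> conj_row w = w.
Proof. by move=> hw; apply/rowP => i; rewrite mxE; apply/conj_real; exact: hw. Qed.

Lemma real_p w j : W w -> (forall i, real (w 0 i)) -> real (p w 0 j).
Proof.
move=> Ww /real_row hw; apply/conj_real.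
by have := rd_p rd Ww; rewrite hw => {2}->; rewrite mxE.
Qed.

Lemma real_G w z : W w -> (forall i, real (w 0 i)) -> U z -> real z -> real (G w z).
Proof.
move=> Ww /real_row hw Uz /conj_real hz; apply/conj_real.
by rewrite -(rd_G rd Ww Uz) hw hz.
Qed.

Lemma real_g z : U z -> real z -> real (g z).
Proof.
move=> Uz /conj_real hz; apply/conj_real.
by rewrite -(rd_g rd (or_intror Uz)) hz.
Qed.

Lemma real_c1 i : real (c1 0 i).
Proof. exact: real_pts (c1_pts hg i). Qed.

Lemma real_derive x : U x -> real x -> real (derive1 g x).
Proof.
move=> xU xr; rewrite derive1E'; last exact: (g_diff hg).
have h := lo_diff (1 : C) (g_diff hg xU).
apply: (@real_coef R 1 (fun t => g (x + t *: 1) - g x)).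
  by apply: eq_lo h => t; rewrite expr1.
have [d d0 hd] := WU_ball hg hG xU.
exists d => // t ht tr; have ttr : real (x + t *: 1).
  by apply: realD => //; rewrite -[_ *: _]/(_ * _) mulr1.
apply: realB; last exact: real_g.
apply: real_g => //; have [] := hd (c1, x + t *: 1) => //.
rewrite -[(c1, _) - (c1, x)]/(c1 - c1, x + t *: 1 - x) subrr addrC addKr.
by rewrite nm_pair_lt nm0 d0 -[t *: 1]/(t * 1) mulr1.
Qed.

Lemma real_near (u : 'rV[C]_nu) : (forall i, real (u 0 i)) ->
  exists2 d : R, 0 < d & forall t : C, nm t < d -> t \is Num.real ->
    W (c1 + t *: u) /\ forall i, real ((c1 + t *: u) 0 i).
Proof.
move=> ur; have [d d0 hd] := W_ball hG.
have u1 : 0 < nm u + 1 by rewrite ltr_wpDl ?nm_ge0.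
exists (d / (nm u + 1)) => [|t]; first by rewrite divr_gt0.
rewrite ltr_pdivlMr // => ht tr; split.
  apply: hd; rewrite addrC addKr nmZ; apply: le_lt_trans ht.
  by rewrite mulrDr mulr1 lerDl nm_ge0.
move=> i; have -> : (c1 + t *: u) 0 i = c1 0 i + t * u 0 i by rewrite mxE [(t *: u) 0 i]mxE.
by apply: realD; [exact: real_c1|apply: realM => //; exact: ur].
Qed.

Lemma real_ev (v : vec) : (forall x, x \in pts -> real (at_pt v x)) ->
  forall i, real ((ev c0 v) 0 i).
Proof. by move=> hv i; rewrite mxE; apply: hv; exact: (c1_pts hg). Qed.

(** The entries of A v are built from leading coefficients of p and G along a real direction at a
    real point, where these maps take real values. *)
Lemma real_transfer (v : vec) : (forall x, x \in pts -> real (at_pt v x)) ->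
  forall x, x \in pts -> real (at_pt (A v) x).
Proof.
move=> hv x xp; have er := real_ev hv.
have [d d0 hd] := real_near er.
have [xP0|xP0] := boolP (x \in P0 c0).
  have [j xj] := mem_P0 xP0; rewrite xj in xp *; rewrite (transfer_P0 hg hG) //.
  apply: (@real_coef R 1 (fun t => pcoord p j (c1 + t *: ev c0 v) - pcoord p j c1)).
    by apply: eq_lo (lo_diff (ev c0 v) (pcoord_diff1 hG j)) => t; rewrite expr1.
  exists d => // t ht tr; have [h1 h2] := hd t ht tr.
  by apply: realB; apply: real_p => //; [exact: (ld_base hG)|exact: real_c1].
have xU := mm_P hg (pts_P hg xp) xP0; have xr := real_pts xp.
have c0' := mm_noncritical hg (pts_P hg xp) xP0.
have -> : at_pt (A v) x = (derive1 g x)^-1 * (derive1 g x * at_pt (A v) x).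
  by rewrite mulKf.
apply: realM; first by rewrite realV; exact: real_derive.
rewrite (transfer_other hg hG) //; apply: realB; first by apply: hv; exact: (g_pts g (pts_P hg xp)).
apply: (@real_coef R 1 (fun t => G (c1 + t *: ev c0 v) (x + t * 0) - g x)).
  by apply: eq_lo (Gpair_lo hG (ev c0 v) 0 xU) => t; rewrite expr1.
exists d => // t ht tr; have [h1 h2] := hd t ht tr; rewrite mulr0 addr0.
by apply: realB; [exact: real_G|exact: real_g].
Qed.

Definition re_vec (v : vec) : vec := [ffun y => ((complex.Re (v y : C))%:C%C : C^o)].

Lemma at_re_vec v x : at_pt (re_vec v) x = (complex.Re (at_pt v x))%:C%C.
Proof. by rewrite /at_pt; case: insub => [y|] //=; rewrite ffunE. Qed.

Lemma re_vec_real v x : real (at_pt (re_vec v) x).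
Proof. by rewrite at_re_vec; apply/complex_realP; eexists. Qed.

Lemma re_im_vec (v : vec) : v = re_vec v + 'i%C *: re_vec (- 'i%C *: v).
Proof.
apply: at_pt_ext => x xp; rewrite at_ptD at_ptZ !at_re_vec at_ptZ.
by case: (at_pt v x) => a b; apply: complex_ext => /=; ring.
Qed.

Lemma re_realD (a b : C) : real a -> real b -> (complex.Re (a + 'i%C * b))%:C%C = a.
Proof.
by move=> /complex_realP [x ->] /complex_realP [y ->]; congr (_%:C%C) => /=; ring.
Qed.

(** Since A preserves real vectors it commutes with real parts. Hence w - A w = b with b real is
    also solved by the real part of w. *)
Lemma transfer_re (v : vec) : A (re_vec v) = re_vec (A v).
Proof.
apply: at_pt_ext => x xp; rewrite at_re_vec {2}(re_im_vec v) linearD linearZ at_ptD at_ptZ.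
by rewrite re_realD //; apply: real_transfer => // y _; exact: re_vec_real.
Qed.

Lemma admissible_real : real_lifting_property c0 U g P W p G ->
  admissible (fun z => z \is Num.real).
Proof.
move=> LP; split.
- by move=> h0 hm hr; apply: LP; split=> // t x _ tr xp; exact: hr.
- exact: real_pts.
- by move=> a b; exact: realD.
- by move=> t a; exact: realM.
- move=> k h b ch [hP hO] hr x xp; have gh := curve_germ ch.
  have [d d0 hd] := W_ball hG; have [r r0 hr'] := lo_small (row_germ hg gh) d0.
  have rowr (t : C) : nm t < r -> t \is Num.real -> W (motion_c1 c0 g h t) /\
      forall i, real (motion_c1 c0 g h t 0 i).
    move=> /hr' /hd ht tr; split=> // i; rewrite mxE; apply: hr => //; exact: (c1_pts hg).
  have [xP0|xP0] := boolP (x \in P0 c0).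
    have [j xj] := mem_P0 xP0; rewrite xj in xp *.
    apply: (real_coef (hP j xp)); exists r => // t ht tr.
    have [h1 h2] := rowr t ht tr.
    by apply: realB; [exact: real_p|exact: hr].
  have xU := mm_P hg (pts_P hg xp) xP0; have xr := real_pts xp.
  have c0' := mm_noncritical hg (pts_P hg xp) xP0.
  have -> : b x = - ((derive1 g x)^-1 * - (derive1 g x * b x)).
    by rewrite mulrN opprK mulKf.
  rewrite realN; apply: realM; first by rewrite realV; exact: real_derive.
  have gxp : g x \in pts by exact: (g_pts g (pts_P hg xp)).
  have [d' d'0 hd'] := WU_ball hg hG xU; have [r' r'0 hr''] := lo_small (gh x xp) d'0.
  apply: (@real_coef R k (fun t => G (motion_c1 c0 g h t) (h t x) - h t (g x))).
    by apply: eq_lo (hO x xp xP0) => t; rewrite mulrN opprK.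
  exists (Num.min r r') => [|t]; first by rewrite lt_min r0.
  rewrite lt_min => /andP [t1 t2] tr; have [h1 h2] := rowr t t1 tr.
  apply: realB; last exact: hr.
  apply: real_G => //; last exact: hr.
  have [] := hd' (c1, h t x) => //.
  rewrite -[(c1, h t x) - (c1, x)]/(c1 - c1, h t x - x) subrr nm_pair_lt nm0 d'0.
  exact: hr''.
- move=> w hw; exists (re_vec w); last by move=> x _; exact: re_vec_real.
  apply: at_pt_ext => x xp; rewrite transfer_re [LHS]at_ptB !at_re_vec.
  have /complex_realP [a ea] := hw x xp.
  by rewrite ea -rmorphB /= -cReN -cReD -at_ptB ea.
- move=> v; exists (re_vec v), (re_vec (- 'i%C *: v)); split.
  + exact: re_im_vec.
  + by move=> x _; split; exact: re_vec_real.
  + by move=> Av; rewrite !transfer_re linearZ /= -/A Av.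
Qed.
End Real.

Lemma admissible_exists : lifting_property c0 U g P W p G \/
    (real_deformation c0 U g P W p G /\ real_lifting_property c0 U g P W p G) ->
  exists ad, admissible ad.
Proof.
case=> [LP|[rd LP]]; first by exists (fun _ => True); exact: admissible_complex.
by exists (fun z => z \is Num.real); exact: admissible_real.
Qed.

Lemma power_bounded ad (v : vec) : admissible ad ->
  exists B : R, forall n x, x \in pts -> nm (at_pt (iter n A v) x) <= B.
Proof.
move=> [h1 h2 h3 h4 h5 h6 h7]; have [v1 [v2 [ev hv _]]] := h7 v.
have [B1 hB1] := power_bounded_ad hg hG h1 h2 h3 h4 (v := v1) (fun x xp => (hv x xp).1).
have [B2 hB2] := power_bounded_ad hg hG h1 h2 h3 h4 (v := v2) (fun x xp => (hv x xp).2).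
exists (B1 + B2) => n x xp.
have -> : iter n A v = iter n A v1 + 'i%C *: iter n A v2.
  by elim: n => //= n ->; rewrite linearD linearZ.
rewrite at_ptD at_ptZ; apply: (le_trans (nmD _ _)); rewrite nmM nm_i mul1r.
by apply: lerD; [exact: hB1|exact: hB2].
Qed.

(** On an eigenvector the bounded powers act as a^n, which by Bernoulli's inequality would grow at
    least linearly if |a| > 1. *)
Lemma eigenvalue_bound ad a : admissible ad -> passmx.leigenvalue A a -> nm a <= 1.
Proof.
move=> had; rewrite /passmx.leigenvalue /passmx.leigenspace => h.
pose v := vpick (lker (A - a *: \1)%VF).
have v0 : v != 0 by rewrite vpick0.
have Av : A v = a *: v.
  have := memv_pick (lker (A - a *: \1)%VF); rewrite memv_ker add_lfunE opp_lfunE scale_lfunE id_lfunE.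
  by rewrite subr_eq0 => /eqP.
have [B hB] := power_bounded v had.
have iv n : iter n A v = a ^+ n *: v.
  elim: n => [|n IH]; first by rewrite scale1r.
  by rewrite iterS IH linearZ /= Av scalerA exprSr.
have [x xp vx] : exists2 x, x \in pts & at_pt v x != 0.
  apply: contrapT => hno; move/eqP: v0; apply; apply: at_pt_ext => x xp.
  rewrite at_pt0; apply: contrapT => /eqP vx; apply: hno; by exists x.
have vp := nm_pos vx.
rewrite leNgt; apply/negP => a1.
have bound n : nm a ^+ n <= B / nm (at_pt v x).
  by rewrite ler_pdivlMr // -nmX -nmM -at_ptZ -iv; exact: hB.
pose e := nm a - 1; have e0 : 0 < e by rewrite subr_gt0.
have bern n : n%:R * e <= nm a ^+ n.
  have h1 : 1 + n%:R * e <= nm a ^+ n.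
    elim: n => [|n IH]; first by rewrite mul0r addr0 expr0.
    have -> : nm a = 1 + e by rewrite /e addrC subrK.
    rewrite exprS; have ea : nm a = 1 + e by rewrite /e addrC subrK.
    rewrite -ea; apply: (@le_trans _ _ ((1 + e) * (1 + n%:R * e))); last first.
      by rewrite -ea ler_pM2l //; apply: lt_trans a1.
    have k0 : 0 <= n%:R * (e * e) by rewrite mulr_ge0 // mulr_ge0 // ltW.
    by rewrite -natr1; move: (n%:R : R) k0 => N; move: (e : R) => E; lra.
  by apply: le_trans h1; rewrite lerDr.
have B0 : 0 <= `|B / nm (at_pt v x)| / e by rewrite divr_ge0 // ltW.
have := archi_boundP B0; rewrite ltr_pdivrMr // ltNge => /negP; apply.
apply: (le_trans (bern _)); apply: (le_trans (bound _)); exact: ler_norm.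
Qed.
End RealCase.

(** * Critical relations *)

Section Relations.
Context {R : realType}.
Local Notation C := (cplx R).
Variables (nu : nat) (c0 : 'rV[C]_nu) (U : set C) (g : C -> C) (P : {fset C}).
Variables (W : set 'rV[C]_nu) (p : 'rV[C]_nu -> 'rV[C]_nu) (G : 'rV[C]_nu -> C -> C).
Hypotheses (hg : marked_map c0 U g P) (hG : local_deformation c0 U g W p G).
Variables (r : nat) (q l : 'I_nu -> nat) (mu : 'I_nu -> 'I_nu).
Hypothesis hrel : critical_relations c0 g r q l mu.
Hypothesis hmult : forall j : 'I_nu, (r <= j)%N ->
  derive1 (iter (q j - l j) g) (iter (l j) g (c0 0 j)) <> 1.

Let c1 := crit c0 g 1.
Let pts := gP g P.
Let A := transfer c0 g P p G.
Let vec := {ffun pts -> C^o}.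
Let F := relation_map p G r q l mu.

Lemma derive1_compC (f h : C -> C) x : differentiable f x -> differentiable h (f x) ->
  derive1 (h \o f) x = derive1 h (f x) * derive1 f x.
Proof.
move=> df dh; have dhf : differentiable (h \o f) x by exact: differentiable_comp.
have e1 : derive1 (h \o f) x = 'd (h \o f) x 1 := derive1E' dhf.
have e2 : derive1 h (f x) = 'd h (f x) 1 := derive1E' dh.
have e3 : derive1 f x = 'd f x 1 := derive1E' df.
have e4 : 'd (h \o f) x 1 = 'd h (f x) ('d f x 1).
  exact: (congr1 (fun k : C -> C => k 1) (diff_comp df dh)).
have e5 (a : C) : 'd h (f x) a = a * 'd h (f x) 1.
  by rewrite -{1}[a]mulr1 -[a * 1]/(a *: 1) linearZ.
apply: (etrans e1); apply: (etrans e4); apply: (etrans (e5 _)).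
by apply: (etrans (mulrC _ _)); exact: (congr2 *%R (esym e2) (esym e3)).
Qed.

Lemma derive_iter n x : (forall k, (k < n)%N -> U (iter k g x)) ->
  differentiable (iter n g) x /\
  forall y, n = y.+1 -> derive1 (iter n g) x = derive1 g (iter y g x) * derive1 (iter y g) x.
Proof.
elim: n => [|n IH] h; first by split=> //; exact: differentiable_idm.
have [|dn _] := IH; first by move=> k kn; apply: h; exact: leqW.
have dgn : differentiable g (iter n g x) by apply: (g_diff hg); exact: h.
have dn1 : differentiable (iter n.+1 g) x by exact: (differentiable_comp dn dgn).
split=> // _ [<-].
exact: derive1_compC dn dgn.
Qed.

Lemma iter_pts n x : x \in pts -> iter n g x \in pts.
Proof. by case: n => //= n xp; apply: g_pts; apply: (iter_P hg); exact: (pts_P hg). Qed.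

Lemma iter_pts1 n j : (0 < n)%N -> iter n g (c0 0 j) \in pts.
Proof. by case: n => // n _ /=; apply: g_pts; apply: (iter_P hg); exact: (c0_P hg). Qed.

(** The homogeneous linearized equation along an orbit is solved by the chain rule; as g' is nonzero
    off P0, a zero also propagates backwards. *)
Lemma transport (d : nat -> C) x n : x \in pts ->
  (forall k, (k < n)%N -> iter k g x \notin P0 c0) ->
  (forall k, (k < n)%N -> d k.+1 = derive1 g (iter k g x) * d k) ->
  d n = derive1 (iter n g) x * d 0 /\ (d n = 0 -> d 0 = 0).
Proof.
move=> xp xP0 hd.
have hU k : (k < n)%N -> U (iter k g x).
  by move=> kn; apply: (mm_P hg); [exact: (pts_P hg (iter_pts k xp))|exact: xP0].
have main m : (m <= n)%N -> d m = derive1 (iter m g) x * d 0.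
  elim: m => [|m IH] mn.
    have -> : derive1 (iter 0 g) x = 1; last by rewrite mul1r.
    rewrite derive1E'; last exact: differentiable_idm.
    by rewrite (_ : 'd (iter 0 g) x = id :> (C -> C)) //; exact: diff_val.
  have [|_ /(_ m erefl) ->] := @derive_iter m.+1 x.
    by move=> k km; apply: hU; apply: leq_trans mn.
  by rewrite hd // IH ?mulrA // ltnW.
split; first exact: main.
elim: n hd xP0 {hU main} => // n IH hd xP0.
rewrite hd // => /eqP; rewrite mulf_eq0.
have nz := mm_noncritical hg (pts_P hg (iter_pts n xp)) (xP0 n (ltnSn n)).
rewrite (negbTE nz) /= => /eqP; apply: IH => k kn; [apply: hd|apply: xP0]; exact: leqW.
Qed.

(** Following mu through relations of type (a) must stop, since each one shortens the distance m to
    x; it can only stop at an index of type (b). *)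
Lemma orbit_end j m x : iter m g (c0 0 j) = x -> (forall n, iter n g x \notin P0 c0) ->
  exists i : 'I_nu, (r <= i)%N /\ exists m', iter m' g (c0 0 i) = x.
Proof.
elim/ltn_ind: m j => m IH j ex xfree.
have [rj|jr] := leqP r j; first by exists j; split=> //; exists m.
have [q0 eq _] := cr_a hrel jr.
have [mq|qm] := ltnP m (q j).
  have := xfree (q j - m)%N; rewrite -ex -iterD subnK; last exact: ltnW.
  by rewrite eq c0_P0.
apply: (IH (m - q j)%N _ (mu j)) => //.
  by rewrite ltn_subrL q0 (leq_trans q0 qm).
by rewrite -eq -iterD subnK.
Qed.

(** An orbit either meets P0, where v vanishes, or ends in a cycle off P0, where v equals itself
    times the multiplier. The multiplier is not 1, by [hmult] for cycles met by the orbit of P0 and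
    by [no_extra_multiplier_one] for the others. Zeros are then pulled back along the orbit. *)
Lemma kernel_zero (v : vec) : no_extra_multiplier_one c0 g P ->
  (forall j, c0 0 j \in pts -> at_pt v (c0 0 j) = 0) ->
  (forall x, x \in pts -> x \notin P0 c0 -> at_pt v (g x) = derive1 g x * at_pt v x) ->
  forall x, x \in pts -> at_pt v x = 0.
Proof.
move=> hno h0 hv.
have chain n x : x \in pts -> (forall k, (k < n)%N -> iter k g x \notin P0 c0) ->
    at_pt v (iter n g x) = derive1 (iter n g) x * at_pt v x /\
    (at_pt v (iter n g x) = 0 -> at_pt v x = 0).
  move=> xp xP0; apply: (@transport (fun k => at_pt v (iter k g x)) x n) => // k kn.
  by rewrite iterS hv //; [exact: iter_pts|exact: xP0].
have periodic_zero x : x \in pts -> (forall n, iter n g x \notin P0 c0) ->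
    (exists2 n, (0 < n)%N & iter n g x = x) -> at_pt v x = 0.
  move=> xp xfree [n n0 en].
  have [[j [m ejm]]|hnone] := pselect (exists (j : 'I_nu) m, iter m g (c0 0 j) = x).
    have [i [ri [m' em']]] := orbit_end ejm xfree.
    have [/andP [l1 lq] eq qfree] := cr_b hrel ri.
    have clp : iter (l i) g (c0 0 i) \in pts by exact: iter_pts1.
    have lfree k : (k < q i - l i)%N -> iter k g (iter (l i) g (c0 0 i)) \notin P0 c0.
      by move=> kq; rewrite -iterD; apply: qfree; move: l1 lq kq; clear; lia.
    have [k1 _] := chain (q i - l i)%N _ clp lfree.
    have zl : at_pt v (iter (l i) g (c0 0 i)) = 0.
      move: k1; rewrite -iterD subnK ?(ltnW lq) // eq => /eqP.
      rewrite -subr_eq0 -{1}[at_pt v _]mul1r -mulrBl mulf_eq0 => /orP [|/eqP //].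
      by rewrite subr_eq0 eq_sym => /eqP /(hmult ri).
    have per N : iter (l i + N * (q i - l i)) g (c0 0 i) = iter (l i) g (c0 0 i).
      elim: N => [|N IH]; first by rewrite addn0.
      rewrite mulSn addnCA iterD IH -iterD subnK ?(ltnW lq) //.
    (* After m' turns of the cycle the index of c_{l_i, i} exceeds that of x, so x lies before a
       point where v is zero. *)
    have m'le : (m' <= l i + m' * (q i - l i))%N.
      by rewrite (leq_trans _ (leq_addl _ _)) // leq_pmulr // subn_gt0.
    have [_ k2] := chain (l i + m' * (q i - l i) - m')%N x xp (fun k _ => xfree k).
    by apply: k2; rewrite -em' -iterD subnK // per.
  (* [no_extra_multiplier_one] speaks of the minimal period. *)
  have exn : exists n, (0 < n)%N && (iter n g x == x) by exists n; rewrite n0 en eqxx.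
  case: (ex_minnP exn) => s /andP [s0 /eqP es] smin.
  have D1 : derive1 (iter s g) x <> 1.
    apply: hno => //; first exact: (pts_P hg).
      move=> m /andP [m0 ms] em; have := smin m; rewrite m0 em eqxx => /(_ isT).
      by rewrite leqNgt ms.
    by move=> j m ejm; apply: hnone; exists j, m.
  have [k1 _] := chain s x xp (fun k _ => xfree k).
  move/eqP: k1; rewrite es -subr_eq0 -{1}[at_pt v _]mul1r -mulrBl mulf_eq0 => /orP [|/eqP //].
  by rewrite subr_eq0 eq_sym => /eqP.
move=> x xp.
have [[n xn]|hfree] := pselect (exists n, iter n g x \in P0 c0).
  have exn : exists n, iter n g x \in P0 c0 by exists n.
  case: (ex_minnP exn) => s xs smin.
  have sfree k : (k < s)%N -> iter k g x \notin P0 c0.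
    by move=> ks; apply/negP => /smin; rewrite leqNgt ks.
  have [_ k2] := chain s x xp sfree; apply: k2.
  have [j xj] := mem_P0 xs; rewrite xj; apply: h0; rewrite -xj; exact: iter_pts.
have xfree n : iter n g x \notin P0 c0.
  by apply/negP => h; apply: hfree; exists n.
(* By the pigeonhole principle on the finite set g(P). *)
have [a [n [n0 ean]]] : exists a n, (0 < n)%N /\ iter (n + a) g x = iter a g x.
  pose f (i : 'I_#|` pts|.+1) : pts := FSetSub (iter_pts i xp).
  have /injectivePn [i [j ij eij]] : ~~ injectiveb f.
    apply/negP => /injectiveP /leq_card; rewrite card_ord cardfE ltnn.
    by [].
  have e : iter i g x = iter j g x by exact: (congr1 val eij).
  have [lt|gt|eq] := ltngtP i j.
  - by exists i, (j - i)%N; rewrite subn_gt0 subnK ?(ltnW lt).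
  - by exists j, (i - j)%N; rewrite subn_gt0 subnK ?(ltnW gt).
  - by move: ij; rewrite (val_inj eq) eqxx.
have [_ k2] := chain a x xp (fun k _ => xfree k); apply: k2.
apply: periodic_zero => [|k|]; first exact: iter_pts.
  by rewrite -iterD.
by exists n => //; rewrite -iterD.
Qed.

(** Its transfer operator is the homogeneous part of A: zero on P0 and v(g(x)) / g'(x) elsewhere. *)
Lemma trivial_deformation : local_deformation c0 U g W (fun _ => c0) (fun _ => g).
Proof.
split; [exact: (ld_open hG)|exact: (ld_connected hG)|exact: (ld_base hG)| |by []| |by []].
  by move=> w _; exact: differentiable_cst.
move=> [w z] [_ /= zU].
apply: (@differentiable_comp _ _ _ _ (fun wz : 'rV[C]_nu * C => wz.2) g); last exact: (g_diff hg).
exact: (@linear_differentiable C _ _ (snd : {linear ('rV[C]_nu * C)%type -> C}) (w, z) (fun x => cvg_snd)).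
Qed.

(** These are the equations of A v = v with [ev v] replaced by the given [u]. Their homogeneous part
    is 1 - B for the trivial deformation; [kernel_zero] makes it injective, hence surjective in
    finite dimension. *)
Lemma solve_vec (u : 'rV[C]_nu) : no_extra_multiplier_one c0 g P -> exists v : vec,
  (forall j, c0 0 j \in pts -> at_pt v (c0 0 j) = 'd (pcoord p j) c1 u) /\
  (forall x, x \in pts -> x \notin P0 c0 ->
     at_pt v (g x) = 'd (Gpair G) (c1, x) (u, 0) + derive1 g x * at_pt v x).
Proof.
move=> hno; have hT := trivial_deformation.
pose B := transfer c0 g P (fun _ : 'rV[C]_nu => c0) (fun _ : 'rV[C]_nu => g).
have B_P0 v j : c0 0 j \in pts -> at_pt (B v) (c0 0 j) = 0.
  move=> jp; rewrite /B (transfer_P0 hg hT) //.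
  have := lo_diff (ev c0 v) (pcoord_diff1 hT j).
  move=> h; apply: (@lo1_unique R C C (fun=> 0)).
    by apply: eq_lo h => t; rewrite /pcoord subrr.
  by apply: eq_lo (lo0 C 1) => t; rewrite scaler0 subr0.
have B_other v x : x \in pts -> x \notin P0 c0 ->
    derive1 g x * at_pt (B v) x = at_pt v (g x).
  move=> xp xP0; have xU := mm_P hg (pts_P hg xp) xP0.
  rewrite /B (transfer_other hg hT) // -[RHS]subr0; congr (_ - _).
  apply: (@lo1_unique R C C (fun=> 0)).
    by apply: eq_lo (Gpair_lo hT (ev c0 v) 0 xU) => t; rewrite mulr0 addr0 subrr.
  by apply: eq_lo (lo0 C 1) => t; rewrite scaler0 subr0.
have inj : lker (\1 - B)%VF == 0%VS.
  rewrite -subv0; apply/subvP => v; rewrite memv_ker memv0 add_lfunE opp_lfunE id_lfunE.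
  rewrite subr_eq0 => /eqP ev; apply/eqP; apply: at_pt_ext => x xp; rewrite at_pt0.
  apply: kernel_zero => // [j jp|y yp yP0]; first by rewrite ev B_P0.
  by rewrite {2}ev B_other.
pose w : vec := [ffun y : pts =>
  (if [pick j | c0 0 j == val y] is Some j then 'd (pcoord p j) c1 u
   else - ((derive1 g (val y))^-1 * 'd (Gpair G) (c1, val y) (u, 0))) : C^o].
have [v hv] : exists v : vec, v - B v = w.
  exists ((\1 - B)^-1 w)%VF.
  have := comp_lfunE (\1 - B)%VF ((\1 - B)^-1)%VF w.
  by rewrite (lker0_compfV inj) id_lfunE add_lfunE opp_lfunE id_lfunE.
exists v; split=> [j jp|x xp xP0].
  have := congr1 (fun v : vec => at_pt v (c0 0 j)) hv; rewrite /= at_ptB B_P0 // subr0 => ->.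
  rewrite /at_pt insubT /= ffunE; case: pickP => [i /= /eqP ij|/(_ j)]; last by rewrite /= eqxx.
  by have -> : i = j by exact: (mm_distinct hg).
have cn := mm_noncritical hg (pts_P hg xp) xP0.
have := congr1 (fun v : vec => derive1 g x * at_pt v x) hv.
rewrite /= at_ptB mulrBr B_other // => /eqP; rewrite subr_eq => /eqP ->.
suff -> : derive1 g x * at_pt w x = - 'd (Gpair G) (c1, x) (u, 0) by rewrite addrA subrr add0r.
rewrite /at_pt insubT /= ffunE; case: pickP => [i /= /eqP ij|_].
  by move: xP0; rewrite -ij c0_P0.
by rewrite mulrN mulVKf.
Qed.
(** [x_ j n] is c_{n+1, j}; the relations use it at the indices q_j - 1 and l_j - 1. *)
Let x_ (j : 'I_nu) n := iter n g (c1 0 j).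

Lemma x_iter j n : x_ j n = iter n.+1 g (c0 0 j).
Proof. by rewrite iterSr -c1E. Qed.

Lemma x_pts j n : x_ j n \in pts.
Proof. exact: (iter_pts n (c1_pts hg j)). Qed.

Lemma x_free j n : (n < (q j).-1)%N -> x_ j n \notin P0 c0.
Proof.
rewrite x_iter => nq; have [/(cr_a hrel) [q0 _ h]|/(cr_b hrel) [_ _ h]] := ltnP j r; apply: h => /=.
  by rewrite -ltn_predRL.
by apply: (leq_trans nq); exact: leq_pred.
Qed.

Lemma x_U j n : (n < (q j).-1)%N -> U (x_ j n).
Proof. by move=> /x_free; apply: (mm_P hg); exact: (pts_P hg (x_pts j n)). Qed.

(** Shadowing: G is locally Lipschitz, so one-step errors o(t^k) accumulate to o(t^k). It is applied
    to almost invariant curves and to first-order expansions of orbits. *)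
Lemma orbit_expansion k (w : C -> 'rV[C]_nu) (y : nat -> C -> C) j N : (N <= (q j).-1)%N ->
  lo 0 (fun t => w t - c1) -> (forall n, (n < N)%N -> lo 0 (fun t => y n t - x_ j n)) ->
  (forall t, y 0 t = w t 0 j) ->
  (forall n, (n < N)%N -> lo k (fun t => G (w t) (y n t) - y n.+1 t)) ->
  lo k (fun t => iter N (G (w t)) (w t 0 j) - y N t).
Proof.
move=> + hw + hy0; elim: N => [|N IH] Nq hx hy.
  by apply: eq_lo (lo0 C k) => t; rewrite /= hy0 subrr.
have {IH} h : lo k (fun t => iter N (G (w t)) (w t 0 j) - y N t).
  apply: IH => [|n nN|n nN]; [exact: ltnW|apply: hx|apply: hy]; exact: ltnW.
have xU := x_U Nq.
have [K K0 [d d0 hd]] := sdiff_lipschitz (Gpair_diff1 hG xU) (Gpair_sdiff hg hG xU).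
have hz : lo 0 (fun t => iter N (G (w t)) (w t 0 j) - x_ j N).
  apply: eq_lo (loD (lo_leq (leq0n k) h) (hx N (ltnSn N))) => t.
  by rewrite addrA subrK.
have [d1 d10 hd1] := lo_small (lo_pair hw hz) d0.
have [d2 d20 hd2] := lo_small (lo_pair hw (hx N (ltnSn N))) d0.
have h2 : lo k (fun t => G (w t) (iter N (G (w t)) (w t 0 j)) - G (w t) (y N t)).
  apply: (@lo_le _ _ _ _ _ _ K) (lo_pair (lo0 'rV[C]_nu k) h).
  exists (Num.min d1 d2) => [|t]; first by rewrite lt_min d10.
  rewrite lt_min => /andP [/hd1 h1 /hd2 h2].
  have := hd (w t, iter N (G (w t)) (w t 0 j)) (w t, y N t) h1 h2.
  by rewrite -[(w t, _) - (w t, _)]/(w t - w t, iter N (G (w t)) (w t 0 j) - y N t) subrr.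
by apply: eq_lo (loD h2 (hy N (ltnSn N))) => t; rewrite addrA subrK iterS.
Qed.

(** Both terms of R_j follow [h] up to o(t^k), and the critical relation of g says that they end at
    [h t] of the same point. *)
Lemma curve_relation k h : germ g P h -> invariant_upto c0 g P p G k h ->
  lo k (fun t => F (motion_c1 c0 g h t)).
Proof.
move=> gh [hP hO]; apply: lo_row => j.
have expand N : (N <= (q j).-1)%N ->
    lo k (fun t => iter N (G (motion_c1 c0 g h t)) (motion_c1 c0 g h t 0 j) - h t (x_ j N)).
  move=> Nq; apply: (@orbit_expansion k (motion_c1 c0 g h) (fun n t => h t (x_ j n)) j N) => //.
  - exact: (row_germ hg gh).
  - by move=> n nN; apply: gh; exact: x_pts.
  - by move=> t; rewrite mxE.
  - move=> n nN; have nq := leq_trans nN Nq.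
    by apply: hO; [exact: x_pts|exact: x_free].
have h1 := expand _ (leqnn _).
have [jr|rj] := ltnP j r.
  have [q0 eq _] := cr_a hrel jr.
  rewrite x_iter prednK // eq in h1.
  have hp := hP (mu j); rewrite -eq -(prednK q0) -x_iter in hp.
  have {}hp := hp (x_pts _ _); rewrite x_iter prednK // eq in hp.
  by apply: eq_lo (loB h1 hp) => t; rewrite /F [relation_map _ _ _ _ _ _ _ _ _]mxE jr opprB addrA subrK.
have [/andP [l0 lq] eq _] := cr_b hrel rj.
have lq' : ((l j).-1 <= (q j).-1)%N by move: l0 lq; clear; lia.
have h2 := expand _ lq'.
have e : x_ j (q j).-1 = x_ j (l j).-1.
  by rewrite !x_iter !prednK // (leq_trans _ lq).
apply: eq_lo (loB h1 h2) => t.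
by rewrite /F [relation_map _ _ _ _ _ _ _ _ _]mxE ltnNge rj /= e opprB addrA subrK.
Qed.

(** For the solution v of [solve_vec], the equation A v = v amounts to ev v = u. The difference
    between v and the linearized orbit started at u satisfies a homogeneous equation, and the
    relation at the end of the orbit forces it to vanish. *)
Lemma kernel_lift (u : 'rV[C]_nu) : no_extra_multiplier_one c0 g P ->
  lo 1 (fun t => F (c1 + t *: u)) -> exists v : vec, A v = v /\ ev c0 v = u.
Proof.
move=> hno hF; have [v [v1 v2]] := solve_vec u hno.
have hw : lo 0 (fun t => c1 + t *: u - c1).
  have := @lo_monom R 'rV[C]_nu 0 1 u isT; apply: eq_lo => t; by rewrite expr1 addrC addKr.
exists v; suff evu : ev c0 v = u.
  split=> //; apply: at_pt_ext => x xp.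
  have [xP0|xP0] := boolP (x \in P0 c0).
    have [j xj] := mem_P0 xP0; rewrite xj in xp *.
    by rewrite (transfer_P0 hg hG) // evu v1.
  apply: (mulfI (mm_noncritical hg (pts_P hg xp) xP0)).
  by rewrite (transfer_other hg hG) // evu v2 // addrC addKr.
apply/rowP => j; rewrite mxE.
(* The derivative at t = 0 of the n-th iterate of the j-th entry of c1 + t u under G at the
   parameter c1 + t u. *)
pose a := fix a n : C := if n is m.+1 then
  'd (Gpair G) (c1, x_ j m) (u, 0) + derive1 g (x_ j m) * a m else u 0 j.
pose d n := at_pt v (x_ j n) - a n.
have dS n : (n < (q j).-1)%N -> d n.+1 = derive1 g (x_ j n) * d n.
  move=> nq; rewrite /d /= v2 ?x_pts ?x_free //.
  by move: (derive1 g _) (at_pt v _) (a n) => *; ring.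
have expand N : (N <= (q j).-1)%N ->
    lo 1 (fun t : C => iter N (G (c1 + t *: u)) ((c1 + t *: u) 0 j) - (x_ j N + t * a N)).
  move=> Nq; apply: (@orbit_expansion 1 (fun t => c1 + t *: u) (fun n t => x_ j n + t * a n) j N) => //.
  - move=> n nN; have := @lo_monom R C 0 1 (a n) isT; apply: eq_lo => t.
    by rewrite expr1 addrC addKr.
  - by move=> t; rewrite mxE [(t *: u) 0 j]mxE.
  - move=> n nN; have nU := x_U (leq_trans nN Nq).
    apply: eq_lo (Gpair_lo hG u (a n) nU) => t.
    by rewrite (dGpair hg hG) // -[in RHS]/(g (x_ j n)) opprD addrA.
suff : d 0 = 0 by move/eqP; rewrite subr_eq0 => /eqP.
have back N : (N <= (q j).-1)%N -> d N = 0 -> d 0 = 0.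
  move=> Nq; have [||_] := @transport d (c1 0 j) N (c1_pts hg j) => //.
    by move=> k kN; apply: x_free; exact: leq_trans Nq.
  by move=> k kN; apply: dS; exact: leq_trans Nq.
have h1 := expand _ (leqnn _); have hFj := lo_coord j hF.
apply: (back _ (leqnn _)).
have [jr|rj] := ltnP j r.
  have [q0 eq _] := cr_a hrel jr.
  have xq : x_ j (q j).-1 = c0 0 (mu j) by rewrite x_iter prednK.
  have h2 := lo_diff u (pcoord_diff1 hG (mu j)).
  have e : a (q j).-1 = 'd (pcoord p (mu j)) c1 u.
    apply/eqP; rewrite -subr_eq0; apply/eqP/lo_linear_eq0.
    apply: eq_lo (loD (loB hFj h1) h2) => t.
    rewrite /F [relation_map _ _ _ _ _ _ _ _ _]mxE jr xq /pcoord (ld_p_base hG) -/c1.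
    move: (iter _ _ _) (p _ _ _) (a _) ('d _ _ _) => z z' z1 z2.
    by rewrite -![_ *: _]/(_ * _); ring.
  by rewrite /d e xq v1 ?subrr // -xq; exact: x_pts.
have [/andP [l0 lq] eq _] := cr_b hrel rj.
have lq' : ((l j).-1 <= (q j).-1)%N by move: l0 lq; clear; lia.
have h2 := expand _ lq'.
have e : x_ j (q j).-1 = x_ j (l j).-1.
  by rewrite !x_iter !prednK // (leq_trans _ lq).
have ea : a (q j).-1 = a (l j).-1.
  apply/eqP; rewrite -subr_eq0; apply/eqP/lo_linear_eq0.
  apply: eq_lo (loD (loB hFj h1) h2) => t.
  rewrite /F [relation_map _ _ _ _ _ _ _ _ _]mxE ltnNge rj /= e.
  move: (iter _ _ _) (iter (l j).-1 _ _) (a _) (a (l j).-1) => z z' z1 z2.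
  by rewrite -![_ *: _]/(_ * _); ring.
(* One turn of the cycle multiplies d by its multiplier and also returns the same value; as the
   multiplier is not 1, d vanishes there. *)
have dql : d (q j).-1 = d (l j).-1 by rewrite /d e ea.
have xl : x_ j (l j).-1 = iter (l j) g (c0 0 j) by rewrite x_iter prednK.
have ql : (q j - l j + (l j).-1)%N = (q j).-1 by move: l0 lq; clear; lia.
have [||k1 _] := @transport (fun n => d (n + (l j).-1)%N) (x_ j (l j).-1) (q j - l j) (x_pts _ _).
- move=> k kq; have -> : iter k g (x_ j (l j).-1) = x_ j (k + (l j).-1)%N by rewrite /x_ iterD.
  by apply: x_free; rewrite -ql ltn_add2r.
- move=> k kq; have -> : iter k g (x_ j (l j).-1) = x_ j (k + (l j).-1)%N by rewrite /x_ iterD.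
  by apply: dS; rewrite -ql ltn_add2r.
move: k1; rewrite ql add0n dql xl => /eqP.
rewrite -subr_eq0 -{1}[d _]mul1r -mulrBl mulf_eq0 => /orP [|/eqP //].
by rewrite subr_eq0 eq_sym => /eqP /(hmult rj).
Qed.

(** When v vanishes at all c_{1,k}, the derivatives of p and G drop out of A v = v and the
    homogeneous equation remains. *)
Lemma ev_inj (v : vec) : no_extra_multiplier_one c0 g P -> A v = v -> ev c0 v = 0 -> v = 0.
Proof.
move=> hno Av ev0; apply: at_pt_ext => x xp; rewrite at_pt0.
apply: (kernel_zero hno) xp => [j jp|y yp yP0].
  by rewrite -Av (transfer_P0 hg hG) // ev0 linear0.
rewrite -{2}Av (transfer_other hg hG) // ev0.
have -> : ((0 : 'rV[C]_nu), (0 : C)) = 0 by [].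
by rewrite linear0 subr0.
Qed.

Lemma relation_near : exists2 rho : R, 0 < rho & forall w, nm (w - c1) < rho ->
  relation_domain U W G q w /\ differentiable F w.
Proof.
pose phi N j (w : 'rV[C]_nu) : C := iter N (G w) (w 0 j).
have near j N : (N <= (q j).-1)%N -> phi N j c1 = x_ j N /\
    exists2 rho : R, 0 < rho & forall w, nm (w - c1) < rho ->
      [/\ W w, forall k, (k < N)%N -> U (phi k j w) & differentiable (phi N j) w].
  elim: N => [|N IH] Nq.
    have [d d0 hd] := W_ball hG; split=> //; exists d => // w /hd Ww; split; [exact: Ww|by []|].
    exact: differentiable_coord.
  have [|e [d d0 hd]] := IH; first exact: ltnW.
  have xU := x_U Nq.
  have eS : phi N.+1 j c1 = x_ j N.+1.
    by rewrite -[LHS]/(G c1 (phi N j c1)) e (ld_G_base hG).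
  split; first exact: eS.
  have [r' r0 hr] := WU_ball hg hG xU.
  have [_ _ dphi] : [/\ W c1, forall k, (k < N)%N -> U (phi k j c1) & differentiable (phi N j) c1].
    by apply: hd; rewrite subrr nm0.
  have [d' d'0 hd'] := differentiable_near dphi r0.
  exists (Num.min d d') => [|w]; first by rewrite lt_min d0.
  rewrite lt_min => /andP [/hd [Ww hU dw] /hd' hw].
  have wU : U (phi N j w).
    have [] := hr (c1, phi N j w) => //.
    by rewrite -[(c1, _) - (c1, _)]/(c1 - c1, phi N j w - x_ j N) subrr nm_pair_lt nm0 r0 -e.
  split; [exact: Ww|by move=> k; rewrite ltnS leq_eqVlt => /orP [/eqP -> //|]; exact: hU|].
  apply: (@differentiable_comp _ _ _ _ (fun w => (w, phi N j w)) (Gpair G)).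
    by apply: differentiable_pair; [exact: differentiable_idm|exact: dw].
  exact: (Gpair_diff hG (wz := (w, phi N j w)) Ww wU).
have [|rho rho0 h] := @uniform_radius R _ _ (fun w => nm (w - c1)) (enum 'I_nu)
  (fun j w => [/\ W w, forall k, (k < (q j).-1)%N -> U (phi k j w) &
     differentiable (fun w => F w 0 j) w]).
  move=> j _; have [_ [d d0 hd]] := near j _ (leqnn _).
  have [jr|rj] := ltnP j r.
    exists d => // w /hd [Ww hU dw]; split; [exact: Ww|exact: hU|].
    have -> : (fun w => F w 0 j) = (fun w => phi (q j).-1 j w - pcoord p (mu j) w).
      by apply/funext => y; rewrite /F mxE jr.
    by apply: differentiableB; [exact: dw|exact: (pcoord_diff hG (mu j) Ww)].
  have [/andP [l0 lq] eq _] := cr_b hrel rj.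
  have lq' : ((l j).-1 <= (q j).-1)%N by move: l0 lq; clear; lia.
  have [_ [d' d'0 hd']] := near j _ lq'.
  exists (Num.min d d') => [|w]; first by rewrite lt_min d0.
  rewrite lt_min => /andP [/hd [Ww hU dw] /hd' [_ _ dw']]; split; [exact: Ww|exact: hU|].
  have -> : (fun w => F w 0 j) = (fun w => phi (q j).-1 j w - phi (l j).-1 j w).
    by apply/funext => y; rewrite /F mxE ltnNge rj.
  by apply: differentiableB; [exact: dw|exact: dw'].
have [d d0 hd] := W_ball hG.
exists (Num.min rho d) => [|w]; first by rewrite lt_min rho0.
rewrite lt_min => /andP [hw /hd Ww]; split.
  split; first exact: Ww.
  by move=> j; have [] := h j w (mem_enum _ j) hw.
by apply: differentiable_row => j; have [] := h j w (mem_enum _ j) hw.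
Qed.
Lemma ev_linear : linear (@ev R nu c0 g P : vec -> 'rV[C]_nu).
Proof.
by move=> a u v; apply/rowP => j; rewrite !mxE at_pt_linear.
Qed.

Lemma fixedD (a : C) (v1 v2 : vec) : A v1 = v1 -> A v2 = v2 -> A (v1 + a *: v2) = v1 + a *: v2.
Proof. by move=> h1 h2; rewrite linearD linearZ /= h1 h2. Qed.

Lemma evD (a : C) (v1 v2 : vec) : ev c0 (v1 + a *: v2) = ev c0 v1 + a *: ev c0 v2.
Proof. by rewrite addrC ev_linear addrC. Qed.

Let mc := @motion_c1 R nu c0 g.
Let E : {vspace vec} := passmx.leigenspace A 1.

Lemma leigenspace1P (v : vec) : v \in E <-> A v = v.
Proof.
rewrite /E /passmx.leigenspace memv_ker add_lfunE opp_lfunE scale_lfunE id_lfunE scale1r subr_eq0.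
by split=> /eqP.
Qed.

Lemma relation_diff : differentiable F c1.
Proof. by have [rho rho0 h] := relation_near; apply: (h c1 _).2; rewrite subrr nm0. Qed.

(** The constant motion is invariant, and a [lo] function vanishes at t = 0. *)
Lemma relation_base : F c1 = 0.
Proof.
have [hP hO] := const_defect hg hG 1.
have inv : invariant_upto c0 g P p G 1 (fun _ x => x).
  split=> [j jp|x xp xP0].
    by apply: eq_lo (hP j jp) => t; rewrite mulr0 subr0.
  by apply: eq_lo (hO x xp xP0) => t; rewrite !mulr0 addr0.
have := lo0_at0 (curve_relation (curve_germ (const_curve (g := g) (P := P))) inv).
suff -> : motion_c1 c0 g (fun _ x => x) 0 = c1 by [].
by apply/rowP => j; rewrite mxE.
Qed.

Lemma curve_tangent h (v : vec) : germ g P h -> invariant_upto c0 g P p G 1 h ->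
  (forall x, x \in pts -> lo 1 (fun t => h t x - x - t * at_pt v x)) ->
  lo 1 (fun t => mc h t - c1 - t *: ev c0 v) /\ 'd F c1 (ev c0 v) = 0.
Proof.
move=> gh ih hv.
have k1 : lo 1 (fun t => mc h t - c1 - t *: ev c0 v).
  by apply: lo_row => j; apply: eq_lo (hv _ (c1_pts hg j)) => t; rewrite !mxE.
split=> //; have [rho rho0 hF] := relation_near.
have sd := @sdiff_row R _ _ F c1 rho rho0 (fun z hz => (hF z hz).2).
have hc : lo 0 (fun _ : C => c1 - c1) by apply: eq_lo (lo0 _ 0) => t; rewrite subrr.
have k2 : lo 1 (fun t => mc h t - c1 - t ^+ 1 *: ev c0 v).
  by apply: eq_lo k1 => t; rewrite expr1.
have h1 := sdiff_lo (diff_continuous relation_diff) sd (row_germ hg gh) hc k2.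
apply: lo_linear_eq0.
apply: eq_lo (loB (curve_relation gh ih) h1) => t.
by rewrite -/mc -/c1 relation_base subr0 expr1 subKr.
Qed.

Hypothesis hno : no_extra_multiplier_one c0 g P.
Variable ad : C -> Prop.
Hypothesis had : admissible c0 U g P W p G ad.

Lemma tangent_curves k (v : vec) : A v = v -> (forall x, x \in pts -> ad (at_pt v x)) ->
  exists y : C -> 'rV[C]_nu, lo 1 (fun t => y t - c1 - t *: ev c0 v) /\ lo k (fun t => F (y t)).
Proof.
move=> Av adv.
have [h [ch ih hv _]] := invariant_curve hg hG (ad_lift had) (ad_pts had) (ad_add had)
  (ad_mul had) (ad_defect had) (ad_solve had) k Av adv.
have gh := curve_germ ch; exists (mc h); split.
  apply: (curve_tangent gh _ hv).1; case: ih => i1 i2; split=> [j jp|x xp xP0].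
    by apply: lo_leq (i1 j jp).
  by apply: lo_leq (i2 x xp xP0).
by apply: lo_leq (curve_relation gh ih).
Qed.

Lemma eigenvector_tangent (v : vec) : A v = v -> 'd F c1 (ev c0 v) = 0.
Proof.
have real_case (v' : vec) : A v' = v' -> (forall x, x \in pts -> ad (at_pt v' x)) ->
    'd F c1 (ev c0 v') = 0.
  move=> Av adv.
  have [h [ch ih hv _]] := invariant_curve hg hG (ad_lift had) (ad_pts had) (ad_add had)
    (ad_mul had) (ad_defect had) (ad_solve had) 0 Av adv.
  exact: (curve_tangent (curve_germ ch) ih hv).2.
move=> Av; have [v1 [v2 [ev12 ad12 /(_ Av) [Av1 Av2]]]] := ad_split had v.
rewrite ev12 evD linearD linearZ /=.
rewrite (real_case v1 Av1) => [|x /ad12 []//]; rewrite (real_case v2 Av2) => [|x /ad12 []//].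
by rewrite scaler0 addr0.
Qed.

Let L : 'M[C]_nu := lin1_mx ('d F c1).

Lemma diff_relation_mx u : 'd F c1 u = u *m L.
Proof. exact: (esym (mul_rV_lin1 ('d F c1) u)). Qed.

Lemma tangent_eigenvector (u : 'rV[C]_nu) : u *m L = 0 -> exists v : vec, A v = v /\ ev c0 v = u.
Proof.
rewrite -diff_relation_mx => uL; apply: (kernel_lift hno).
apply: eq_lo (lo_diff u relation_diff) => t.
by rewrite -/c1 relation_base subr0 uL scaler0 subr0.
Qed.

(** [ev] is an isomorphism from the eigenspace onto the kernel of the derivative: the rows of [M],
    images of a basis, span the kernel by [eigenvector_tangent] and [tangent_eigenvector], and are
    independent by [ev_inj]. *)
Lemma relation_corank : (nu - \rank L)%N = \dim E.
Proof.
pose M : 'M[C]_(\dim E, nu) := \matrix_i ev c0 (vbasis E)`_i.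
have rowM c : c *m M = ev c0 (\sum_i c 0 i *: (vbasis E)`_i).
  rewrite mulmx_sum_row -[RHS]/(mklin ev_linear _) linear_sum.
  by apply: eq_bigr => i _; rewrite linearZ rowK.
have bE i : (vbasis E)`_i \in E.
  have [ilt|ige] := ltnP i (size (vbasis E)); last by rewrite nth_default // mem0v.
  by apply: vbasis_mem; exact: mem_nth.
have eM : (M :=: kermx L)%MS.
  apply/eqmxP/andP; split.
    apply/row_subP => i; apply/sub_kermxP; rewrite rowK -diff_relation_mx.
    by apply: eigenvector_tangent; apply/leigenspace1P.
  apply/row_subP => i; have : row i (kermx L) *m L = 0 by apply/sub_kermxP; exact: row_sub.
  move=> /tangent_eigenvector [v [/leigenspace1P vE <-]].
  rewrite (coord_vbasis vE).
  have -> : \sum_(i < \dim E) coord (vbasis E) i v *: (vbasis E)`_i =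
    \sum_i (\row_i coord (vbasis E) i v) 0 i *: (vbasis E)`_i.
    by apply: eq_bigr => j _; rewrite mxE.
  by rewrite -rowM submxMl.
have freeM : row_free M.
  apply: inj_row_free => c; rewrite rowM => h.
  have sE : \sum_i c 0 i *: (vbasis E)`_i \in E by apply: memv_suml => i _; exact: memvZ.
  have s0 := ev_inj hno ((leigenspace1P _).1 sE) h.
  have /freeP /(_ (fun i => c 0 i) s0) h0 := basis_free (vbasisP E).
  by apply/rowP => i; rewrite h0 mxE.
by rewrite -mxrank_ker -eM; apply/eqP.
Qed.

(** The directions [T] are the images under [ev] of the admissible fixed vectors. They contain u1 +
    j u2 for natural j, because admissibility is stable under sums and real multiples. *)
Lemma relation_submanifold : exists W' : set 'rV[C]_nu,
  [/\ open W', W' c1, W' `<=` relation_domain U W G q &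
   submanifold W' (\dim E) [set w | W' w /\ F w = 0]].
Proof.
have [rho rho0 hF] := relation_near.
have [|u|V [oV Vc Vr Vs]] := zero_set_submanifold (L := L) (T := fun u => exists v : vec,
  [/\ A v = v, forall x, x \in pts -> ad (at_pt v x) & u = ev c0 v])
  rho0 (fun z hz => (hF z hz).2) diff_relation_mx.
- move=> u [v [Av adv ->]]; split; first by rewrite -diff_relation_mx eigenvector_tangent.
  by move=> k; exact: tangent_curves.
- move=> /tangent_eigenvector [v [Av <-]].
  have [v1 [v2 [ev12 ad12 /(_ Av) [Av1 Av2]]]] := ad_split had v.
  exists (ev c0 v1), (ev c0 v2); split.
    by rewrite [in LHS]ev12; exact: evD.
  move=> j; exists (v1 + j%:R *: v2); split.
  - exact: fixedD.
  - move=> x xp; have [h1 h2] := ad12 x xp; rewrite at_ptD at_ptZ.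
    by apply: (ad_add had) => //; apply: (ad_mul had) => //; exact: realn.
  - exact: (esym (evD _ _ _)).
exists V; split=> //; last by rewrite -relation_corank.
by move=> w /Vr /hF [].
Qed.
End Relations.

Theorem theorem6p1 (R : realType) (nu : nat) (c0 : 'rV[cplx R]_nu)
    (U : set (cplx R)) (g : cplx R -> cplx R) (P : {fset cplx R})
    (W : set 'rV[cplx R]_nu) (p : 'rV[cplx R]_nu -> 'rV[cplx R]_nu)
    (G : 'rV[cplx R]_nu -> cplx R -> cplx R)
    (r : nat) (q l : 'I_nu -> nat) (mu : 'I_nu -> 'I_nu)
    (hg : marked_map c0 U g P)
    (hG : local_deformation c0 U g W p G)
    (hrel : critical_relations c0 g r q l mu)
    (hlift : lifting_property c0 U g P W p G \/
       (real_deformation c0 U g P W p G /\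
        real_lifting_property c0 U g P W p G))
    (hmult : forall j : 'I_nu, (r <= j)%N ->
       derive1 (iter (q j - l j) g) (iter (l j) g (c0 0 j)) <> 1) :
  (forall a : cplx R,
     passmx.leigenvalue (transfer c0 g P p G) a -> `|a| <= 1) /\
  (no_extra_multiplier_one c0 g P ->
   exists W' : set 'rV[cplx R]_nu,
     [/\ open W', W' (crit c0 g 1), W' `<=` relation_domain U W G q &
      submanifold W' (\dim (passmx.leigenspace (transfer c0 g P p G) 1))
        [set w | W' w /\ relation_map p G r q l mu w = 0]]).
Proof.
have [ad had] := admissible_exists hg hG hlift; split=> [a /(eigenvalue_bound hg hG had)|hno].
  by rewrite nmE -(rmorph1 (@real_complex R)) lecR.
exact: (relation_submanifold hg hG hrel hmult hno had).
Qed.
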